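(* Let $0<q<1$. For generic parameters $a,b,c,u\in\mathbb{C}^\times=\mathbb{C}\setminus\{0\}$ with $q<|u|<1$ and $|a|,|b|,|c|<1$, $$\frac{1}{4\pi i}\int_{\mathbb{T}}\frac{(x^2,1/x^2;q)_{\infty}}{(ax,a/x,bx,b/x,cx,c/x;q)_{\infty}\,\theta(ux,u/x)}\frac{dx}{x}+\sum_{k=1}^\infty\underset{x=uq^{-k}}{\mathrm{Res}}\left(\frac{(x^2,1/x^2;q)_{\infty}}{(ax,a/x,bx,b/x,cx,c/x;q)_{\infty}\,\theta(ux,u/x)\,x}\right)=\frac{1}{(q,ab,ac,bc;q)_{\infty}}\,\frac{\theta(abcu)}{\theta(au,bu,cu)}.$$
   Context: $(x;q)_\infty=\prod_{i\ge0}(1-xq^i)$, $(x_1,\dots,x_r;q)_\infty=\prod_i(x_i;q)_\infty$, $\theta(x)=(x,q/x;q)_\infty$, $\theta(x_1,\dots,x_r)=\prod_i\theta(x_i)$; $\mathbb{T}$ is the counterclockwise oriented unit circle in the complex plane. ''Generic'' means that the parameters avoid the exceptional proper subvarieties on which some expression involved is ill-defined (e.g. vanishing denominators) or on which poles at which residues are taken fail to be simple. *)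

(* Defs.v *)
From Stdlib Require Import Reals List.
From Coquelicot Require Import Coquelicot.
Import ListNotations.
Open Scope C_scope.

Definition Cprod (l : list C) : C := fold_right Cmult (RtoC 1) l.

(* [lim] is a total function; for |q| < 1 the partial products do converge. *)
Definition qpoch (q : R) (x : C) : C :=
  lim (T := C_CompleteNormedModule)
    (filtermap (fun n : nat => Cprod (map (fun i : nat => 1 - x * q ^ i) (seq 0 n)))
       eventually).

Definition qpochs (q : R) (xs : list C) : C := Cprod (map (qpoch q) xs).

Definition theta (q : R) (x : C) : C := qpochs q [x; q / x].

Definition thetas (q : R) (xs : list C) : C := Cprod (map (theta q) xs).

Definition expi (t : R) : C := (cos t, sin t).

(* [l] is the integral of [f z dz] over the counterclockwise circle [z = z0 + r e^(it)],
   where [dz = i r e^(it) dt]. *)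
Definition is_circle_int (f : C -> C) (z0 : C) (r : R) (l : C) : Prop :=
  is_RInt (V := C_R_NormedModule)
    (fun t : R => f (z0 + r * expi t) * (Ci * r * expi t)) 0%R (2 * PI)%R l.

(* [f] is holomorphic on a punctured disc around [z0], and [l] is 1/(2 pi i) times its
   integral over every small circle around [z0]. *)
Definition is_residue (f : C -> C) (z0 l : C) : Prop :=
  exists eps : posreal,
    (forall z : C, (0 < Cmod (z - z0) < eps)%R ->
       ex_derive (K := C_AbsRing) (V := C_NormedModule) f z) /\
    (forall r : R, (0 < r < eps)%R ->
       is_circle_int f z0 r (2 * PI * Ci * l)).

Definition integrand (q : R) (a b c u x : C) : C :=
  qpochs q [x ^ 2; 1 / x ^ 2] /
  (qpochs q [a * x; a / x; b * x; b / x; c * x; c / x] *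
   thetas q [u * x; u / x] * x).

(* Main.v *)
Require Import Defs.
From Stdlib Require Import Reals List Lra Lia.
From Coquelicot Require Import Coquelicot.
Import ListNotations.
Open Scope C_scope.

(** Write R(a) for the left-hand side. The weight satisfies
    (1 - ab)(1 - ac) w_a(x) - bc w_{aq}(x) = g(x) - g(qx) for an explicit g; moving the circle
    |x| = 1 to |x| = q picks up the residues of g at u and q/u, which cancel against the
    telescoping sum of residues, so (1 - ab)(1 - ac) R(a) = bc R(aq). Iterating,
    R(a) = lim (bc)^n R(a q^n) / (ab, ac; q)_n. In this limit the integral disappears, and the
    residue sum becomes the bilateral series sum_i (bc)^i / (a u q^i; q)_oo, the case b = 0 of
    Ramanujan's 1psi1 sum. *)

(** Away from its poles, g(x) = w_a(x) (1 - a/x)(1 - b/x)(1 - c/x) / (1 - x^(-2)). The weight is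
    invariant under x -> 1/x and g(qx) = - g(1/x), so g(x) - g(qx) is a symmetrisation in which the
    poles at x = 1 and x = -1 cancel. Both u and q/u lie in the annulus q < |x| < 1 and give the
    same residue; the factor 1/2 contained in 1/(4 pi i) is what allows the single sequence u q^(-k)
    to balance the pair. The residues survive the limit in which the integral dies because, for a
    q^n in place of a, the growing a-product at u q^(-k) depends on n - k only, while (bc)^n meets a
    growth of order (bc)^(-k). The bulk of the sum therefore travels with k close to n, and
    recentring at k = n makes it bilateral. On the analytic side, infinite products enter as Euler's
    power series, hence as entire functions, and residue calculus is needed for circles only: it
    rests on the fact that the mean of a holomorphic function over a circle does not depend on the
    radius. *)

(** * Limits, continuity and absolutely convergent series in C *)

(* Coquelicot equips [C] with two uniform structures that are not convertible: the one of
   [Cmod], used for continuity and derivatives here, and the product one, [C_UniformSpace], in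
   which [C_NormedModule] states series and derivatives. *)
Notation CU := (AbsRing_UniformSpace C_AbsRing).
Notation CN := (AbsRing_NormedModule C_AbsRing).

Definition Clim (x : nat -> C) (l : C) : Prop :=
  @filterlim nat CU x eventually (@locally CU l).

Definition Ccont (f : C -> C) (z : C) : Prop := @continuous CU CU f z.

Lemma Clim_eps (x : nat -> C) (l : C) :
  Clim x l <->
  forall eps : R, (0 < eps)%R ->
    exists N : nat, forall n : nat, (N <= n)%nat -> (Cmod (x n - l) < eps)%R.
Proof.
  split.
  - intros H eps Heps.
    exact (proj1 (filterlim_locally (U := CU) x l) H (mkposreal eps Heps)).
  - intros H. apply (proj2 (filterlim_locally (U := CU) x l)).
    intros [eps Heps]. exact (H eps Heps).
Qed.

Lemma Ccont_eps (f : C -> C) (z : C) :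
  Ccont f z <->
  forall eps : R, (0 < eps)%R -> exists d : R, (0 < d)%R /\
    forall w : C, (Cmod (w - z) < d)%R -> (Cmod (f w - f z) < eps)%R.
Proof.
  split.
  - intros H eps Heps.
    destruct (proj1 (filterlim_locally (U := CU) f (f z)) H (mkposreal eps Heps)) as [d Hd].
    exists d. split; [apply cond_pos | exact Hd].
  - intros H. apply (proj2 (filterlim_locally (U := CU) f (f z))).
    intros [eps Heps]. destruct (H eps Heps) as [d [Hd Hw]].
    exists (mkposreal d Hd). exact Hw.
Qed.

Lemma Clim_unique (x : nat -> C) (l l' : C) : Clim x l -> Clim x l' -> l = l'.
Proof. exact (@filterlim_locally_unique nat C_AbsRing CN eventually _ x l l'). Qed.

Lemma Clim_const (c : C) : Clim (fun _ => c) c.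
Proof. exact (@filterlim_const nat CU eventually _ c). Qed.

Lemma Clim_ext (x y : nat -> C) (l : C) : (forall n, x n = y n) -> Clim x l -> Clim y l.
Proof. exact (fun H => @filterlim_ext nat CU eventually _ _ x y H). Qed.

Lemma Clim_eq (x : nat -> C) (l l' : C) : Clim x l -> l = l' -> Clim x l'.
Proof. now intros H <-. Qed.

Lemma Clim_plus (x y : nat -> C) (l m : C) :
  Clim x l -> Clim y m -> Clim (fun n => x n + y n) (l + m).
Proof.
  intros Hx Hy.
  refine (@filterlim_comp_2 _ _ _ _ _ _ _ _ _ x y Cplus Hx Hy _).
  exact (@filterlim_plus C_AbsRing CN l m).
Qed.

Lemma Clim_mult (x y : nat -> C) (l m : C) :
  Clim x l -> Clim y m -> Clim (fun n => x n * y n) (l * m).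
Proof.
  intros Hx Hy.
  refine (@filterlim_comp_2 _ _ _ _ _ _ _ _ _ x y Cmult Hx Hy _).
  exact (@filterlim_mult C_AbsRing l m).
Qed.

Lemma Clim_comp (f : C -> C) (x : nat -> C) (l : C) :
  Ccont f l -> Clim x l -> Clim (fun n => f (x n)) (f l).
Proof. intros Hf Hx. exact (filterlim_comp _ _ _ x f _ _ _ Hx Hf). Qed.

Lemma Clim_subseq (x : nat -> C) (l : C) (s : nat -> nat) :
  (forall n, (n <= s n)%nat) -> Clim x l -> Clim (fun n => x (s n)) l.
Proof.
  intros Hs. rewrite !Clim_eps. intros H eps Heps.
  destruct (H eps Heps) as [N HN]. exists N. intros n Hn. apply HN.
  specialize (Hs n). lia.
Qed.

Lemma Clim_shift (x : nat -> C) (l : C) : Clim (fun n => x (S n)) l -> Clim x l.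
Proof.
  rewrite !Clim_eps. intros H eps Heps.
  destruct (H eps Heps) as [N HN]. exists (S N). intros [|n] Hn; [lia|].
  apply HN. lia.
Qed.

Lemma Ccont_ext_loc (f g : C -> C) (z : C) :
  @locally CU z (fun w => f w = g w) -> Ccont f z -> Ccont g z.
Proof. exact (@continuous_ext_loc CU CU g f z). Qed.

Lemma Ccont_mult (f g : C -> C) (z : C) :
  Ccont f z -> Ccont g z -> Ccont (fun w => f w * g w) z.
Proof. exact (@continuous_mult CU C_AbsRing f g z). Qed.

Lemma Ccont_plus (f g : C -> C) (z : C) :
  Ccont f z -> Ccont g z -> Ccont (fun w => f w + g w) z.
Proof. exact (@continuous_plus CU C_AbsRing CN f g z). Qed.

Lemma Ccont_const (c z : C) : Ccont (fun _ => c) z.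
Proof. exact (@continuous_const CU CU c z). Qed.

Lemma Ccont_id (z : C) : Ccont (fun w => w) z.
Proof. exact (@continuous_id CU z). Qed.

Lemma Ccont_comp (f g : C -> C) (z : C) :
  Ccont f z -> Ccont g (f z) -> Ccont (fun w => g (f w)) z.
Proof. exact (@continuous_comp CU CU CU f g z). Qed.

Lemma Cmod_lower_triangle (x y : C) : (Cmod x - Cmod (y - x) <= Cmod y)%R.
Proof.
  generalize (Cmod_triangle y (- (y - x))). rewrite Cmod_opp.
  replace (y + - (y - x)) with x by ring. lra.
Qed.

Lemma Ccont_inv (z : C) : z <> 0 -> Ccont (fun w => / w) z.
Proof.
  intros Hz. apply Ccont_eps. intros eps Heps.
  assert (Hm : (0 < Cmod z)%R) by now apply Cmod_gt_0.
  (* The first bound keeps |w| above |z|/2; the second then makes |w - z| / (|w| |z|) smaller than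
     eps. *)
  exists (Rmin (Cmod z / 2) (eps * (Cmod z * Cmod z) / 2)). split.
  { apply Rmin_pos; [lra|]. apply Rdiv_lt_0_compat; [|lra].
    repeat apply Rmult_lt_0_compat; assumption. }
  intros w Hw.
  assert (H1 := Rlt_le_trans _ _ _ Hw (Rmin_l _ _)).
  assert (H2 := Rlt_le_trans _ _ _ Hw (Rmin_r _ _)).
  assert (H3 := Cmod_lower_triangle z w).
  assert (Hmw : (Cmod z / 2 < Cmod w)%R) by lra.
  assert (Hw0 : w <> 0) by (apply Cmod_gt_0; lra).
  replace (/ w - / z) with (- (w - z) * / (w * z)) by (field; auto).
  rewrite Cmod_mult, Cmod_opp, Cmod_inv, Cmod_mult by now apply Cmult_neq_0.
  apply Rmult_lt_reg_r with (Cmod w * Cmod z)%R; [apply Rmult_lt_0_compat; lra|].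
  rewrite Rmult_assoc, Rinv_l, Rmult_1_r
    by (apply Rmult_integral_contrapositive_currified; lra).
  apply Rlt_trans with (1 := H2).
  assert (0 < eps * Cmod z)%R by (apply Rmult_lt_0_compat; lra). nra.
Qed.

Lemma Ccont_nonzero (f : C -> C) (z : C) :
  Ccont f z -> f z <> 0 -> @locally CU z (fun w => f w <> 0).
Proof.
  intros Hf Hz. apply Cmod_gt_0 in Hz.
  destruct (proj1 (Ccont_eps f z) Hf _ Hz) as [d [Hd Hw]].
  exists (mkposreal d Hd). intros w Hb. apply Cmod_gt_0.
  generalize (Hw w Hb) (Cmod_lower_triangle (f z) (f w)). lra.
Qed.

Lemma Clim_inv (x : nat -> C) (l : C) : l <> 0 -> Clim x l -> Clim (fun n => / x n) (/ l).
Proof. intros Hl. apply Clim_comp. now apply Ccont_inv. Qed.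

Lemma Clim_bounded (x : nat -> C) (l : C) :
  Clim x l -> exists K : R, forall n, (Cmod (x n) <= K)%R.
Proof.
  intros H. destruct (proj1 (Clim_eps x l) H 1%R Rlt_0_1) as [N HN].
  assert (Hfin : exists K, forall n, (n < N)%nat -> (Cmod (x n) <= K)%R).
  { clear HN. induction N as [|N [K HK]].
    - exists 0%R. lia.
    - exists (Rmax K (Cmod (x N))). intros n Hn.
      destruct (Nat.eq_dec n N) as [->|Hne]; [apply Rmax_r|].
      apply Rle_trans with K; [apply HK; lia | apply Rmax_l]. }
  destruct Hfin as [K HK]. exists (Rmax K (Cmod l + 1)). intros n.
  destruct (Nat.lt_ge_cases n N) as [Hn|Hn].
  - apply Rle_trans with K; [now apply HK | apply Rmax_l].
  - apply Rle_trans with (2 := Rmax_r _ _).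
    generalize (HN n Hn) (Cmod_triangle l (x n - l)).
    replace (l + (x n - l)) with (x n) by ring. lra.
Qed.

Lemma Clim_le (x : nat -> C) (l : C) (K : R) :
  (forall n, (Cmod (x n) <= K)%R) -> Clim x l -> (Cmod l <= K)%R.
Proof.
  intros HK H. apply Rle_plus_epsilon. intros eps Heps.
  destruct (proj1 (Clim_eps x l) H eps Heps) as [N HN].
  generalize (HN N (le_n N)) (HK N) (Cmod_lower_triangle l (x N)). lra.
Qed.

Lemma Clim_squeeze0 (x : nat -> C) (y : nat -> R) :
  (forall n, (Cmod (x n) <= y n)%R) -> is_lim_seq y 0%R -> Clim x 0.
Proof.
  intros Hxy Hy. apply Clim_eps. intros eps Heps.
  destruct (proj2 (is_lim_seq_spec y 0%R) Hy (mkposreal eps Heps)) as [N HN].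
  exists N. intros n Hn. specialize (HN n Hn). simpl in HN.
  replace (x n - 0) with (x n) by ring.
  apply Rle_lt_trans with (1 := Hxy n). rewrite Rminus_0_r in HN.
  apply Rle_lt_trans with (2 := HN). apply Rle_abs.
Qed.

Lemma Clim_Cmod (x : nat -> C) (l : C) : Clim x l -> is_lim_seq (fun n => Cmod (x n)) (Cmod l).
Proof.
  intros H. exact (filterlim_comp _ _ _ x (@norm C_AbsRing CN) _ _ _ H
    (@filterlim_norm C_AbsRing CN l)).
Qed.

Lemma Clim_pow0 (z : C) : (Cmod z < 1)%R -> Clim (fun n => z ^ n) 0.
Proof.
  intros Hz. apply Clim_squeeze0 with (fun n => Cmod z ^ n)%R.
  - intros n. rewrite Cmod_pow. apply Rle_refl.
  - apply is_lim_seq_geom. rewrite Rabs_pos_eq; [assumption | apply Cmod_ge_0].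
Qed.

(** * Absolutely convergent complex series *)

Definition summable (x : nat -> C) : Prop := ex_series (fun n => Cmod (x n)).

(** A total function, so that sums can be written and rewritten without a convergence proof; its
    value is meaningful under [summable]. *)
Definition Csum (x : nat -> C) : C :=
  (Series (fun n => fst (x n)), Series (fun n => snd (x n))).

Lemma locally_C_iff (l : C) (P : C -> Prop) :
  @locally CU l P <-> @locally C_UniformSpace l P.
Proof. symmetry. apply locally_C. Qed.

Lemma is_series_Clim (x : nat -> C) (l : C) :
  is_series (K := C_AbsRing) (V := C_NormedModule) x l <->
  Clim (fun n => @sum_n C_AbelianMonoid x n) l.
Proof.
  split; intros H P HP; apply H; now apply locally_C_iff.
Qed.

Lemma Csum_correct (x : nat -> C) :
  summable x -> is_series (K := C_AbsRing) (V := C_NormedModule) x (Csum x).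
Proof.
  intros H.
  destruct (@ex_series_le C_AbsRing C_CompleteNormedModule x _ (fun n => Rle_refl _) H) as [l Hl].
  replace (Csum x) with l; [exact Hl|].
  assert (Hf : forall n, fst (@sum_n C_AbelianMonoid x n) = sum_n (fun n => fst (x n)) n
             /\ snd (@sum_n C_AbelianMonoid x n) = sum_n (fun n => snd (x n)) n).
  { induction n as [|n [H1 H2]]; [rewrite !sum_O; auto|].
    rewrite !sum_Sn. split; [rewrite <- H1 | rewrite <- H2]; reflexivity. }
  unfold Csum. rewrite (surjective_pairing l). f_equal; symmetry; apply is_series_unique.
  - apply (@filterlim_ext nat R_UniformSpace eventually _ _ (fun n => fst (@sum_n C_AbelianMonoid x n))).
    { intros n. apply Hf. }
    (* A ball of [C_UniformSpace] is a product of balls, so the limit passes to each coordinate. *)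
    intros P [e He]. apply (Hl (fun z => P (fst z))).
    exists e. intros y Hy. apply He, Hy.
  - apply (@filterlim_ext nat R_UniformSpace eventually _ _ (fun n => snd (@sum_n C_AbelianMonoid x n))).
    { intros n. apply Hf. }
    intros P [e He]. apply (Hl (fun z => P (snd z))).
    exists e. intros y Hy. apply He, Hy.
Qed.

Lemma Csum_unique (x : nat -> C) (l : C) :
  summable x -> is_series (K := C_AbsRing) (V := C_NormedModule) x l -> Csum x = l.
Proof.
  intros Hx Hl. apply Csum_correct in Hx. rewrite is_series_Clim in Hx, Hl.
  exact (Clim_unique _ _ _ Hx Hl).
Qed.

Lemma summable_ext (x y : nat -> C) : (forall n, x n = y n) -> summable x -> summable y.
Proof. intros H. apply ex_series_ext. intros n. now rewrite H. Qed.

Lemma summable_le (x : nat -> C) (y : nat -> R) :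
  (forall n, (Cmod (x n) <= y n)%R) -> ex_series y -> summable x.
Proof.
  intros H. apply (@ex_series_le R_AbsRing R_CompleteNormedModule).
  intros n. change (Rabs (Cmod (x n)) <= y n)%R.
  rewrite Rabs_pos_eq by apply Cmod_ge_0. apply H.
Qed.

Lemma summable_scal (c : C) (x : nat -> C) : summable x -> summable (fun n => c * x n).
Proof.
  intros H. apply summable_le with (fun n => scal (Cmod c) (Cmod (x n))).
  - intros n. rewrite Cmod_mult. apply Rle_refl.
  - now apply (@ex_series_scal_l R_AbsRing).
Qed.

Lemma summable_plus (x y : nat -> C) :
  summable x -> summable y -> summable (fun n => x n + y n).
Proof.
  intros Hx Hy. apply summable_le with (fun n => plus (Cmod (x n)) (Cmod (y n))).
  - intros n. apply Cmod_triangle.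
  - now apply (@ex_series_plus R_AbsRing R_NormedModule).
Qed.

Lemma summable_incr_1 (x : nat -> C) : summable x <-> summable (fun n => x (S n)).
Proof. apply (@ex_series_incr_1 R_AbsRing R_NormedModule). Qed.

Lemma Csum_ext (x y : nat -> C) : (forall n, x n = y n) -> Csum x = Csum y.
Proof. intros H. unfold Csum. f_equal; apply Series_ext; intros n; now rewrite H. Qed.

Lemma Csum_plus (x y : nat -> C) :
  summable x -> summable y -> Csum (fun n => x n + y n) = Csum x + Csum y.
Proof.
  intros Hx Hy. apply Csum_unique; [now apply summable_plus|].
  apply (@is_series_plus C_AbsRing C_NormedModule); now apply Csum_correct.
Qed.

Lemma Csum_scal (c : C) (x : nat -> C) :
  summable x -> Csum (fun n => c * x n) = c * Csum x.
Proof.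
  intros Hx. apply Csum_unique; [now apply summable_scal|].
  apply (@is_series_scal C_AbsRing C_NormedModule); now apply Csum_correct.
Qed.

Lemma Csum_minus (x y : nat -> C) :
  summable x -> summable y -> Csum (fun n => x n - y n) = Csum x - Csum y.
Proof.
  intros Hx Hy.
  rewrite (Csum_ext _ (fun n => x n + (-(1)) * y n)) by (intros; ring).
  rewrite Csum_plus, Csum_scal by (try apply summable_scal; assumption). ring.
Qed.

Lemma Csum_incr_1 (x : nat -> C) : summable x -> Csum x = x O + Csum (fun n => x (S n)).
Proof.
  intros Hx. apply Csum_unique; [assumption|].
  apply (@is_series_decr_1 C_AbsRing C_NormedModule).
  change (is_series (K := C_AbsRing) (V := C_NormedModule) (fun n => x (S n))
    (x O + Csum (fun n => x (S n)) + - x O)).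
  replace (x O + Csum (fun n => x (S n)) + - x O) with (Csum (fun n => x (S n))) by ring.
  apply Csum_correct. now apply summable_incr_1 in Hx.
Qed.

Lemma Cmod_sum_n (x : nat -> C) (n : nat) :
  (Cmod (@sum_n C_AbelianMonoid x n) <= sum_n (fun k => Cmod (x k)) n)%R.
Proof.
  induction n as [|n IH]; [rewrite !sum_O; apply Rle_refl|].
  rewrite !sum_Sn. eapply Rle_trans; [apply Cmod_triangle|].
  apply Rplus_le_compat_r. exact IH.
Qed.

Lemma Cmod_Csum (x : nat -> C) :
  summable x -> (Cmod (Csum x) <= Series (fun n => Cmod (x n)))%R.
Proof.
  intros Hx. apply (Clim_le (fun n => @sum_n C_AbelianMonoid x n)).
  - intros n. eapply Rle_trans; [apply Cmod_sum_n|].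
    apply Series_correct in Hx.
    apply (is_lim_seq_incr_compare (sum_n (fun k => Cmod (x k))) _ Hx).
    intros m. rewrite sum_Sn. change plus with Rplus. generalize (Cmod_ge_0 (x (S m))). lra.
  - apply is_series_Clim. now apply Csum_correct.
Qed.

Lemma Cmod_Csum_le (x : nat -> C) (y : nat -> R) :
  (forall n, (Cmod (x n) <= y n)%R) -> ex_series y -> (Cmod (Csum x) <= Series y)%R.
Proof.
  intros H Hy. eapply Rle_trans; [apply Cmod_Csum; now apply summable_le with y|].
  apply Series_le; [|assumption]. intros n. split; [apply Cmod_ge_0 | apply H].
Qed.

Lemma summable_Clim0 (x : nat -> C) : summable x -> Clim x 0.
Proof.
  intros H. apply Clim_squeeze0 with (fun n => Cmod (x n)); [intros; apply Rle_refl|].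
  now apply ex_series_lim_0.
Qed.

Lemma summable_DAlembert (x : nat -> C) (l : C) :
  (forall n, x n <> 0) -> (Cmod l < 1)%R -> Clim (fun n => x (S n) / x n) l -> summable x.
Proof.
  intros Hx Hl H. apply ex_series_ext with (fun n => Rabs (Cmod (x n))).
  { intros n. apply Rabs_pos_eq, Cmod_ge_0. }
  apply ex_series_DAlembert with (Cmod l); [assumption| |].
  - intros n Hn. now apply (Hx n), Cmod_eq_0.
  - apply is_lim_seq_ext with (fun n => Cmod (x (S n) / x n)); [|now apply Clim_Cmod].
    intros n. rewrite Cmod_div by apply Hx. symmetry. apply Rabs_pos_eq.
    apply Rmult_le_pos; [apply Cmod_ge_0|]. left.
    apply Rinv_0_lt_compat. now apply Cmod_gt_0.
Qed.

Lemma Csum_telescope (x : nat -> C) :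
  summable (fun n => x (S n) - x n) -> Clim x 0 -> Csum (fun n => x (S n) - x n) = - x O.
Proof.
  intros Hs Hx. apply Csum_unique; [assumption|]. apply is_series_Clim.
  apply Clim_ext with (fun n => x (S n) + - x O).
  - induction n as [|n IH]; [rewrite sum_O; ring|].
    rewrite sum_Sn, <- IH.
    change (x (S (S n)) + - x O = x (S n) + - x O + (x (S (S n)) - x (S n))). ring.
  - assert (H := Clim_plus _ _ _ _ (Clim_subseq x 0 S ltac:(lia) Hx) (Clim_const (- x O))).
    now rewrite Cplus_0_l in H.
Qed.

(** * Tannery's theorem and entire power series *)

Lemma Series_tail_small (M : nat -> R) (eps : R) :
  ex_series M -> (0 < eps)%R -> exists N : nat, (Series (fun k => M (N + k)%nat) < eps)%R.
Proof.
  intros HM Heps. assert (Hs := Series_correct _ HM).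
  destruct (proj2 (is_lim_seq_spec (sum_n M) (Series M)) Hs (mkposreal eps Heps)) as [N HN].
  (* The partial sum up to N has N + 1 terms, so the tail starts at S N. *)
  specialize (HN N (le_n N)). exists (S N).
  rewrite (Series_incr_n M (S N)), sum_n_Reals in HN by (try lia; assumption).
  simpl pred in HN. simpl in HN. apply Rabs_def2 in HN. simpl. lra.
Qed.

(** The head of the series is absorbed one null term at a time, by induction on N: the series is
    shifted by one and the tolerance is lowered to the midpoint between the tail T and eps. This is
    why [d], [M] and [eps] are quantified after [N]. *)
Lemma dominated_null_eventually (N : nat) :
  forall (d : nat -> nat -> C) (M : nat -> R) (eps : R),
  ex_series M -> (forall n k, (Cmod (d n k) <= M k)%R) ->
  (forall k, Clim (fun n => d n k) 0) ->
  (Series (fun k => M (N + k)%nat) < eps)%R ->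
  exists n0, forall n, (n0 <= n)%nat -> (Cmod (Csum (d n)) < eps)%R.
Proof.
  induction N as [|N IH]; intros d M eps HM Hd Hl Heps.
  - exists O. intros n _. eapply Rle_lt_trans; [|exact Heps]. now apply Cmod_Csum_le.
  - set (T := Series (fun k => M (S N + k)%nat)) in *.
    destruct (IH (fun n k => d n (S k)) (fun k => M (S k)) ((T + eps) / 2)%R) as [n1 H1].
    + now apply (ex_series_incr_1 M).
    + intros n k. apply Hd.
    + intros k. apply Hl.
    + replace (Series (fun k => M (S (N + k)))) with T by reflexivity. lra.
    + destruct (proj1 (Clim_eps _ _) (Hl O) ((eps - T) / 2)%R ltac:(lra)) as [n2 H2].
      exists (n1 + n2)%nat. intros n Hn.
      rewrite Csum_incr_1 by (apply summable_le with M; auto).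
      eapply Rle_lt_trans; [apply Cmod_triangle|].
      specialize (H1 n ltac:(lia)). specialize (H2 n ltac:(lia)).
      replace (d n O - 0) with (d n O) in H2 by ring. lra.
Qed.

(** The limit inherits the bound [M], so the differences [s n k - L k] are null for each k and
    dominated by twice [M]. *)
Lemma tannery (s : nat -> nat -> C) (L : nat -> C) (M : nat -> R) :
  ex_series M -> (forall n k, (Cmod (s n k) <= M k)%R) ->
  (forall k, Clim (fun n => s n k) (L k)) ->
  Clim (fun n => Csum (s n)) (Csum L).
Proof.
  intros HM Hs Hl. apply Clim_eps. intros eps Heps.
  assert (HL : forall k, (Cmod (L k) <= M k)%R)
    by (intros k; apply (Clim_le (fun n => s n k)); auto).
  assert (HM2 : ex_series (fun k => M k + M k)%R)
    by now apply (@ex_series_plus R_AbsRing R_NormedModule).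
  destruct (Series_tail_small _ eps HM2 Heps) as [N HN].
  destruct (dominated_null_eventually N (fun n k => s n k - L k) _ eps HM2) as [n0 H0].
  - intros n k. eapply Rle_trans; [apply Cmod_triangle|]. rewrite Cmod_opp.
    apply Rplus_le_compat; auto.
  - intros k. assert (H := Clim_plus _ _ _ _ (Hl k) (Clim_const (- L k))).
    now rewrite Cplus_opp_r in H.
  - exact HN.
  - exists n0. intros n Hn. rewrite <- Csum_minus; [now apply H0| |];
      apply summable_le with M; auto.
Qed.

(** Recentres a series at index n: terms from n on are counted upwards, earlier ones backwards from
    n - 1 and padded by 0. Tannery's theorem can then treat each side as n grows. *)
Lemma Csum_split_at (n : nat) (x : nat -> C) :
  summable x ->
  let y := fun j => if (j <? n)%nat then x (n - 1 - j)%nat else 0 in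
  summable y /\ Csum x = Csum (fun j => x (n + j)%nat) + Csum y.
Proof.
  intros Hx. induction n as [|n [IH1 IH2]].
  - intros y. assert (H0 : forall j, 0 * x j = y j) 
      by (intros j; unfold y; destruct (Nat.ltb_spec j 0); [lia | ring]).
    split.
    + apply summable_ext with (1 := H0). now apply summable_scal.
    + rewrite <- (Csum_ext _ _ H0), Csum_scal by assumption.
      now rewrite Cmult_0_l, Cplus_0_r.
  - set (z := fun j => if (j <? n)%nat then x (n - 1 - j)%nat else 0) in *.
    assert (Hz : forall j, z j = (if (S j <? S n)%nat then x (S n - 1 - S j)%nat else 0)).
    { intros j. unfold z. change (S j <? S n)%nat with (j <? n)%nat.
      destruct (j <? n)%nat; [|reflexivity]. f_equal. lia. }
    assert (Hs : summable (fun j => if (j <? S n)%nat then x (S n - 1 - j)%nat else 0)).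
    { apply summable_incr_1. now apply summable_ext with (1 := Hz). }
    split; [exact Hs|].
    rewrite (Csum_incr_1 _ Hs), <- (Csum_ext _ _ Hz), IH2.
    rewrite (Csum_incr_1 (fun j => x (n + j)%nat)).
    + rewrite (Csum_ext (fun j => x (n + S j)%nat) (fun j => x (S n + j)%nat))
        by (intros j; f_equal; lia).
      replace (n + 0)%nat with n by lia. simpl.
      replace (n - 0 - 0)%nat with n by lia. ring.
    + clear -Hx. induction n; [exact Hx|]. apply summable_incr_1 in IHn.
      apply summable_ext with (2 := IHn). intros j. f_equal. lia.
Qed.

(** Tannery's theorem for series whose bulk moves out with n: seen from index n they become
    bilateral. The lower half is bounded for j < n only, since beyond that n - 1 - j is truncated to
    0. *)
Lemma tannery_bilateral (s : nat -> nat -> C) (Lp Lm : nat -> C) (Mp Mm : nat -> R) :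
  ex_series Mp -> ex_series Mm ->
  (forall n, summable (s n)) ->
  (forall n j, (Cmod (s n (n + j)%nat) <= Mp j)%R) ->
  (forall n j, (j < n)%nat -> (Cmod (s n (n - 1 - j)%nat) <= Mm j)%R) ->
  (forall j, Clim (fun n => s n (n + j)%nat) (Lp j)) ->
  (forall j, Clim (fun n => s n (n - 1 - j)%nat) (Lm j)) ->
  Clim (fun n => Csum (s n)) (Csum Lp + Csum Lm).
Proof.
  intros HMp HMm Hs Hp Hm Lp_ok Lm_ok.
  eapply Clim_ext; [intros n; symmetry; apply (Csum_split_at n (s n) (Hs n))|].
  apply Clim_plus.
  - now apply tannery with Mp.
  (* The zero padding needs a nonnegative bound. [Mm] itself is nonnegative, by its hypothesis at n
     = S j, so its summability carries over. *)
  - apply tannery with (fun j => Rabs (Mm j)).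
    + apply ex_series_ext with Mm; [|assumption]. intros j. symmetry. apply Rabs_pos_eq.
      eapply Rle_trans; [|apply (Hm (S j) j); lia]. apply Cmod_ge_0.
    + intros n j. destruct (Nat.ltb_spec j n) as [H|H].
      * eapply Rle_trans; [now apply Hm | apply Rle_abs].
      * rewrite Cmod_0. apply Rabs_pos.
    + intros j. generalize (Lm_ok j). rewrite !Clim_eps. intros H eps Heps.
      destruct (H eps Heps) as [N HN]. exists (S (j + N)). intros n Hn.
      destruct (Nat.ltb_spec j n) as [_|H']; [|lia]. apply HN. lia.
Qed.

(** * Complex derivatives and termwise differentiation of entire power series *)

Definition Cder (f : C -> C) (z l : C) : Prop := @is_derive C_AbsRing CN f z l.

Lemma Cder_eps (f : C -> C) (z l : C) :
  Cder f z l <->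
  forall eps : R, (0 < eps)%R -> exists d : R, (0 < d)%R /\
    forall w : C, (Cmod (w - z) < d)%R ->
      (Cmod (f w - f z - l * (w - z)) <= eps * Cmod (w - z))%R.
Proof.
  split.
  - intros [_ H] eps Heps.
    destruct (H z (fun P HP => HP) (mkposreal eps Heps)) as [d Hd].
    exists d. split; [apply cond_pos|]. intros w Hw. specialize (Hd w Hw).
    rewrite (Cmult_comm l). exact Hd.
  - intros H. split; [apply (@is_linear_scal_l C_AbsRing CN)|].
    intros y Hy.
    apply (@is_filter_lim_locally_unique C_AbsRing CN) in Hy. subst y. intros [eps Heps].
    destruct (H eps Heps) as [d [Hd Hw]]. exists (mkposreal d Hd). intros w Hb.
    specialize (Hw w Hb). rewrite (Cmult_comm l) in Hw. exact Hw.
Qed.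

Lemma Cder_quadratic (f : C -> C) (z l : C) (K : R) :
  (forall w, (Cmod (w - z) <= 1)%R ->
     (Cmod (f w - f z - l * (w - z)) <= Cmod (w - z) * Cmod (w - z) * K)%R) ->
  Cder f z l.
Proof.
  intros H. apply Cder_eps. intros eps Heps.
  (* Raising K to at least 1 makes eps / K' a valid radius whatever the sign of K. *)
  set (K' := Rmax K 1). assert (HK : (1 <= K')%R) by apply Rmax_r.
  exists (Rmin 1 (eps / K')). split.
  { apply Rmin_pos; [lra|]. apply Rdiv_lt_0_compat; lra. }
  intros w Hw.
  assert (H1 := Rlt_le_trans _ _ _ Hw (Rmin_l _ _)).
  assert (H2 := Rlt_le_trans _ _ _ Hw (Rmin_r _ _)).
  eapply Rle_trans; [apply H; lra|].
  assert (Hp := Cmod_ge_0 (w - z)).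
  rewrite Rmult_assoc, (Rmult_comm eps). apply Rmult_le_compat_l; [assumption|].
  apply Rle_trans with (Cmod (w - z) * K')%R.
  - apply Rmult_le_compat_l; [assumption | apply Rmax_l].
  - apply Rmult_le_reg_r with (/ K')%R; [apply Rinv_0_lt_compat; lra|].
    rewrite Rmult_assoc, Rinv_r by lra. rewrite Rmult_1_r. lra.
Qed.

Lemma Cder_cont (f : C -> C) (z l : C) : Cder f z l -> Ccont f z.
Proof.
  intros H. apply (@ex_derive_continuous C_AbsRing CN). now exists l.
Qed.

(** If r_n denotes the second-order Taylor remainder of the power n + 1, then r_(n+1) = w r_n +
    (n+1) z^n (w - z)^2. Taking [Rad] at least 1 pays for the generous exponent n + 1 in the
    bound. *)
Lemma Cmod_pow_sub (w z : C) (Rad : R) (n : nat) :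
  (1 <= Rad)%R -> (Cmod w <= Rad)%R -> (Cmod z <= Rad)%R ->
  (Cmod (w ^ S n - z ^ S n - INR (S n) * z ^ n * (w - z))
    <= Cmod (w - z) * Cmod (w - z) * (INR (S n) * INR (S n) * Rad ^ S n))%R.
Proof.
  intros HR Hw Hz. induction n as [|n IH].
  - replace (w ^ 1 - z ^ 1 - INR 1 * z ^ 0 * (w - z)) with (RtoC 0) by (simpl; ring).
    rewrite Cmod_0. repeat apply Rmult_le_pos; try apply Cmod_ge_0; simpl; lra.
  - replace (w ^ S (S n) - z ^ S (S n) - INR (S (S n)) * z ^ S n * (w - z))
      with (w * (w ^ S n - z ^ S n - INR (S n) * z ^ n * (w - z))
            + INR (S n) * z ^ n * ((w - z) * (w - z))).
    2:{ rewrite (S_INR (S n)), RtoC_plus. simpl Cpow. ring. }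
    eapply Rle_trans; [apply Cmod_triangle|]. rewrite !Cmod_mult.
    set (h := (Cmod (w - z) * Cmod (w - z))%R) in *.
    assert (Hh : (0 <= h)%R) by (apply Rmult_le_pos; apply Cmod_ge_0).
    rewrite Cmod_R, Rabs_pos_eq by apply pos_INR. rewrite Cmod_pow.
    assert (Hzn : (Cmod z ^ n <= Rad ^ n)%R)
      by (apply pow_incr; split; [apply Cmod_ge_0 | assumption]).
    assert (HRn : (0 < Rad ^ n)%R) by (apply pow_lt; lra).
    assert (HN := pos_INR (S n)). rewrite (S_INR (S n)).
    set (N := INR (S n)) in *. set (r := (Rad ^ n)%R) in *. simpl pow. fold r.
    apply Rle_trans with (Rad * (h * (N * N * (Rad * r))) + N * r * h)%R.
    + apply Rplus_le_compat.
      * apply Rmult_le_compat; try apply Cmod_ge_0; assumption.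
      * apply Rmult_le_compat_r; [assumption|]. now apply Rmult_le_compat_l.
    + replace (h * ((N + 1) * (N + 1) * (Rad * (Rad * r))))%R
        with (Rad * (h * (N * N * (Rad * r))) + (h * r) * ((2 * N + 1) * (Rad * Rad)))%R by ring.
      apply Rplus_le_compat_l. replace (N * r * h)%R with (h * r * N)%R by ring.
      apply Rmult_le_compat_l; [apply Rmult_le_pos; lra|].
      assert (1 <= Rad * Rad)%R by nra. nra.
Qed.

Definition entire_coef (c : nat -> C) : Prop :=
  forall Rad : R, (0 < Rad)%R -> ex_series (fun n => Cmod (c n) * Rad ^ n)%R.

Definition Cpser (c : nat -> C) (z : C) : C := Csum (fun n => c n * z ^ n).

Lemma Cpser_term_le (c : nat -> C) (z : C) (Rad : R) (n : nat) :
  (Cmod z <= Rad)%R -> (Cmod (c n * z ^ n) <= Cmod (c n) * Rad ^ n)%R.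
Proof.
  intros Hz. rewrite Cmod_mult, Cmod_pow. apply Rmult_le_compat_l; [apply Cmod_ge_0|].
  apply pow_incr. split; [apply Cmod_ge_0 | assumption].
Qed.

Lemma Cpser_summable (c : nat -> C) (z : C) :
  entire_coef c -> summable (fun n => c n * z ^ n).
Proof.
  intros Hc. apply summable_le with (fun n => Cmod (c n) * (Cmod z + 1) ^ n)%R.
  - intros n. apply Cpser_term_le. lra.
  - apply Hc. generalize (Cmod_ge_0 z). lra.
Qed.

Definition der_coef (c : nat -> C) (n : nat) : C := INR (S n) * c (S n).

(** Turns the polynomial factors of termwise differentiation into powers of 2, that is, into a
    larger radius, which an entire series tolerates. *)
Lemma INR_S_le_pow2 (n : nat) : (INR (S n) <= 2 ^ S n)%R.
Proof.
  induction n as [|n IH]; [simpl; lra|].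
  rewrite S_INR. simpl pow in *. assert (H := pos_INR n). rewrite S_INR in *. lra.
Qed.

Lemma entire_der_coef (c : nat -> C) : entire_coef c -> entire_coef (der_coef c).
Proof.
  intros Hc Rad HR.
  assert (H := proj1 (ex_series_incr_1 _) (Hc (2 * Rad)%R ltac:(lra))).
  apply (@ex_series_scal_l R_AbsRing R_NormedModule (/ Rad)%R) in H. revert H.
  apply (@ex_series_le R_AbsRing R_CompleteNormedModule). intros n.
  change (Rabs (Cmod (der_coef c n) * Rad ^ n)
    <= / Rad * (Cmod (c (S n)) * (2 * Rad) ^ S n))%R.
  assert (HRn : (0 < Rad ^ n)%R) by now apply pow_lt.
  assert (Hcn := Cmod_ge_0 (c (S n))).
  unfold der_coef. rewrite Cmod_mult, Cmod_R, (Rabs_pos_eq (INR _)) by apply pos_INR.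
  rewrite Rabs_pos_eq by (repeat apply Rmult_le_pos; try lra; apply pos_INR).
  rewrite Rpow_mult_distr. generalize (INR_S_le_pow2 n). intros HI.
  replace (/ Rad * (Cmod (c (S n)) * (2 ^ S n * Rad ^ S n)))%R
    with (2 ^ S n * Cmod (c (S n)) * Rad ^ n)%R by (simpl; field; lra).
  apply Rmult_le_compat_r; [lra|]. now apply Rmult_le_compat_r.
Qed.

Lemma Cpser_der (c : nat -> C) (z : C) :
  entire_coef c -> Cder (Cpser c) z (Cpser (der_coef c) z).
Proof.
  intros Hc. set (Rad := (Cmod z + 1)%R).
  assert (Hz := Cmod_ge_0 z).
  (* The factor (n+1)^2 from [Cmod_pow_sub] is at most 4^(n+1), so the remainders are dominated at
     radius 4 Rad. *)
  assert (HK := proj1 (ex_series_incr_1 _) (Hc (4 * Rad)%R ltac:(unfold Rad; lra))).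
  apply Cder_quadratic with (Series (fun n => Cmod (c (S n)) * (4 * Rad) ^ S n)%R).
  intros w Hw.
  assert (HwR : (Cmod w <= Rad)%R).
  { generalize (Cmod_triangle z (w - z)). replace (z + (w - z)) with w by ring.
    unfold Rad. lra. }
  unfold Cpser.
  rewrite (Csum_incr_1 _ (Cpser_summable c w Hc)), (Csum_incr_1 _ (Cpser_summable c z Hc)).
  assert (Sw := proj1 (summable_incr_1 _) (Cpser_summable c w Hc)).
  assert (Sz := proj1 (summable_incr_1 _) (Cpser_summable c z Hc)).
  assert (Sd := Cpser_summable _ z (entire_der_coef c Hc)).
  rewrite (Cmult_comm _ (w - z)), <- Csum_scal by assumption.
  match goal with |- (Cmod (?a + ?b - (?a' + ?b') - ?d) <= _)%R =>
    replace (a + b - (a' + b') - d) with (b - b' - d) by (simpl; ring) end.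
  rewrite <- !Csum_minus; try assumption;
    try (apply summable_scal; assumption).
  2:{ apply summable_ext with (fun n => c (S n) * w ^ S n + (-(1)) * (c (S n) * z ^ S n)).
      - intros n. ring.
      - apply summable_plus; [assumption|]. now apply summable_scal. }
  rewrite <- Series_scal_l. apply Cmod_Csum_le.
  2:{ now apply (@ex_series_scal_l R_AbsRing R_NormedModule). }
  intros n.
  replace (c (S n) * w ^ S n - c (S n) * z ^ S n - (w - z) * (der_coef c n * z ^ n))
    with (c (S n) * (w ^ S n - z ^ S n - INR (S n) * z ^ n * (w - z)))
    by (unfold der_coef; ring).
  rewrite Cmod_mult.
  eapply Rle_trans.
  { apply Rmult_le_compat_l; [apply Cmod_ge_0|].
    apply (Cmod_pow_sub w z Rad); unfold Rad in *; lra. }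
  rewrite Rpow_mult_distr. replace 4%R with (2 * 2)%R by ring. rewrite Rpow_mult_distr.
  set (h := (Cmod (w - z) * Cmod (w - z))%R).
  assert (Hh : (0 <= h)%R) by (apply Rmult_le_pos; apply Cmod_ge_0).
  rewrite <- Rmult_assoc, (Rmult_comm _ h), Rmult_assoc.
  apply Rmult_le_compat_l; [assumption|].
  apply Rmult_le_compat_l; [apply Cmod_ge_0|].
  apply Rmult_le_compat_r; [apply pow_le; unfold Rad; lra|].
  apply Rmult_le_compat; try apply pos_INR; apply INR_S_le_pow2.
Qed.

Lemma Cpser_cont (c : nat -> C) (z : C) : entire_coef c -> Ccont (Cpser c) z.
Proof. intros Hc. eapply Cder_cont. now apply Cpser_der. Qed.

Lemma Cpser_0 (c : nat -> C) : entire_coef c -> Cpser c 0 = c O.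
Proof.
  intros Hc. unfold Cpser. rewrite Csum_incr_1 by now apply Cpser_summable.
  rewrite (Csum_ext _ (fun n => 0 * (c (S n) * 0 ^ S n))) by (intros n; simpl; ring).
  rewrite Csum_scal; [simpl; ring|].
  exact (proj1 (summable_incr_1 _) (Cpser_summable c 0 Hc)).
Qed.

(** * The infinite q-shifted factorial *)

(** The coefficients (-1)^n q^(n(n-1)/2) / (q;q)_n of Euler's expansion of (x;q)_oo. *)
Fixpoint euler_coef (q : R) (n : nat) : C :=
  match n with
  | O => 1
  | S m => - q ^ m / (1 - q ^ S m) * euler_coef q m
  end.

(** Euler's series stands in for the infinite product, so that holomorphy comes from power series;
    [qpoch_qp] identifies the two. *)
Definition qp (q : R) (x : C) : C := Cpser (euler_coef q) x.

Fixpoint qpn (q : R) (n : nat) (x : C) : C :=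
  match n with
  | O => 1
  | S m => qpn q m x * (1 - x * q ^ m)
  end.

Lemma Cmod_q (q : R) : (0 < q < 1)%R -> Cmod q = q.
Proof. intros Hq. rewrite Cmod_R. apply Rabs_pos_eq. lra. Qed.

Lemma Cq_nz (q : R) : (0 < q < 1)%R -> RtoC q <> 0.
Proof. intros Hq H. apply RtoC_inj in H. lra. Qed.

Lemma Cqn_nz (q : R) (n : nat) : (0 < q < 1)%R -> RtoC q ^ n <> 0.
Proof. intros Hq. now apply Cpow_nz, Cq_nz. Qed.

Lemma Cinv_nz (x : C) : x <> 0 -> / x <> 0.
Proof.
  intros Hx H. apply C1_nz. rewrite <- (Cinv_r x Hx), H. ring.
Qed.

Lemma Cdiv_nz (x y : C) : x <> 0 -> y <> 0 -> x / y <> 0.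
Proof. intros Hx Hy. apply Cmult_neq_0; [assumption | now apply Cinv_nz]. Qed.

Lemma Cmult_eq_reg_l (c x y : C) : c <> 0 -> c * x = c * y -> x = y.
Proof.
  intros Hc H. replace x with (/ c * (c * x)) by now field. rewrite H. now field.
Qed.

Lemma Cmod_1_minus (x : C) : (1 - Cmod x <= Cmod (1 - x))%R.
Proof.
  generalize (Cmod_lower_triangle 1 (1 - x)). replace (1 - x - 1) with (- x) by ring.
  rewrite Cmod_opp, Cmod_1. lra.
Qed.

Lemma one_minus_nz (x : C) : (Cmod x < 1)%R -> 1 - x <> 0.
Proof. intros Hx. apply Cmod_gt_0. generalize (Cmod_1_minus x). lra. Qed.

Lemma Cmod_qn (q : R) (n : nat) : (0 < q < 1)%R -> Cmod (q ^ n) = (q ^ n)%R.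
Proof. intros Hq. now rewrite Cmod_pow, Cmod_q. Qed.

Lemma qn_le1 (q : R) (n : nat) : (0 < q < 1)%R -> (0 < q ^ n <= 1)%R.
Proof.
  intros Hq. split; [apply pow_lt; lra|].
  rewrite <- (pow1 n). apply pow_incr. lra.
Qed.

Lemma one_minus_qS_nz (q : R) (n : nat) : (0 < q < 1)%R -> 1 - RtoC q ^ S n <> 0.
Proof.
  intros Hq. apply one_minus_nz. rewrite Cmod_qn by assumption.
  simpl. generalize (qn_le1 q n Hq). nra.
Qed.

Lemma euler_coef_nz (q : R) (n : nat) : (0 < q < 1)%R -> euler_coef q n <> 0.
Proof.
  intros Hq. induction n as [|n IH]; [exact C1_nz|]. cbn [euler_coef].
  apply Cmult_neq_0; [|assumption].
  apply Cmult_neq_0.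
  - intros H. apply (Cqn_nz q n Hq). replace (RtoC q ^ n) with (- - q ^ n) by ring. rewrite H. ring.
  - intros H. apply C1_nz.
    rewrite <- (Cinv_r (1 - q ^ S n)) by now apply one_minus_qS_nz. rewrite H. ring.
Qed.

Lemma Clim_qn (q : R) : (0 < q < 1)%R -> Clim (fun n => RtoC q ^ n) 0.
Proof. intros Hq. apply Clim_pow0. rewrite Cmod_q; lra. Qed.

Lemma Clim_minus (x y : nat -> C) (l m : C) :
  Clim x l -> Clim y m -> Clim (fun n => x n - y n) (l - m).
Proof.
  intros Hx Hy. replace (l - m) with (l + (-(1)) * m) by ring.
  apply Clim_ext with (fun n => x n + (-(1)) * y n); [intros; ring|].
  apply Clim_plus; [assumption|]. apply Clim_mult; [apply Clim_const | assumption].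
Qed.

Lemma euler_entire (q : R) : (0 < q < 1)%R -> entire_coef (euler_coef q).
Proof.
  intros Hq Rad HR.
  assert (HRC : RtoC Rad <> 0) by (intros H; apply RtoC_inj in H; lra).
  cut (summable (fun n => euler_coef q n * Rad ^ n)).
  { apply ex_series_ext. intros n.
    now rewrite Cmod_mult, Cmod_pow, Cmod_R, Rabs_pos_eq by lra. }
  apply summable_DAlembert with (RtoC 0).
  - intros n. apply Cmult_neq_0; [now apply euler_coef_nz | now apply Cpow_nz].
  - rewrite Cmod_0. lra.
  - apply Clim_ext with (fun n => (-(1) * Rad) * RtoC q ^ n * / (1 - RtoC q * RtoC q ^ n)).
    + intros n. simpl euler_coef. simpl Cpow. field. repeat split.
      * exact (one_minus_qS_nz q n Hq).
      * now apply Cpow_nz.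
      * now apply euler_coef_nz.
    + replace (RtoC 0) with ((-(1) * Rad) * RtoC 0 * / (1 - RtoC q * RtoC 0))
        by (rewrite !Cmult_0_r; ring).
      apply Clim_mult.
      * apply Clim_mult; [apply Clim_const | now apply Clim_qn].
      * apply Clim_inv; [intros H; apply C1_nz; rewrite <- H; ring|].
        apply Clim_minus; [apply Clim_const|].
        apply Clim_mult; [apply Clim_const | now apply Clim_qn].
Qed.

Lemma qp_cont (q : R) (x : C) : (0 < q < 1)%R -> Ccont (qp q) x.
Proof. intros Hq. now apply Cpser_cont, euler_entire. Qed.

Lemma qp_0 (q : R) : (0 < q < 1)%R -> qp q 0 = 1.
Proof. intros Hq. unfold qp. now rewrite Cpser_0 by now apply euler_entire. Qed.

(** The coefficient of x^(n+1) gives (1 - q^(n+1)) e_(n+1) = - q^n e_n, which is the recursion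
    defining [euler_coef]. *)
Lemma qp_step (q : R) (x : C) : (0 < q < 1)%R -> qp q x = (1 - x) * qp q (x * q).
Proof.
  intros Hq. assert (He := euler_entire q Hq). unfold qp, Cpser.
  assert (S1 := Cpser_summable _ x He). assert (S2 := Cpser_summable _ (x * q) He).
  match goal with |- _ = _ * ?s => replace ((1 - x) * s) with (s + - x * s) by ring end.
  replace (- x * Csum (fun n => euler_coef q n * (x * q) ^ n))
    with (Csum (fun n => - x * (euler_coef q n * (x * q) ^ n))) by now apply Csum_scal.
  rewrite (Csum_incr_1 _ S1), (Csum_incr_1 _ S2), <- Cplus_assoc. f_equal.
  rewrite <- Csum_plus.
  - apply Csum_ext. intros n. simpl euler_coef. simpl Cpow. rewrite Cpow_mult_l.
    field. exact (one_minus_qS_nz q n Hq).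
  - exact (proj1 (summable_incr_1 _) S2).
  - now apply summable_scal.
Qed.

Lemma qp_qpn (q : R) (n : nat) (x : C) : (0 < q < 1)%R -> qp q x = qpn q n x * qp q (x * q ^ n).
Proof.
  intros Hq. induction n as [|n IH]; simpl.
  - rewrite Cmult_1_r. ring.
  - rewrite IH, (qp_step q (x * q ^ n) Hq). replace (x * (q * q ^ n)) with (x * q ^ n * q) by ring.
    ring.
Qed.

Lemma Clim_qp_qn (q : R) (x : C) : (0 < q < 1)%R -> Clim (fun n => qp q (x * q ^ n)) 1.
Proof.
  intros Hq. rewrite <- (qp_0 q Hq). apply (Clim_comp (qp q) (fun n => x * q ^ n)).
  - now apply qp_cont.
  - replace (RtoC 0) with (x * RtoC 0) by ring. apply Clim_mult; [apply Clim_const | now apply Clim_qn].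
Qed.

(** By [qp_qpn] the partial product is qp(x) / qp(x q^n), and the denominator tends to qp(0) = 1. It
    may vanish for small n, so the quotient is used for large n only. *)
Lemma Clim_qpn (q : R) (x : C) : (0 < q < 1)%R -> Clim (fun n => qpn q n x) (qp q x).
Proof.
  intros Hq. assert (H1 := Clim_qp_qn q x Hq).
  destruct (proj1 (Clim_eps _ _) H1 1%R Rlt_0_1) as [N HN].
  assert (Hnz : forall n, (N <= n)%nat -> qp q (x * q ^ n) <> 0).
  { intros n Hn. apply Cmod_gt_0. specialize (HN n Hn).
    generalize (Cmod_lower_triangle 1 (qp q (x * q ^ n))). rewrite Cmod_1. lra. }
  assert (H2 : Clim (fun n => qp q x * / qp q (x * q ^ n)) (qp q x)).
  { assert (H := Clim_mult _ _ _ _ (Clim_const (qp q x)) (Clim_inv _ _ C1_nz H1)).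
    replace (qp q x * / 1) with (qp q x) in H by field. exact H. }
  rewrite Clim_eps in H2 |- *. intros eps Heps. destruct (H2 eps Heps) as [N2 HN2].
  exists (N + N2)%nat. intros n Hn. specialize (HN2 n ltac:(lia)).
  replace (qpn q n x) with (qp q x * / qp q (x * q ^ n)); [exact HN2|].
  rewrite (qp_qpn q n x Hq) at 1. field. apply Hnz. lia.
Qed.

Lemma qpn_nz (q : R) (n : nat) (x : C) :
  (forall i, (i < n)%nat -> 1 - x * q ^ i <> 0) -> qpn q n x <> 0.
Proof.
  induction n as [|n IH]; intros H; simpl; [exact C1_nz|].
  apply Cmult_neq_0; [apply IH; intros i Hi|]; apply H; lia.
Qed.

(** For large N the factor qp(x q^N) is close to 1, so a zero can come only from the finitely many
    linear factors split off. *)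
Lemma qp_nz (q : R) (x : C) :
  (0 < q < 1)%R -> (forall n, 1 - x * q ^ n <> 0) -> qp q x <> 0.
Proof.
  intros Hq H.
  destruct (proj1 (Clim_eps _ _) (Clim_qp_qn q x Hq) 1%R Rlt_0_1) as [N HN].
  rewrite (qp_qpn q N x Hq). apply Cmult_neq_0; [now apply qpn_nz|].
  apply Cmod_gt_0. specialize (HN N (le_n N)).
  generalize (Cmod_lower_triangle 1 (qp q (x * q ^ N))). rewrite Cmod_1. lra.
Qed.

Lemma qp_nz_disc (q : R) (x : C) : (0 < q < 1)%R -> (Cmod x < 1)%R -> qp q x <> 0.
Proof.
  intros Hq Hx. apply qp_nz; [assumption|]. intros n. apply one_minus_nz.
  rewrite Cmod_mult, Cmod_qn by assumption. generalize (qn_le1 q n Hq) (Cmod_ge_0 x). nra.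
Qed.

Lemma Cprod_map_qpn (q : R) (x : C) (n : nat) :
  Cprod (map (fun i : nat => 1 - x * q ^ i) (seq 0 n)) = qpn q n x.
Proof.
  induction n as [|n IH]; [reflexivity|].
  rewrite seq_S, map_app. simpl qpn. rewrite <- IH. simpl map at 2.
  generalize (map (fun i : nat => 1 - x * q ^ i) (seq 0 n)). intros l.
  unfold Cprod. induction l as [|y l IHl]; simpl; [ring|]. rewrite IHl. ring.
Qed.

(** [lim] is specified for Cauchy filters of the product structure; the limit in the [Cmod]
    structure is transferred there and shown to make the filter Cauchy. *)
Lemma Clim_lim (x : nat -> C) (l : C) :
  Clim x l -> lim (T := C_CompleteNormedModule) (filtermap x eventually) = l.
Proof.
  intros H.
  assert (HC : @filterlim nat C_NormedModule x eventually (@locally C_NormedModule l))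
    by (intros Q HQ; apply H; now apply locally_C_iff).
  apply (@filterlim_locally_unique nat C_AbsRing C_NormedModule eventually _ x); [|exact HC].
  apply (proj2 (@filterlim_locally nat C_NormedModule eventually _ x _)).
  intros eps0. apply (@complete_cauchy C_CompleteNormedModule (filtermap x eventually)).
  - apply filtermap_proper_filter. apply eventually_filter.
  - apply (@cauchy_distance C_UniformSpace); [apply filtermap_proper_filter, eventually_filter|].
    intros eps. exists (@ball C_UniformSpace l (pos_div_2 eps)). split.
    + apply (HC (@ball C_UniformSpace l (pos_div_2 eps))). now exists (pos_div_2 eps).
    + intros u v Hu Hv. rewrite (double_var eps).
      apply (@ball_triangle C_UniformSpace) with l; [now apply ball_sym | exact Hv].
Qed.

Lemma qpoch_qp (q : R) (x : C) : (0 < q < 1)%R -> qpoch q x = qp q x.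
Proof.
  intros Hq. apply Clim_lim.
  apply Clim_ext with (fun n => qpn q n x); [|now apply Clim_qpn].
  intros n. symmetry. apply Cprod_map_qpn.
Qed.

(** At -|x| each factor is 1 + |x| q^i, the largest modulus on the circle through x. This yields a
    bound uniform over that circle. *)
Lemma Cmod_qpn_upper (q : R) (x : C) (n : nat) :
  (0 < q < 1)%R -> (Cmod (qpn q n x) <= Cmod (qpn q n (- RtoC (Cmod x))))%R.
Proof.
  intros Hq. induction n as [|n IH]; [apply Rle_refl|]. simpl qpn. rewrite !Cmod_mult.
  apply Rmult_le_compat; try apply Cmod_ge_0; [exact IH|].
  replace (1 - - RtoC (Cmod x) * q ^ n) with (RtoC (1 + Cmod x * q ^ n))
    by (rewrite RtoC_plus, RtoC_mult, RtoC_pow; ring).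
  assert (H := qn_le1 q n Hq). assert (Hx := Cmod_ge_0 x).
  rewrite Cmod_R, Rabs_pos_eq by nra.
  eapply Rle_trans; [apply Cmod_triangle|].
  rewrite Cmod_1, Cmod_opp, Cmod_mult, Cmod_qn by assumption. lra.
Qed.

(** * Theta functions and a bilateral summation *)

(** For nonzero x this says that x avoids the zeros q^m of theta. *)
Definition generic (q : R) (x : C) : Prop := forall m : Z, x <> powerRZ q m.

Definition th (q : R) (x : C) : C := qp q x * qp q (q / x).

Lemma th_theta (q : R) (x : C) : (0 < q < 1)%R -> theta q x = th q x.
Proof.
  intros Hq. unfold theta, qpochs, th. simpl. rewrite !qpoch_qp by assumption. ring.
Qed.

Lemma generic_nz (q : R) (x : C) (n : nat) :
  (0 < q < 1)%R -> generic q x -> 1 - x * q ^ n <> 0.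
Proof.
  intros Hq Hx H. apply (Hx (- Z.of_nat n)%Z).
  rewrite powerRZ_neg', <- pow_powerRZ by lra.
  rewrite RtoC_inv by (apply pow_nonzero; lra). rewrite RtoC_pow.
  replace (/ q ^ n) with (1 * / q ^ n) by ring.
  replace (RtoC 1) with (x * q ^ n).
  - field. now apply Cqn_nz.
  - replace (x * q ^ n) with (1 - (1 - x * q ^ n)) by ring. rewrite H. ring.
Qed.

Lemma generic_mult_powerRZ (q : R) (x : C) (m : Z) :
  (0 < q < 1)%R -> generic q x -> generic q (x * powerRZ q m).
Proof.
  intros Hq Hx k Hk. apply (Hx (k - m)%Z).
  assert (Hm : powerRZ q m <> 0%R) by (apply powerRZ_NOR; lra).
  unfold Z.sub. rewrite powerRZ_add, powerRZ_neg', RtoC_mult, RtoC_inv by lra || assumption.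
  rewrite <- Hk. field. intros H. apply RtoC_inj in H. contradiction.
Qed.

Lemma generic_mult_pow (q : R) (x : C) (n : nat) :
  (0 < q < 1)%R -> generic q x -> generic q (x * q ^ n).
Proof.
  intros Hq Hx. rewrite <- RtoC_pow, pow_powerRZ. now apply generic_mult_powerRZ.
Qed.

Lemma generic_div_pow (q : R) (x : C) (n : nat) :
  (0 < q < 1)%R -> generic q x -> generic q (x / q ^ n).
Proof.
  intros Hq Hx. unfold Cdiv.
  rewrite <- RtoC_pow, <- RtoC_inv by (apply pow_nonzero; lra).
  rewrite pow_powerRZ, <- powerRZ_neg' by lra. now apply generic_mult_powerRZ.
Qed.

Lemma generic_q_div (q : R) (x : C) :
  (0 < q < 1)%R -> x <> 0 -> generic q x -> generic q (q / x).
Proof.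
  intros Hq Hx0 Hx m Hm. apply (Hx (1 - m)%Z).
  assert (Hm0 : powerRZ q m <> 0%R) by (apply powerRZ_NOR; lra).
  unfold Z.sub. rewrite powerRZ_add, powerRZ_neg', RtoC_mult, RtoC_inv by lra || assumption.
  rewrite <- Hm, powerRZ_1. field. auto using Cq_nz.
Qed.

Lemma qp_generic_nz (q : R) (x : C) : (0 < q < 1)%R -> generic q x -> qp q x <> 0.
Proof. intros Hq Hx. apply qp_nz; [assumption|]. intros n. now apply generic_nz. Qed.

Lemma th_generic_nz (q : R) (x : C) :
  (0 < q < 1)%R -> x <> 0 -> generic q x -> th q x <> 0.
Proof.
  intros Hq Hx0 Hx. apply Cmult_neq_0; apply qp_generic_nz; try assumption.
  now apply generic_q_div.
Qed.

Lemma qp_1 (q : R) : (0 < q < 1)%R -> qp q 1 = 0.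
Proof. intros Hq. rewrite qp_step by assumption. ring. Qed.

Lemma th_div_q (q : R) (x : C) :
  (0 < q < 1)%R -> x <> 0 -> th q (x / q) = - (x / q) * th q x.
Proof.
  intros Hq Hx. assert (Hq0 := Cq_nz q Hq). unfold th.
  destruct (Ceq_dec x q) as [->|Hne].
  - replace (q / q) with (RtoC 1) by now field. rewrite qp_1 by assumption. ring.
  - rewrite (qp_step q (x / q) Hq), (qp_step q (q / x) Hq).
    replace (x / q * q) with x by now field.
    replace (q / (x / q)) with (q / x * q) by now field.
    field. auto.
Qed.

Lemma th_mult_q (q : R) (x : C) :
  (0 < q < 1)%R -> x <> 0 -> th q (x * q) = - / x * th q x.
Proof.
  intros Hq Hx. assert (Hq0 := Cq_nz q Hq).
  generalize (th_div_q q (x * q) Hq ltac:(now apply Cmult_neq_0)).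
  replace (x * q / q) with x by now field. intros ->. now field.
Qed.

(** In the ratio theta(xz) / theta(x) the quasi-periodicity factors cancel except for z^n. The
    identity is multiplied out because theta(x) may vanish here. *)
Lemma th_ratio_div_pow (q : R) (x z : C) (n : nat) :
  (0 < q < 1)%R -> x <> 0 -> z <> 0 ->
  th q (x * z / q ^ n) * th q x = z ^ n * th q (x * z) * th q (x / q ^ n).
Proof.
  intros Hq Hx Hz. assert (Hq0 := Cq_nz q Hq).
  induction n as [|n IH].
  - simpl. replace (x / 1) with x by field. replace (x * z / 1) with (x * z) by field. ring.
  - assert (Hqn := Cqn_nz q n Hq).
    assert (H : forall y : C, y <> 0 -> th q (y / q ^ S n) = - (y / q ^ n / q) * th q (y / q ^ n)).
    { intros y Hy. rewrite <- th_div_q; [|assumption|].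
      - f_equal. simpl. now field.
      - now apply Cdiv_nz. }
    rewrite (H x), (H (x * z)) by auto using Cmult_neq_0.
    transitivity (- (x * z / q ^ n / q) * (th q (x * z / q ^ n) * th q x)); [ring|].
    rewrite IH. simpl Cpow. now field.
Qed.

(** Continuity at 0, along w q^n, of a power series known to converge absolutely only at w: the
    terms at w serve as majorant in Tannery's theorem. *)
Lemma geometric_coef_limit (b : nat -> C) (w : C) (q : R) :
  (0 < q < 1)%R -> summable (fun n => b n * w ^ n) ->
  Clim (fun n => Csum (fun k => b k * (w * q ^ n) ^ k)) (b O).
Proof.
  intros Hq Hs.
  set (L := fun k : nat => match k with O => b O | S _ => 0 end).
  assert (HL : forall k, (Cmod (L k) <= Cmod (b k * w ^ k))%R).
  { intros [|k]; simpl L; [rewrite Cmult_1_r; apply Rle_refl|].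
    rewrite Cmod_0. apply Cmod_ge_0. }
  replace (b O) with (Csum L).
  - apply tannery with (fun k => Cmod (b k * w ^ k)); [exact Hs| |].
    + intros n k. rewrite !Cpow_mult_l, !Cmod_mult, <- Rmult_assoc.
      rewrite <- (Rmult_1_r (Cmod (b k) * _)) at 2.
      apply Rmult_le_compat_l; [apply Rmult_le_pos; apply Cmod_ge_0|].
      rewrite Cmod_pow, Cmod_qn by assumption. rewrite <- (pow1 k).
      apply pow_incr. generalize (qn_le1 q n Hq). lra.
    + intros [|k].
      * apply Clim_ext with (fun _ => b O); [intros n; simpl; ring|]. apply Clim_const.
      * apply Clim_ext with (fun n => b (S k) * w * (q ^ n * (w * q ^ n) ^ k)).
        { intros n. simpl. ring. }
        replace (L (S k)) with (b (S k) * w * (RtoC 0 * (w * RtoC 0) ^ k)) by (simpl; ring).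
        apply Clim_mult; [apply Clim_const|].
        apply Clim_mult; [now apply Clim_qn|].
        induction k as [|k IH]; [apply Clim_const|].
        simpl. apply Clim_mult; [|exact IH].
        apply Clim_mult; [apply Clim_const | now apply Clim_qn].
  - rewrite Csum_incr_1 by now apply summable_le with (1 := HL).
    rewrite (Csum_ext _ (fun n => 0 * (b n * w ^ n))) by (intros; simpl; ring).
    rewrite Csum_scal by assumption. simpl. ring.
Qed.

Lemma qpn_q_nz (q : R) (n : nat) : (0 < q < 1)%R -> qpn q n q <> 0.
Proof. intros Hq. apply qpn_nz. intros i _. exact (one_minus_qS_nz q i Hq). Qed.

(** The q-binomial coefficient (x;q)_n / (q;q)_n divided by (x;q)_oo. In this form replacing x by x
    q^(-N) and n by N + j leaves the first factor independent of N. *)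
Definition binom_coef (q : R) (x : C) (n : nat) : C := / (qp q (x * q ^ n) * qpn q n q).

Lemma binom_coef_nz (q : R) (x : C) (n : nat) :
  (0 < q < 1)%R -> generic q x -> binom_coef q x n <> 0.
Proof.
  intros Hq Hx. apply Cinv_nz, Cmult_neq_0; [|now apply qpn_q_nz].
  apply qp_generic_nz; [assumption|]. now apply generic_mult_pow.
Qed.

Lemma binom_coef_S (q : R) (x : C) (n : nat) :
  (0 < q < 1)%R -> generic q x ->
  (1 - RtoC q ^ S n) * binom_coef q x (S n) = (1 - x * q ^ n) * binom_coef q x n.
Proof.
  intros Hq Hx. unfold binom_coef. rewrite (qp_step q (x * q ^ n)) by assumption.
  replace (x * q ^ n * q) with (x * q ^ S n) by (simpl; ring). simpl qpn.
  replace (RtoC q * q ^ n) with (RtoC q ^ S n) by reflexivity. field. repeat split.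
  - now apply qpn_q_nz.
  - apply qp_generic_nz; [assumption|]. now apply generic_mult_pow.
  - now apply generic_nz.
  - now apply one_minus_qS_nz.
Qed.

Lemma binom_summable (q : R) (x w : C) :
  (0 < q < 1)%R -> generic q x -> (0 < Cmod w < 1)%R ->
  summable (fun n => binom_coef q x n * w ^ n).
Proof.
  intros Hq Hx Hw. assert (Hw0 : w <> 0) by (apply Cmod_gt_0; lra).
  apply summable_DAlembert with w; [|lra|].
  - intros n. apply Cmult_neq_0; [now apply binom_coef_nz | now apply Cpow_nz].
  - apply Clim_ext with (fun n => w * (1 - x * q ^ n) * / (1 - RtoC q * q ^ n)).
    + intros n. assert (H := binom_coef_S q x n Hq Hx).
      assert (H1 := one_minus_qS_nz q n Hq).
      assert (H2 := binom_coef_nz q x n Hq Hx).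
      replace (binom_coef q x (S n))
        with ((1 - x * q ^ n) * binom_coef q x n / (1 - RtoC q ^ S n))
        by (rewrite <- H; now field).
      simpl Cpow in *. field. repeat split; auto using Cpow_nz.
    + assert (Hl : forall y, Clim (fun n => 1 - y * q ^ n) (1 - y * 0)).
      { intros y. apply Clim_minus; [apply Clim_const|].
        apply Clim_mult; [apply Clim_const | now apply Clim_qn]. }
      assert (H10 : 1 - RtoC q * 0 <> 0)
        by (replace (1 - RtoC q * 0) with (RtoC 1) by ring; exact C1_nz).
      eapply Clim_eq.
      * apply Clim_mult; [apply Clim_mult; [apply Clim_const | apply Hl]|].
        apply Clim_inv; [exact H10 | apply Hl].
      * field.
Qed.

(** The recursion of the coefficients gives (1 - v) F(v) = (1 - xv) F(vq); iterating it from w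
    towards 0 produces the two infinite products, with F(0) = 1 / (x;q)_oo left over. *)
Lemma q_binomial (q : R) (x w : C) :
  (0 < q < 1)%R -> generic q x -> (0 < Cmod w < 1)%R ->
  qp q w * qp q x * Csum (fun n => binom_coef q x n * w ^ n) = qp q (x * w).
Proof.
  intros Hq Hx Hw.
  set (F := fun w => Csum (fun n => binom_coef q x n * w ^ n)).
  assert (Hstep : forall v, (0 < Cmod v < 1)%R -> (1 - v) * F v = (1 - x * v) * F (v * q)).
  { intros v Hv. assert (Hs := binom_summable q x v Hq Hx Hv).
    assert (Hvq : (0 < Cmod (v * q) < 1)%R) by (rewrite Cmod_mult, Cmod_q by assumption; nra).
    assert (Hsq := binom_summable q x _ Hq Hx Hvq).
    assert (H : F v - F (v * q) = v * F v - x * v * F (v * q)).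
    { unfold F. rewrite <- Csum_minus, <- !Csum_scal, <- Csum_minus
        by auto using summable_scal.
      rewrite Csum_incr_1.
      - match goal with |- ?a + ?b = ?c => replace (a + b) with b by (simpl; ring) end.
        apply Csum_ext. intros n. rewrite !Cpow_mult_l.
        transitivity ((1 - RtoC q ^ S n) * binom_coef q x (S n) * v ^ S n); [ring|].
        rewrite binom_coef_S by assumption. simpl Cpow. ring.
      - apply summable_ext with
          (fun n => binom_coef q x n * v ^ n + (-(1)) * (binom_coef q x n * (v * q) ^ n)).
        + intros n. ring.
        + apply summable_plus; [assumption|]. now apply summable_scal. }
    transitivity (F v - F (v * q) - v * F v + F (v * q)); [ring|]. rewrite H. ring. }
  assert (Hiter : forall n, qpn q n w * F w = qpn q n (x * w) * F (w * q ^ n)).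
  { induction n as [|n IH].
    - simpl. rewrite Cmult_1_r. ring.
    - simpl qpn. transitivity ((1 - w * q ^ n) * (qpn q n w * F w)); [ring|].
      rewrite IH. transitivity (qpn q n (x * w) * ((1 - w * q ^ n) * F (w * q ^ n))); [ring|].
      rewrite Hstep.
      + replace (w * q ^ n * q) with (w * q ^ S n) by (simpl; ring). ring.
      + rewrite Cmod_mult, Cmod_qn by assumption. generalize (qn_le1 q n Hq). nra. }
  assert (Hlim : qp q w * F w = qp q (x * w) * binom_coef q x O).
  { apply (Clim_unique (fun n => qpn q n w * F w)).
    - apply Clim_mult; [now apply Clim_qpn | apply Clim_const].
    - apply Clim_ext with (1 := fun n => eq_sym (Hiter n)).
      apply Clim_mult; [now apply Clim_qpn|].
      apply geometric_coef_limit; [assumption|]. now apply binom_summable. }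
  fold (F w). transitivity (qp q x * (qp q w * F w)); [ring|]. rewrite Hlim.
  unfold binom_coef. simpl. rewrite !Cmult_1_r. field.
  now apply qp_generic_nz.
Qed.

(** [psi_up] and [psi_down] are the halves i = j and i = - S j of the bilateral series with terms
    z^i / (x q^i; q)_oo. *)
Definition psi_up (q : R) (x z : C) (j : nat) : C := z ^ j / qp q (x * q ^ j).
Definition psi_down (q : R) (x z : C) (j : nat) : C := / (z ^ S j * qp q (x / q ^ S j)).

Lemma Clim_qpn_q_inv (q : R) : (0 < q < 1)%R -> Clim (fun n => / qpn q n q) (/ qp q q).
Proof.
  intros Hq. apply Clim_inv; [|now apply Clim_qpn].
  apply qp_nz_disc; [assumption|]. rewrite Cmod_q; lra.
Qed.

Lemma psi_up_summable (q : R) (x z : C) :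
  (0 < q < 1)%R -> generic q x -> (0 < Cmod z < 1)%R -> summable (psi_up q x z).
Proof.
  intros Hq Hx Hz. assert (Hz0 : z <> 0) by (apply Cmod_gt_0; lra).
  assert (Hnz : forall n, qp q (x * q ^ n) <> 0)
    by (intros n; apply qp_generic_nz; [assumption | now apply generic_mult_pow]).
  apply summable_DAlembert with z; [|lra|].
  - intros n. apply Cdiv_nz; [now apply Cpow_nz | apply Hnz].
  - apply Clim_ext with (fun n => z * (1 - x * q ^ n)).
    + intros n. unfold psi_up. generalize (Hnz n) (Hnz (S n)).
      rewrite (qp_step q (x * q ^ n)) by assumption.
      replace (x * q ^ n * q) with (x * q ^ S n) by (simpl; ring). intros H1 H2.
      simpl (z ^ S n). field. repeat split; auto using Cpow_nz. now apply generic_nz.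
    + eapply Clim_eq.
      * apply Clim_mult; [apply Clim_const|]. apply Clim_minus; [apply Clim_const|].
        apply Clim_mult; [apply Clim_const | now apply Clim_qn].
      * ring.
Qed.

(** The ratio of successive terms is 1 / (z (1 - x / q^(n+2))), of order q^n, so this half converges
    for every nonzero z. *)
Lemma psi_down_summable (q : R) (x z : C) :
  (0 < q < 1)%R -> x <> 0 -> generic q x -> z <> 0 -> summable (psi_down q x z).
Proof.
  intros Hq Hx0 Hx Hz0. assert (Hq0 := Cq_nz q Hq).
  assert (Hnz : forall n, qp q (x / q ^ n) <> 0)
    by (intros n; apply qp_generic_nz; [assumption | now apply generic_div_pow]).
  apply summable_DAlembert with (RtoC 0).
  - intros n. apply Cinv_nz, Cmult_neq_0; [now apply Cpow_nz | apply Hnz].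
  - rewrite Cmod_0. lra.
  - apply Clim_ext with (fun n => / z * (RtoC q * q * q ^ n) * / (RtoC q ^ S (S n) - x)).
    2:{ eapply Clim_eq.
        - apply Clim_mult.
          + apply Clim_mult; [apply Clim_const|].
            apply Clim_mult; [apply Clim_const | now apply Clim_qn].
          + apply Clim_inv with (l := 0 - x).
            * intros H. apply Hx0. replace x with (- (0 - x)) by ring. rewrite H. ring.
            * apply Clim_minus; [|apply Clim_const].
              apply (Clim_subseq _ _ (fun n => S (S n))); [lia | now apply Clim_qn].
        - ring. }
    intros n. unfold psi_down. generalize (Hnz (S n)) (Hnz (S (S n))).
    assert (Hn2 := generic_nz q _ 0 Hq (generic_div_pow q x (S (S n)) Hq Hx)).
    rewrite (qp_step q (x / q ^ S (S n))) by assumption.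
    replace (x / q ^ S (S n) * q) with (x / q ^ S n)
      by (simpl; field; split; [now apply Cqn_nz | assumption]).
    rewrite Cmult_1_r in Hn2. intros H1 H2.
    assert (Hqn := Cqn_nz q n Hq). assert (Hzn := Cpow_nz z n Hz0).
    assert (H3 : RtoC q ^ S (S n) - x <> 0).
    { intros H. apply Hn2. replace x with (RtoC q ^ S (S n)).
      - field. now apply Cqn_nz.
      - replace x with (RtoC q ^ S (S n) - (RtoC q ^ S (S n) - x)) by ring. rewrite H. ring. }
    simpl Cpow in *. field. repeat split; auto.
Qed.

(* q-binomial theorem at [x q^(-N)], [N -> oo]: a shift of the summation index by [N] turns
   the one-sided sum into the bilateral one. *)
Lemma psi_sum (q : R) (x z : C) :
  (0 < q < 1)%R -> x <> 0 -> generic q x -> (0 < Cmod z < 1)%R ->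
  Csum (psi_up q x z) + Csum (psi_down q x z) =
  qp q q * th q (x * z) / (th q x * qp q z).
Proof.
  intros Hq Hx0 Hx Hz. assert (Hz0 : z <> 0) by (apply Cmod_gt_0; lra).
  assert (Hq0 := Cq_nz q Hq).
  assert (Hqq : qp q q <> 0) by (apply qp_nz_disc; [|rewrite Cmod_q]; lra).
  assert (Hqz : qp q z <> 0) by (apply qp_nz_disc; lra).
  assert (Hth : th q x <> 0) by now apply th_generic_nz.
  set (X := fun N => Csum (fun m => binom_coef q (x / q ^ N) m * z ^ m / z ^ N)).
  assert (HsX : forall N, summable (fun m => binom_coef q (x / q ^ N) m * z ^ m)).
  { intros N. apply binom_summable; [assumption | | assumption].
    now apply generic_div_pow. }
  (* The q-binomial theorem at x q^(-N), with the products in x and xz completed to thetas so that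
     quasi-periodicity removes z^N; the completing factors tend to 1. *)
  assert (Hexact : forall N, X N * (qp q z * th q x * qp q (q / (x * z) * q ^ N)) =
                             th q (x * z) * qp q (q / x * q ^ N)).
  { intros N. assert (Hxg := generic_div_pow q x N Hq Hx).
    assert (Hb := q_binomial q (x / q ^ N) z Hq Hxg Hz).
    assert (Hr := th_ratio_div_pow q x z N Hq Hx0 Hz0).
    assert (HzN := Cpow_nz z N Hz0). assert (HqN := Cqn_nz q N Hq).
    assert (Hxn := qp_generic_nz q _ Hq Hxg).
    unfold X. rewrite (Csum_ext _ (fun m => / z ^ N * (binom_coef q (x / q ^ N) m * z ^ m)))
      by (intros m; field; assumption).
    rewrite Csum_scal by apply HsX.
    set (Y := Csum _) in *.
    apply Cmult_eq_reg_l with (z ^ N * qp q (x / q ^ N)); [now apply Cmult_neq_0|].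
    unfold th in Hr at 1 4.
    replace (q / (x * z / q ^ N)) with (q / (x * z) * q ^ N) in Hr by (field; auto).
    replace (q / (x / q ^ N)) with (q / x * q ^ N) in Hr by (field; auto).
    transitivity (qp q z * qp q (x / q ^ N) * Y * qp q (q / (x * z) * q ^ N) * th q x).
    { field. assumption. }
    rewrite Hb. replace (x / q ^ N * z) with (x * z / q ^ N) by (field; assumption).
    rewrite Hr. ring. }
  assert (HX : Clim X ((Csum (psi_up q x z) + Csum (psi_down q x z)) * / qp q q)).
  { rewrite Cmult_comm, Cmult_plus_distr_l, <- !Csum_scal
      by auto using psi_up_summable, psi_down_summable.
    (* After recentring, n enters only through a factor 1 / (q;q)_m, which converges and is
       therefore bounded by some K. *)
    destruct (Clim_bounded _ _ (Clim_qpn_q_inv q Hq)) as [K HK].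
    assert (Hup : forall n j, binom_coef q (x / q ^ n) (n + j) * z ^ (n + j) / z ^ n
                    = / qpn q (n + j) q * psi_up q x z j).
    { intros n j. unfold binom_coef, psi_up. rewrite !Cpow_add_r.
      replace (x / q ^ n * (q ^ n * q ^ j)) with (x * q ^ j) by (field; now apply Cqn_nz).
      field. repeat split; auto using Cpow_nz, qpn_q_nz.
      apply qp_generic_nz; [assumption | now apply generic_mult_pow]. }
    assert (Hdown : forall n j, (j < n)%nat ->
                    binom_coef q (x / q ^ n) (n - 1 - j) * z ^ (n - 1 - j) / z ^ n
                    = / qpn q (n - 1 - j) q * psi_down q x z j).
    { intros n j Hj. unfold binom_coef, psi_down.
      replace n with ((n - 1 - j) + S j)%nat at 1 5 by lia. rewrite !Cpow_add_r.
      set (m := (n - 1 - j)%nat).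
      replace (x / (q ^ m * q ^ S j) * q ^ m) with (x / q ^ S j)
        by (field; split; now apply Cqn_nz).
      assert (Hzj := Cpow_nz z (S j) Hz0).
      field. repeat split; auto using Cpow_nz, qpn_q_nz.
      apply qp_generic_nz; [assumption | now apply generic_div_pow]. }
    apply tannery_bilateral with
      (fun j => K * Cmod (psi_up q x z j))%R (fun j => K * Cmod (psi_down q x z j))%R.
    - apply (@ex_series_scal_l R_AbsRing R_NormedModule). now apply psi_up_summable.
    - apply (@ex_series_scal_l R_AbsRing R_NormedModule). now apply psi_down_summable.
    - intros n. apply summable_ext with
        (fun m => / z ^ n * (binom_coef q (x / q ^ n) m * z ^ m)).
      + intros m. field. now apply Cpow_nz.
      + apply summable_scal, HsX.
    - intros n j. rewrite Hup, Cmod_mult.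
      apply Rmult_le_compat_r; [apply Cmod_ge_0 | apply HK].
    - intros n j Hj. rewrite Hdown, Cmod_mult by assumption.
      apply Rmult_le_compat_r; [apply Cmod_ge_0 | apply HK].
    - intros j. apply Clim_ext with (1 := fun n => eq_sym (Hup n j)).
      apply Clim_mult; [|apply Clim_const].
      apply (Clim_subseq (fun n => / qpn q n q) _ (fun n => (n + j)%nat)); [lia|].
      now apply Clim_qpn_q_inv.
    (* [Hdown] holds for j < n only, so the two sequences are identified for large n. *)
    - intros j. assert (H := Clim_mult _ _ _ _ (Clim_qpn_q_inv q Hq) (Clim_const (psi_down q x z j))).
      rewrite Clim_eps in H |- *. intros eps Heps. destruct (H eps Heps) as [N HN].
      exists (N + S j)%nat. intros n Hn. rewrite Hdown by lia. apply HN. lia. }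
  assert (Hone : forall y, Clim (fun N => qp q (y * q ^ N)) 1) by (intros y; now apply Clim_qp_qn).
  assert (Heq := Clim_unique _ _ _
    (Clim_ext _ _ _ Hexact (Clim_mult _ _ _ _ HX
       (Clim_mult _ _ _ _ (Clim_const (qp q z * th q x)) (Hone (q / (x * z))))))
    (Clim_mult _ _ _ _ (Clim_const (th q (x * z))) (Hone (q / x)))).
  set (Psi := Csum (psi_up q x z) + Csum (psi_down q x z)) in *.
  transitivity (Psi * / qp q q * (qp q z * th q x * 1) * (qp q q / (th q x * qp q z))).
  - field. auto.
  - rewrite Heq. field. auto.
Qed.

(** * Holomorphic functions and circle means *)

(* Continuity of the derivative is part of the definition, so that circle means can be
   differentiated under the integral sign. *)
Definition holo_at (f : C -> C) (z : C) : Prop :=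
  exists f' : C -> C, @locally CU z (fun w => Cder f w (f' w) /\ Ccont f' w).

Lemma Cder_is_derive (f : C -> C) (z l : C) :
  Cder f z l -> is_derive (K := C_AbsRing) (V := C_NormedModule) f z l.
Proof.
  intros [_ H]. split; [apply (@is_linear_scal_l C_AbsRing C_NormedModule) | exact H].
Qed.

(** Uniqueness of derivatives replaces the existential derivative of [holo_at] by the fixed function
    [C_derive]. *)
Lemma holo_at_C_derive (f : C -> C) (z : C) :
  holo_at f z -> Cder f z (C_derive f z) /\ Ccont (C_derive f) z.
Proof.
  intros [f' Hf].
  assert (Heq : @locally CU z (fun w => f' w = C_derive f w)).
  { apply (filter_imp _ _) with (2 := Hf). intros w [Hw _]. symmetry.
    now apply is_C_derive_unique, Cder_is_derive. }
  destruct (locally_singleton _ _ Hf) as [H1 H2]. split.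
  - now rewrite <- (locally_singleton _ _ Heq).
  - now apply Ccont_ext_loc with f'.
Qed.

Lemma holo_at_locally (f : C -> C) (z : C) :
  holo_at f z -> @locally CU z (fun w => holo_at f w).
Proof.
  intros [f' Hf]. apply (@locally_locally CU) in Hf.
  apply (filter_imp _ _) with (2 := Hf). intros w Hw. now exists f'.
Qed.

Lemma holo_at_Ccont (f : C -> C) (z : C) : holo_at f z -> Ccont f z.
Proof. intros H. apply holo_at_C_derive in H. eapply Cder_cont. apply H. Qed.

Lemma holo_at_ext_loc (f g : C -> C) (z : C) :
  @locally CU z (fun w => f w = g w) -> holo_at f z -> holo_at g z.
Proof.
  intros He [f' Hf]. exists f'. apply (@locally_locally CU) in He.
  apply (filter_imp _ _) with (2 := filter_and _ _ He Hf).
  intros w [Hw [H1 H2]]. split; [|exact H2].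
  exact (@is_derive_ext_loc C_AbsRing CN f g w (f' w) Hw H1).
Qed.

Lemma holo_at_const (c z : C) : holo_at (fun _ => c) z.
Proof.
  exists (fun _ => 0). apply filter_forall. intros w.
  split; [exact (@is_derive_const C_AbsRing CN c w) | apply Ccont_const].
Qed.

Lemma holo_at_id (z : C) : holo_at (fun w => w) z.
Proof.
  exists (fun _ => 1). apply filter_forall. intros w.
  split; [exact (@is_derive_id C_AbsRing w) | apply Ccont_const].
Qed.

Lemma holo_at_plus (f g : C -> C) (z : C) :
  holo_at f z -> holo_at g z -> holo_at (fun w => f w + g w) z.
Proof.
  intros [f' Hf] [g' Hg]. exists (fun w => f' w + g' w).
  apply (filter_imp _ _) with (2 := filter_and _ _ Hf Hg).
  intros w [[H1 H2] [H3 H4]]. split; [|now apply Ccont_plus].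
  exact (@is_derive_plus C_AbsRing CN f g w _ _ H1 H3).
Qed.

Lemma holo_at_mult (f g : C -> C) (z : C) :
  holo_at f z -> holo_at g z -> holo_at (fun w => f w * g w) z.
Proof.
  intros [f' Hf] [g' Hg]. exists (fun w => f' w * g w + f w * g' w).
  apply (filter_imp _ _) with (2 := filter_and _ _ Hf Hg).
  intros w [[H1 H2] [H3 H4]]. split.
  - exact (@is_derive_mult C_AbsRing f g w _ _ H1 H3 Cmult_comm).
  - apply Ccont_plus; apply Ccont_mult; try assumption; eapply Cder_cont; eassumption.
Qed.

Lemma holo_at_comp (f g : C -> C) (z : C) :
  holo_at f z -> holo_at g (f z) -> holo_at (fun w => g (f w)) z.
Proof.
  intros Hf Hg. assert (Hc := holo_at_Ccont _ _ Hf).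
  destruct Hf as [f' Hf]. destruct Hg as [g' Hg]. exists (fun w => f' w * g' (f w)).
  apply Hc in Hg. apply (filter_imp _ _) with (2 := filter_and _ _ Hf Hg).
  intros w [[H1 H2] [H3 H4]]. split.
  - exact (@is_derive_comp C_AbsRing CN g f w _ _ H3 H1).
  - apply Ccont_mult; [assumption|]. apply Ccont_comp; [|assumption].
    eapply Cder_cont; eassumption.
Qed.

Lemma Cder_inv (z : C) : z <> 0 -> Cder (fun w => / w) z (- / (z * z)).
Proof.
  intros Hz. apply Cder_eps. intros eps Heps.
  assert (Hm : (0 < Cmod z)%R) by now apply Cmod_gt_0.
  set (m := Cmod z) in *.
  exists (Rmin (m / 2) (eps * (m * m * m) / 2)). split.
  { apply Rmin_pos; [lra|]. apply Rdiv_lt_0_compat; [|lra].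
    repeat apply Rmult_lt_0_compat; assumption. }
  intros w Hw.
  assert (H1 := Rlt_le_trans _ _ _ Hw (Rmin_l _ _)).
  assert (H2 := Rlt_le_trans _ _ _ Hw (Rmin_r _ _)).
  assert (H3 := Cmod_lower_triangle z w). fold m in H3.
  assert (Hmw : (m / 2 < Cmod w)%R) by lra.
  assert (Hw0 : w <> 0) by (apply Cmod_gt_0; lra).
  replace (/ w - / z - - / (z * z) * (w - z))
    with ((w - z) * / (w * (z * z)) * (w - z)) by (field; auto).
  rewrite Cmod_mult. apply Rmult_le_compat_r; [apply Cmod_ge_0|].
  rewrite Cmod_mult, Cmod_inv, !Cmod_mult by auto using Cmult_neq_0. fold m.
  assert (Hd : (0 < Cmod w * (m * m))%R) by (repeat apply Rmult_lt_0_compat; lra).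
  apply Rmult_le_reg_r with (Cmod w * (m * m))%R; [assumption|].
  rewrite Rmult_assoc, Rinv_l, Rmult_1_r by lra.
  left. apply Rlt_le_trans with (1 := H2).
  assert (0 < eps * (m * m))%R by (repeat apply Rmult_lt_0_compat; assumption). nra.
Qed.

Lemma holo_at_inv (z : C) : z <> 0 -> holo_at (fun w => / w) z.
Proof.
  intros Hz. exists (fun w => - / (w * w)).
  apply (filter_imp (fun w : C => w <> 0)).
  - intros w Hw. split; [now apply Cder_inv|].
    apply Ccont_ext_loc with (fun w => (-(1)) * / (w * w)).
    { apply filter_forall. intros y. ring. }
    apply Ccont_mult; [apply Ccont_const|].
    apply (Ccont_comp (fun w => w * w) (fun w => / w));
      [apply Ccont_mult; apply Ccont_id | apply Ccont_inv; now apply Cmult_neq_0].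
  - apply (Ccont_nonzero (fun w => w)); [apply Ccont_id | assumption].
Qed.

Lemma holo_at_div (f g : C -> C) (z : C) :
  holo_at f z -> holo_at g z -> g z <> 0 -> holo_at (fun w => f w / g w) z.
Proof.
  intros Hf Hg Hz. apply holo_at_mult; [assumption|].
  apply (holo_at_comp g (fun w => / w)); [assumption | now apply holo_at_inv].
Qed.

Lemma holo_at_pow (f : C -> C) (n : nat) (z : C) :
  holo_at f z -> holo_at (fun w => f w ^ n) z.
Proof.
  intros Hf. induction n as [|n IH]; [exact (holo_at_const 1 z)|].
  exact (holo_at_mult f (fun w => f w ^ n) z Hf IH).
Qed.

Lemma holo_at_Cpser (c : nat -> C) (z : C) : entire_coef c -> holo_at (Cpser c) z.
Proof.
  intros Hc. exists (Cpser (der_coef c)). apply filter_forall. intros w.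
  split; [now apply Cpser_der | now apply Cpser_cont, entire_der_coef].
Qed.

Lemma holo_at_qp (q : R) (f : C -> C) (z : C) :
  (0 < q < 1)%R -> holo_at f z -> holo_at (fun w => qp q (f w)) z.
Proof.
  intros Hq Hf. apply (holo_at_comp f (qp q)); [assumption|].
  now apply holo_at_Cpser, euler_entire.
Qed.

(** * Functions on circles: joint continuity, chain rule, and independence of the radius *)

Definition circ_pt (z0 : C) (r t : R) : C := z0 + r * expi t.

Lemma Cmod_expi (t : R) : Cmod (expi t) = 1%R.
Proof.
  unfold Cmod, expi. simpl.
  replace (cos t * (cos t * 1) + sin t * (sin t * 1))%R with 1%R; [apply sqrt_1|].
  generalize (sin2_cos2 t). unfold Rsqr. lra.
Qed.

(** The radius may be any real number: negative radii make 0 an interior point of the range on which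
    means are compared. *)
Lemma circ_pt_dist (z0 : C) (r t : R) : Cmod (circ_pt z0 r t - z0) = Rabs r.
Proof.
  unfold circ_pt. replace (z0 + r * expi t - z0) with (r * expi t) by ring.
  now rewrite Cmod_mult, Cmod_expi, Cmod_R, Rmult_1_r.
Qed.

(** Joint continuity in radius and angle, in the real componentwise form that differentiation under
    the integral sign requires. *)
Definition C2cont (F : R -> R -> C) (x y : R) : Prop :=
  continuity_2d_pt (fun u v => fst (F u v)) x y /\
  continuity_2d_pt (fun u v => snd (F u v)) x y.

Lemma C2cont_mult (F G : R -> R -> C) (x y : R) :
  C2cont F x y -> C2cont G x y -> C2cont (fun u v => F u v * G u v) x y.
Proof.
  intros [F1 F2] [G1 G2]. split; simpl.
  - apply continuity_2d_pt_minus; now apply continuity_2d_pt_mult.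
  - apply continuity_2d_pt_plus; now apply continuity_2d_pt_mult.
Qed.

Lemma C2cont_expi (x y : R) : C2cont (fun _ v => expi v) x y.
Proof.
  split; simpl; apply (continuity_1d_2d_pt_comp _ (fun _ v => v));
    try apply continuity_2d_pt_id2; [apply continuity_cos | apply continuity_sin].
Qed.

Lemma C2cont_circ_pt (z0 : C) (x y : R) : C2cont (circ_pt z0) x y.
Proof.
  assert (H : C2cont (fun u v => RtoC u * expi v) x y).
  { apply C2cont_mult; [|apply C2cont_expi].
    split; [apply continuity_2d_pt_id1 | exact (continuity_2d_pt_const x y 0)]. }
  destruct H as [H1 H2].
  split; unfold circ_pt.
  - exact (continuity_2d_pt_plus _ _ x y (continuity_2d_pt_const x y (fst z0)) H1).
  - exact (continuity_2d_pt_plus _ _ x y (continuity_2d_pt_const x y (snd z0)) H2).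
Qed.

Lemma abs_fst_le_Cmod (z : C) : (Rabs (fst z) <= Cmod z)%R.
Proof. apply Rle_trans with (2 := Rmax_Cmod z), Rmax_l. Qed.

Lemma abs_snd_le_Cmod (z : C) : (Rabs (snd z) <= Cmod z)%R.
Proof. apply Rle_trans with (2 := Rmax_Cmod z), Rmax_r. Qed.

Lemma Cmod_le_abs (z : C) : (Cmod z <= Rabs (fst z) + Rabs (snd z))%R.
Proof.
  unfold Cmod. rewrite <- (pow2_abs (fst z)), <- (pow2_abs (snd z)).
  assert (H1 := Rabs_pos (fst z)). assert (H2 := Rabs_pos (snd z)).
  rewrite <- (sqrt_pow2 (Rabs (fst z) + Rabs (snd z))) by lra.
  apply sqrt_le_1_alt. nra.
Qed.

Lemma C2cont_comp (h : C -> C) (F : R -> R -> C) (x y : R) :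
  C2cont F x y -> Ccont h (F x y) -> C2cont (fun u v => h (F u v)) x y.
Proof.
  intros [F1 F2] Hh.
  assert (H : forall eps : posreal, locally_2d (fun u v => (Cmod (h (F u v) - h (F x y)) < eps)%R) x y).
  { intros eps. destruct (proj1 (Ccont_eps _ _) Hh eps (cond_pos eps)) as [d [Hd Hw]].
    assert (Hd2 : (0 < d / 2)%R) by lra.
    generalize (locally_2d_and _ _ _ _ (F1 (mkposreal _ Hd2)) (F2 (mkposreal _ Hd2))).
    apply locally_2d_impl, locally_2d_forall. simpl. intros u v [H1 H2]. apply Hw.
    eapply Rle_lt_trans; [apply Cmod_le_abs|]. simpl.
    unfold Rminus in H1, H2. lra. }
  split; intros eps; generalize (H eps); apply locally_2d_impl, locally_2d_forall;
    intros u v Huv; apply Rle_lt_trans with (2 := Huv);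
    [apply (abs_fst_le_Cmod (h (F u v) - h (F x y)))
    |apply (abs_snd_le_Cmod (h (F u v) - h (F x y)))].
Qed.

Definition Rder (F : R -> C) (s : R) (l : C) : Prop :=
  is_derive (fun t => fst (F t)) s (fst l) /\ is_derive (fun t => snd (F t)) s (snd l).

Lemma is_derive_R_eps (f : R -> R) (x l : R) :
  is_derive f x l <->
  forall eps : R, (0 < eps)%R -> exists d : R, (0 < d)%R /\
    forall y : R, (Rabs (y - x) < d)%R ->
      (Rabs (f y - f x - l * (y - x)) <= eps * Rabs (y - x))%R.
Proof.
  split.
  - intros [_ H] eps Heps.
    destruct (H x (fun Q HQ => HQ) (mkposreal eps Heps)) as [d Hd].
    exists d. split; [apply cond_pos|]. intros w Hw. specialize (Hd w Hw).
    rewrite (Rmult_comm l). exact Hd.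
  - intros H. split; [apply (@is_linear_scal_l R_AbsRing R_NormedModule)|].
    intros y Hy.
    apply (@is_filter_lim_locally_unique R_AbsRing R_NormedModule) in Hy. subst y.
    intros [eps Heps].
    destruct (H eps Heps) as [d [Hd Hw]]. exists (mkposreal d Hd). intros w Hb.
    specialize (Hw w Hb). rewrite (Rmult_comm l) in Hw. exact Hw.
Qed.

Lemma Rder_eps (F : R -> C) (s : R) (l : C) :
  Rder F s l <->
  forall eps : R, (0 < eps)%R -> exists d : R, (0 < d)%R /\
    forall t : R, (Rabs (t - s) < d)%R ->
      (Cmod (F t - F s - l * RtoC (t - s)) <= eps * Rabs (t - s))%R.
Proof.
  assert (E1 : forall t, fst (F t - F s - l * RtoC (t - s))
             = (fst (F t) - fst (F s) - fst l * (t - s))%R) by (intros t; simpl; ring).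
  assert (E2 : forall t, snd (F t - F s - l * RtoC (t - s))
             = (snd (F t) - snd (F s) - snd l * (t - s))%R) by (intros t; simpl; ring).
  unfold Rder. rewrite !is_derive_R_eps. split.
  - intros [H1 H2] eps Heps.
    destruct (H1 (eps / 2)%R ltac:(lra)) as [d1 [Hd1 K1]].
    destruct (H2 (eps / 2)%R ltac:(lra)) as [d2 [Hd2 K2]].
    exists (Rmin d1 d2). split; [now apply Rmin_pos|]. intros t Ht.
    eapply Rle_trans; [apply Cmod_le_abs|]. rewrite E1, E2.
    specialize (K1 t (Rlt_le_trans _ _ _ Ht (Rmin_l _ _))).
    specialize (K2 t (Rlt_le_trans _ _ _ Ht (Rmin_r _ _))). lra.
  - intros H. split; intros eps Heps; destruct (H eps Heps) as [d [Hd K]];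
      exists d; (split; [assumption|]); intros t Ht;
      apply Rle_trans with (2 := K t Ht); [rewrite <- E1 | rewrite <- E2];
      [apply abs_fst_le_Cmod | apply abs_snd_le_Cmod].
Qed.

Lemma Rder_comp (h : C -> C) (F : R -> C) (s : R) (l m : C) :
  Rder F s l -> Cder h (F s) m -> Rder (fun t => h (F t)) s (m * l).
Proof.
  rewrite !Rder_eps, Cder_eps. intros HF Hh eps Heps.
  assert (Hl := Cmod_ge_0 l). assert (Hm := Cmod_ge_0 m).
  (* [e1] bounds the error of h, multiplied by the local Lipschitz constant |l| + 1 of F; [e2]
     bounds the error of F, multiplied by at most |m| + 1. Each costs eps/2, and [e2] at most 1
     gives that Lipschitz constant. *)
  set (e1 := (eps / (2 * (Cmod l + 1)))%R).
  set (e2 := Rmin 1 (eps / (2 * (Cmod m + 1)))).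
  assert (He1 : (0 < e1)%R) by (apply Rdiv_lt_0_compat; lra).
  assert (He2 : (0 < e2)%R) by (apply Rmin_pos; [lra | apply Rdiv_lt_0_compat; lra]).
  destruct (Hh e1 He1) as [d1 [Hd1 K1]]. destruct (HF e2 He2) as [d2 [Hd2 K2]].
  exists (Rmin d2 (d1 / (Cmod l + 1))). split.
  { apply Rmin_pos; [assumption | apply Rdiv_lt_0_compat; lra]. }
  intros t Ht.
  assert (T1 := Rlt_le_trans _ _ _ Ht (Rmin_l _ _)).
  assert (T2 := Rlt_le_trans _ _ _ Ht (Rmin_r _ _)).
  specialize (K2 t T1). assert (Hab := Rabs_pos (t - s)).
  assert (HFl : (Cmod (F t - F s) <= (Cmod l + 1) * Rabs (t - s))%R).
  { replace (F t - F s) with (l * RtoC (t - s) + (F t - F s - l * RtoC (t - s))) by ring.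
    eapply Rle_trans; [apply Cmod_triangle|]. rewrite Cmod_mult, Cmod_R.
    assert (e2 <= 1)%R by apply Rmin_l. nra. }
  assert (HFd : (Cmod (F t - F s) < d1)%R).
  { eapply Rle_lt_trans; [exact HFl|].
    apply Rmult_lt_reg_r with (/ (Cmod l + 1))%R; [apply Rinv_0_lt_compat; lra|].
    replace ((Cmod l + 1) * Rabs (t - s) * / (Cmod l + 1))%R with (Rabs (t - s))
      by (field; lra). exact T2. }
  specialize (K1 (F t) HFd).
  replace (h (F t) - h (F s) - m * l * RtoC (t - s))
    with ((h (F t) - h (F s) - m * (F t - F s)) + m * (F t - F s - l * RtoC (t - s))) by ring.
  eapply Rle_trans; [apply Cmod_triangle|]. rewrite Cmod_mult.
  apply Rle_trans with (e1 * ((Cmod l + 1) * Rabs (t - s)) + (Cmod m + 1) * (e2 * Rabs (t - s)))%R.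
  - apply Rplus_le_compat.
    + eapply Rle_trans; [exact K1|]. apply Rmult_le_compat_l; lra.
    + apply Rmult_le_compat; try lra; apply Cmod_ge_0.
  - replace (e1 * ((Cmod l + 1) * Rabs (t - s)))%R with (eps / 2 * Rabs (t - s))%R
      by (unfold e1; field; lra).
    assert (H2 : (e2 <= eps / (2 * (Cmod m + 1)))%R) by apply Rmin_r.
    apply Rmult_le_compat_l with (r := (Cmod m + 1)%R) in H2; [|lra].
    replace ((Cmod m + 1) * (eps / (2 * (Cmod m + 1))))%R with (eps / 2)%R in H2
      by (field; lra). nra.
Qed.

Lemma Rder_circ_pt_radius (z0 : C) (r t : R) : Rder (fun u => circ_pt z0 u t) r (expi t).
Proof.
  split; unfold circ_pt; simpl; auto_derive; trivial; ring.
Qed.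

Lemma Rder_circ_pt_angle (z0 : C) (r t : R) : Rder (circ_pt z0 r) t (r * (Ci * expi t)).
Proof.
  split; unfold circ_pt; simpl; auto_derive; trivial; ring.
Qed.

Lemma continuity_2d_fst (f : R -> R -> R) (x y : R) :
  continuity_2d_pt f x y -> continuity_pt (f x) y.
Proof.
  intros H. apply continuity_pt_filterlim, filterlim_locally. intros eps.
  destruct (H eps) as [d Hd]. exists d. intros v Hv. apply Hd; [|exact Hv].
  rewrite Rminus_diag. rewrite Rabs_R0. apply cond_pos.
Qed.

Lemma circ_cont (h : C -> C) (z0 : C) (r t : R) :
  Ccont h (circ_pt z0 r t) -> C2cont (fun r t => h (circ_pt z0 r t)) r t.
Proof. intros H. apply C2cont_comp; [apply C2cont_circ_pt | exact H]. Qed.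

Lemma circ_ex_RInt (h : C -> C) (z0 : C) (r a b : R) :
  (forall t, Ccont h (circ_pt z0 r t)) ->
  ex_RInt (fun t => fst (h (circ_pt z0 r t))) a b.
Proof.
  intros H. apply (@ex_RInt_continuous R_CompleteNormedModule). intros t _.
  apply continuity_pt_filterlim.
  apply (continuity_2d_fst (fun r t => fst (h (circ_pt z0 r t)))).
  now apply circ_cont.
Qed.

(** Not normalised by 2 pi. One real component suffices, because the imaginary part of h is the real
    part of -i h, as [circ_rot] exploits. *)
Definition mean_re (h : C -> C) (z0 : C) (r : R) : R :=
  RInt (fun t => fst (h (circ_pt z0 r t))) 0 (2 * PI).

(** Cauchy's theorem on an annulus in differential form: under the integral sign the radial
    derivative becomes an exact angular derivative, whose integral over a full turn vanishes. *)
Lemma mean_re_derive (h : C -> C) (z0 : C) (r1 r2 r : R) :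
  (0 <= r1)%R -> (forall r t, (r1 < r < r2)%R -> holo_at h (circ_pt z0 r t)) ->
  (r1 < r < r2)%R -> is_derive (mean_re h z0) r 0%R.
Proof.
  intros Hr1 Hh Hr.
  assert (Hloc : locally r (fun u => r1 < u < r2)%R).
  { apply (open_and _ _ (open_gt r1) (open_lt r2)). exact Hr. }
  assert (Hder : forall u t, (r1 < u < r2)%R ->
    is_derive (fun v => fst (h (circ_pt z0 v t))) u
      (fst (C_derive h (circ_pt z0 u t) * expi t))).
  { intros u t Hu. apply (Rder_comp h (fun v => circ_pt z0 v t)).
    - apply Rder_circ_pt_radius.
    - now apply holo_at_C_derive, Hh. }
  assert (Hc : forall u t, (r1 < u < r2)%R ->
    C2cont (fun u t => C_derive h (circ_pt z0 u t) * expi t) u t).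
  { intros u t Hu. apply C2cont_mult; [|apply C2cont_expi].
    apply circ_cont. now apply holo_at_C_derive, Hh. }
  assert (H0 : RInt (fun t => Derive (fun v => fst (h (circ_pt z0 v t))) r) 0 (2 * PI) = 0%R).
  { rewrite (RInt_ext _ (fun t => fst (C_derive h (circ_pt z0 r t) * expi t)))
      by (intros t _; now apply is_derive_unique, Hder).
    (* Cauchy-Riemann: the radial derivative of [Re h] is [1/r] times the angular derivative
       of [Im h]. *)
    apply is_RInt_unique.
    replace 0%R with (minus (snd (h (circ_pt z0 r (2 * PI))) / r)
                            (snd (h (circ_pt z0 r 0)) / r))%R at 2.
    2:{ unfold circ_pt, expi. rewrite cos_2PI, sin_2PI, cos_0, sin_0. exact (minus_eq_zero (G := R_AbelianGroup) _). }
    apply (is_RInt_derive (V := R_CompleteNormedModule)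
             (fun t => (snd (h (circ_pt z0 r t)) / r)%R)).
    - intros t _.
      assert (HR := proj2 (Rder_comp h (circ_pt z0 r) t _ _ (Rder_circ_pt_angle z0 r t)
        (proj1 (holo_at_C_derive h _ (Hh r t Hr))))).
      replace (fst (C_derive h (circ_pt z0 r t) * expi t))
        with (/ r * snd (C_derive h (circ_pt z0 r t) * (r * (Ci * expi t)))%C)%R
        by (simpl; field; lra).
      apply is_derive_ext with (fun t => (/ r * snd (h (circ_pt z0 r t)))%R).
      { intros u. apply Rmult_comm. }
      apply is_derive_scal. exact HR.
    - intros t _. apply continuity_pt_filterlim.
      apply (continuity_2d_fst (fun u t => fst (C_derive h (circ_pt z0 u t) * expi t))).
      now apply Hc. }
  refine (eq_ind _ (fun l => is_derive (mean_re h z0) r l) _ _ H0).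
  apply (is_derive_RInt_param (fun u t => fst (h (circ_pt z0 u t)))).
  - apply (filter_imp _ _) with (2 := Hloc). intros u Hu t _. eexists. now apply Hder.
  - intros t _. apply continuity_2d_pt_ext_loc with
      (fun u t => fst (C_derive h (circ_pt z0 u t) * expi t)); [|now apply Hc].
    destruct Hloc as [d Hd]. exists d. intros u v Hu _. symmetry.
    apply is_derive_unique, Hder. now apply Hd.
  - apply (filter_imp _ _) with (2 := Hloc). intros u Hu.
    apply circ_ex_RInt. intros t. now apply holo_at_Ccont, Hh.
Qed.

Lemma mean_re_cont (h : C -> C) (z0 : C) (s1 s2 r : R) :
  (forall r t, (s1 < r < s2)%R -> Ccont h (circ_pt z0 r t)) ->
  (s1 < r < s2)%R -> continuity_pt (mean_re h z0) r.
Proof.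
  intros Hh Hr. apply continuity_pt_filterlim, filterlim_locally. intros eps.
  assert (Hpi := PI_RGT_0).
  assert (He : (0 < eps / (4 * PI))%R) by (apply Rdiv_lt_0_compat; [apply cond_pos | lra]).
  destruct (uniform_continuity_2d_1d' (fun u t => fst (h (circ_pt z0 u t))) 0 (2 * PI) r)
    with (eps := mkposreal _ He) as [d Hd].
  { intros t _. now apply circ_cont, Hh. }
  assert (Hd2 : (0 < Rmin d (Rmin (r - s1) (s2 - r)))%R)
    by (repeat apply Rmin_pos; try apply cond_pos; lra).
  exists (mkposreal _ Hd2). intros u Hu. change (Rabs (u - r) < Rmin d (Rmin (r - s1) (s2 - r)))%R in Hu.
  change (Rabs (mean_re h z0 u - mean_re h z0 r) < eps)%R.
  assert (Hu1 := Rlt_le_trans _ _ _ Hu (Rmin_l _ _)).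
  assert (Hu2 := Rlt_le_trans _ _ _ Hu (Rmin_r _ _)).
  assert (Hu3 := Rlt_le_trans _ _ _ Hu2 (Rmin_l _ _)).
  assert (Hu4 := Rlt_le_trans _ _ _ Hu2 (Rmin_r _ _)).
  assert (Hus : (s1 < u < s2)%R)
    by (apply Rabs_def2 in Hu3; apply Rabs_def2 in Hu4; lra).
  assert (X1 := circ_ex_RInt h z0 u 0 (2 * PI) (fun t => Hh u t Hus)).
  assert (X2 := circ_ex_RInt h z0 r 0 (2 * PI) (fun t => Hh r t Hr)).
  assert (X3 := ex_RInt_minus _ _ _ _ X1 X2).
  apply (RInt_correct (V := R_CompleteNormedModule)) in X1.
  apply (RInt_correct (V := R_CompleteNormedModule)) in X2.
  assert (Hle := norm_RInt_le_const (V := R_NormedModule) _ 0 (2 * PI) _ (eps / (4 * PI))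
    ltac:(lra) (fun t Ht => Rlt_le _ _ (Hd t r t u Ht
       ltac:(generalize (cond_pos d); lra) Ht
       ltac:(apply Rabs_def2 in Hu1; lra)
       ltac:(rewrite Rminus_diag, Rabs_R0; apply cond_pos)))
    (is_RInt_minus _ _ _ _ _ _ X1 X2)).
  apply Rle_lt_trans with (1 := Hle).
  replace ((2 * PI - 0) * (eps / (4 * PI)))%R with (eps / 2)%R by (field; lra).
  generalize (cond_pos eps). lra.
Qed.

(** By the mean value theorem. Holomorphy is asked strictly between the radii and continuity
    slightly beyond them, so that r1 may be 0 and an end circle may carry a point where only
    continuity is known. *)
Lemma mean_re_const (h : C -> C) (z0 : C) (s1 r1 r2 s2 : R) :
  (0 <= r1)%R -> (s1 < r1)%R -> (r1 <= r2)%R -> (r2 < s2)%R ->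
  (forall r t, (s1 < r < s2)%R -> Ccont h (circ_pt z0 r t)) ->
  (forall r t, (r1 < r < r2)%R -> holo_at h (circ_pt z0 r t)) ->
  mean_re h z0 r1 = mean_re h z0 r2.
Proof.
  intros H0 Hs1 Hr Hs2 Hc Hh.
  destruct (MVT_gen (mean_re h z0) r1 r2 (fun _ => 0%R)) as [c [_ Hc']].
  - rewrite Rmin_left, Rmax_right by assumption. intros r Hr'.
    now apply mean_re_derive with r1 r2.
  - rewrite Rmin_left, Rmax_right by assumption. intros r Hr'.
    apply mean_re_cont with s1 s2; [assumption | lra].
  - lra.
Qed.

(** Up to a factor i this is the contour integral of h(z) dz / (z - z0), since dz = i (z - z0) dt on
    the circle. *)
Definition circ (h : C -> C) (z0 : C) (r : R) : C :=
  (mean_re h z0 r, RInt (fun t => snd (h (circ_pt z0 r t))) 0 (2 * PI)).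

Lemma circ_rot (h : C -> C) (z0 : C) (r : R) :
  circ h z0 r = (mean_re h z0 r, mean_re (fun z => - Ci * h z) z0 r).
Proof.
  unfold circ, mean_re. f_equal. apply RInt_ext. intros t _. simpl. ring.
Qed.

Lemma circ_const (h : C -> C) (z0 : C) (s1 r1 r2 s2 : R) :
  (0 <= r1)%R -> (s1 < r1)%R -> (r1 <= r2)%R -> (r2 < s2)%R ->
  (forall r t, (s1 < r < s2)%R -> Ccont h (circ_pt z0 r t)) ->
  (forall r t, (r1 < r < r2)%R -> holo_at h (circ_pt z0 r t)) ->
  circ h z0 r1 = circ h z0 r2.
Proof.
  intros H0 Hs1 Hr Hs2 Hc Hh. rewrite !circ_rot.
  f_equal; apply mean_re_const with s1 s2; try assumption; intros r t Hrt.
  - apply Ccont_mult; [apply Ccont_const | now apply Hc].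
  - apply holo_at_mult; [apply holo_at_const | now apply Hh].
Qed.

Lemma circ_0 (h : C -> C) (z0 : C) : circ h z0 0 = 2 * PI * h z0.
Proof.
  assert (Hp : forall t, circ_pt z0 0 t = z0) by (intros t; unfold circ_pt; ring).
  unfold circ, mean_re.
  rewrite (RInt_ext (V := R_CompleteNormedModule) (fun t => fst (h (circ_pt z0 0 t))) (fun _ => fst (h z0)))
    by (intros t _; now rewrite Hp).
  rewrite (RInt_ext (V := R_CompleteNormedModule) (fun t => snd (h (circ_pt z0 0 t))) (fun _ => snd (h z0)))
    by (intros t _; now rewrite Hp).
  rewrite !RInt_const. unfold scal. simpl. unfold mult. simpl.
  apply injective_projections; simpl; ring.
Qed.

Lemma circ_ext (h k : C -> C) (z0 : C) (r : R) :
  (forall t, h (circ_pt z0 r t) = k (circ_pt z0 r t)) -> circ h z0 r = circ k z0 r.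
Proof.
  intros H. unfold circ, mean_re. f_equal; apply RInt_ext; intros t _; now rewrite H.
Qed.

Lemma circ_ex_RInt_snd (h : C -> C) (z0 : C) (r a b : R) :
  (forall t, Ccont h (circ_pt z0 r t)) ->
  ex_RInt (fun t => snd (h (circ_pt z0 r t))) a b.
Proof.
  intros H. apply ex_RInt_ext with (fun t => fst (- Ci * h (circ_pt z0 r t))).
  - intros t _. simpl. ring.
  - apply (circ_ex_RInt (fun z => - Ci * h z)). intros t.
    apply Ccont_mult; [apply Ccont_const | apply H].
Qed.

Lemma circ_plus (h k : C -> C) (z0 : C) (r : R) :
  (forall t, Ccont h (circ_pt z0 r t)) -> (forall t, Ccont k (circ_pt z0 r t)) ->
  circ (fun z => h z + k z) z0 r = circ h z0 r + circ k z0 r.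
Proof.
  intros Hh Hk. unfold circ, mean_re, Cplus. simpl.
  f_equal; apply (RInt_plus (V := R_CompleteNormedModule));
    auto using circ_ex_RInt, circ_ex_RInt_snd.
Qed.

Lemma circ_scal (c : C) (h : C -> C) (z0 : C) (r : R) :
  (forall t, Ccont h (circ_pt z0 r t)) ->
  circ (fun z => c * h z) z0 r = c * circ h z0 r.
Proof.
  intros Hh. destruct c as [c1 c2].
  assert (X1 := circ_ex_RInt h z0 r 0 (2 * PI) Hh).
  assert (X2 := circ_ex_RInt_snd h z0 r 0 (2 * PI) Hh).
  assert (Y : forall (c : R) f, ex_RInt f 0 (2 * PI) -> ex_RInt (fun t => c * f t)%R 0 (2 * PI))
    by (intros c f; apply (ex_RInt_scal (V := R_NormedModule))).
  assert (Z : forall (c : R) f, ex_RInt f 0 (2 * PI) ->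
    RInt (fun t => c * f t)%R 0 (2 * PI) = (c * RInt f 0 (2 * PI))%R)
    by (intros c f; apply (RInt_scal (V := R_CompleteNormedModule))).
  unfold circ, mean_re, Cmult. simpl. f_equal.
  - rewrite <- !Z by assumption.
    apply (RInt_minus (V := R_CompleteNormedModule)); now apply Y.
  - rewrite <- !Z by assumption.
    apply (RInt_plus (V := R_CompleteNormedModule)); now apply Y.
Qed.

Lemma is_circle_int_circ (f h : C -> C) (z0 : C) (r : R) :
  (forall t, Ccont h (circ_pt z0 r t)) ->
  (forall t, f (circ_pt z0 r t) * (r * expi t) = h (circ_pt z0 r t)) ->
  is_circle_int f z0 r (Ci * circ h z0 r).
Proof.
  intros Hc Hf. unfold is_circle_int.
  apply is_RInt_ext with (fun t => Ci * h (circ_pt z0 r t)).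
  { intros t _. rewrite <- Hf. unfold circ_pt.
    match goal with |- ?x = ?y => change (@eq C x y) end. ring. }
  replace (Ci * circ h z0 r) with
    (opp (snd (circ h z0 r)), fst (circ h z0 r)).
  2:{ apply injective_projections; simpl; unfold opp; simpl; ring. }
  apply (is_RInt_fct_extend_pair (U := R_NormedModule) (V := R_NormedModule)).
  - apply is_RInt_ext with (fun t => opp (snd (h (circ_pt z0 r t)))).
    { intros t _. unfold opp. simpl. match goal with |- ?x = ?y => change (@eq R x y) end. ring. }
    apply (is_RInt_opp (V := R_NormedModule)).
    apply (RInt_correct (V := R_CompleteNormedModule)). now apply circ_ex_RInt_snd.
  - apply is_RInt_ext with (fun t => fst (h (circ_pt z0 r t))).
    { intros t _. simpl. match goal with |- ?x = ?y => change (@eq R x y) end. ring. }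
    apply (RInt_correct (V := R_CompleteNormedModule)). now apply circ_ex_RInt.
Qed.

(** On a circle around x0 the contour integral of f is i times the integral of F over the angle. The
    latter is constant down to radius 0, where it equals 2 pi F(x0). *)
Lemma residue_simple_pole (f F : C -> C) (x0 : C) :
  holo_at F x0 -> @locally CU x0 (fun z => z <> x0 -> f z = F z / (z - x0)) ->
  is_residue f x0 (F x0).
Proof.
  intros HF Hf.
  destruct (filter_and _ _ (holo_at_locally _ _ HF) Hf) as [d Hd]. exists d. split.
  - intros z [Hz1 Hz2]. destruct (Hd z Hz2) as [Hz _].
    assert (Hne : z - x0 <> 0) by now apply Cmod_gt_0.
    assert (Hh : holo_at f z).
    { apply holo_at_ext_loc with (fun w => F w / (w + - x0)).
      - destruct (Ccont_nonzero (fun w => w - x0) z) as [e He]; [|exact Hne|].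
        { apply Ccont_plus; [apply Ccont_id | apply Ccont_const]. }
        assert (Hmin : (0 < Rmin e (d - Cmod (z - x0)))%R)
          by (apply Rmin_pos; [apply cond_pos | lra]).
        exists (mkposreal _ Hmin). intros w Hw.
        change (Cmod (w - z) < Rmin e (d - Cmod (z - x0)))%R in Hw.
        symmetry. apply Hd.
        + change (Cmod (w - x0) < d)%R.
          replace (w - x0) with ((w - z) + (z - x0)) by ring.
          eapply Rle_lt_trans; [apply Cmod_triangle|].
          generalize (Rlt_le_trans _ _ _ Hw (Rmin_r _ _)). lra.
        + intros ->. apply (He x0); [|ring].
          exact (Rlt_le_trans _ _ _ Hw (Rmin_l _ _)).
      - apply holo_at_div; [exact Hz| |exact Hne].
        apply holo_at_plus; [apply holo_at_id | apply holo_at_const]. }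
    exists (C_derive f z). now apply Cder_is_derive, holo_at_C_derive.
  - intros r Hr.
    assert (Hball : forall u t, (- d < u < d)%R -> (Cmod (circ_pt x0 u t - x0) < d)%R)
      by (intros u t Hu; rewrite circ_pt_dist; now apply Rabs_def1).
    replace (2 * PI * Ci * F x0) with (Ci * circ F x0 r).
    + apply is_circle_int_circ.
      * intros t. apply holo_at_Ccont, (Hd (circ_pt x0 r t)), Hball. lra.
      * intros t.
        assert (Hpt : circ_pt x0 r t - x0 <> 0).
        { apply Cmod_gt_0. rewrite circ_pt_dist, Rabs_pos_eq; lra. }
        replace (r * expi t) with (circ_pt x0 r t - x0) by (unfold circ_pt; ring).
        rewrite (proj2 (Hd (circ_pt x0 r t) (Hball r t ltac:(lra)))).
        -- field. exact Hpt.
        -- intros H. apply Hpt. rewrite H. ring.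
    (* The range of continuity starts at the negative radius - d so that radius 0 is interior to
       it. *)
    + rewrite <- (circ_const F x0 (- d) 0 r d); try lra.
      * rewrite circ_0. ring.
      * intros u t Hu. now apply holo_at_Ccont, (Hd (circ_pt x0 u t)), Hball.
      * intros u t Hu. apply (Hd (circ_pt x0 u t)), Hball. lra.
Qed.

Lemma Cmod_circ_pt_0 (r t : R) : (0 <= r)%R -> Cmod (circ_pt 0 r t) = r.
Proof.
  intros Hr. rewrite <- (Rabs_pos_eq r Hr) at 2. rewrite <- (circ_pt_dist 0 r t).
  f_equal. ring.
Qed.

(** The Cauchy kernel multiplied by z, because [circ] around 0 integrates against dz/z. *)
Definition geom_kernel (u z : C) : C := z / (z - u).

Lemma holo_at_geom_kernel (u z : C) : z <> u -> holo_at (geom_kernel u) z.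
Proof.
  intros H. apply (holo_at_div (fun z => z) (fun z => z + - u)).
  - apply holo_at_id.
  - apply holo_at_plus; [apply holo_at_id | apply holo_at_const].
  - now apply Cminus_eq_contra.
Qed.

(** The kernel is holomorphic for |z| < |u| and vanishes at the centre. *)
Lemma circ_geom_kernel_in (u : C) (r : R) :
  (0 <= r < Cmod u)%R -> circ (geom_kernel u) 0 r = 0.
Proof.
  intros Hr.
  assert (Hne : forall s t, (- Cmod u < s < Cmod u)%R -> circ_pt 0 s t <> u).
  { intros s t Hs H. assert (E := circ_pt_dist 0 s t).
    rewrite H in E. replace (u - 0) with u in E by ring.
    assert (Rabs s < Cmod u)%R by now apply Rabs_def1. lra. }
  rewrite <- (circ_const _ 0 (- Cmod u) 0 r (Cmod u)); try lra.
  - rewrite circ_0. unfold geom_kernel, Cdiv. ring.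
  - intros s t Hs. now apply holo_at_Ccont, holo_at_geom_kernel, Hne.
  - intros s t Hs. apply holo_at_geom_kernel, Hne. lra.
Qed.

(* On the circle [|z| = r] one has [z / (z - u) = 1 / (1 - u conj(z) / r^2)], the conjugate of a
   function that is holomorphic in the disc. *)
Lemma circ_geom_kernel_out (u : C) (r : R) :
  (Cmod u < r)%R -> circ (geom_kernel u) 0 r = 2 * PI.
Proof.
  intros Hr. assert (Hu := Cmod_ge_0 u).
  set (c := Cconj u * RtoC (/ (r * r))).
  assert (Hrr : (0 < / (r * r))%R) by (apply Rinv_0_lt_compat, Rmult_lt_0_compat; lra).
  assert (Hc : Cmod c = (Cmod u * / (r * r))%R).
  { unfold c. rewrite Cmod_mult, Cmod_conj, Cmod_R, Rabs_pos_eq; lra. }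
  set (k := fun w => 1 / (1 + (- c) * w)).
  (* For u nonzero the pole of [k] has modulus r^2/|u|, and 2r - |u| does not exceed it because (r -
     |u|)^2 >= 0. This choice also makes sense for u = 0. *)
  set (s := (r + (r - Cmod u))%R).
  assert (Hsafe : forall x t, (- s < x < s)%R -> holo_at k (circ_pt 0 x t)).
    { intros x t Hx. apply holo_at_div; [apply holo_at_const| |].
      - apply holo_at_plus; [apply holo_at_const|].
        apply holo_at_mult; [apply holo_at_const | apply holo_at_id].
      - replace (1 + - c * circ_pt 0 x t) with (1 - c * circ_pt 0 x t) by ring.
        apply one_minus_nz. rewrite Cmod_mult, Hc.
        replace (circ_pt 0 x t) with (circ_pt 0 x t - 0) by ring. rewrite circ_pt_dist.
        apply Rmult_lt_reg_r with (r * r)%R; [apply Rmult_lt_0_compat; lra|].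
        replace (Cmod u * / (r * r) * Rabs x * (r * r))%R with (Cmod u * Rabs x)%R
          by (field; lra).
        assert (Rabs x < s)%R by now apply Rabs_def1.
        assert (0 <= Rabs x)%R by apply Rabs_pos. unfold s in *.
        destruct (Req_dec (Cmod u) 0) as [->|Hu0]; [nra|].
        apply Rlt_le_trans with (Cmod u * (r + (r - Cmod u)))%R; [|nra].
        apply Rmult_lt_compat_l; lra. }
  assert (Hk : circ k 0 r = 2 * PI).
  { rewrite <- (circ_const k 0 (- s) 0 r s); unfold s in *; try lra.
    - rewrite circ_0. unfold k. replace (1 / (1 + - c * 0)) with (RtoC 1) by field. ring.
    - intros x t Hx. now apply holo_at_Ccont, Hsafe.
    - intros x t Hx. apply Hsafe. lra. }
  assert (Hpt : forall t, geom_kernel u (circ_pt 0 r t) = Cconj (k (circ_pt 0 r t))).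
  { intros t. set (z := circ_pt 0 r t).
    assert (Hz : Cmod z = r) by (apply Cmod_circ_pt_0; lra).
    assert (Hz0 : z <> 0) by (apply Cmod_gt_0; lra).
    assert (Hzu : z - u <> 0).
    { apply Cminus_eq_contra. intros H. rewrite H in Hz. lra. }
    assert (Hzz : Cconj z * z = RtoC (r * r)).
    { rewrite Cmult_comm, <- Cmod2_conj, Hz. f_equal. ring. }
    assert (Hden : 1 - c * z <> 0).
    { apply one_minus_nz. rewrite Cmod_mult, Hc, Hz.
      apply Rmult_lt_reg_r with r; [lra|].
      replace (Cmod u * / (r * r) * r * r)%R with (Cmod u) by (field; lra). lra. }
    unfold k. replace (1 + - c * z) with (1 - c * z) by ring.
    rewrite Cdiv_conj by assumption. rewrite Cminus_conj, Cmult_conj.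
    unfold c. rewrite Cmult_conj, Cconj_conj.
    replace (Cconj 1) with (RtoC 1) by (apply injective_projections; simpl; ring).
    replace (Cconj (RtoC (/ (r * r)))) with (/ (Cconj z * z)).
    2:{ rewrite Hzz, <- RtoC_inv by (apply Rgt_not_eq, Rmult_lt_0_compat; lra).
        apply injective_projections; simpl; ring. }
    assert (Hcz : Cconj z <> 0).
    { apply Cmod_gt_0. rewrite Cmod_conj. lra. }
    unfold geom_kernel. field. auto. }
  apply injective_projections.
  - rewrite <- Hk. apply RInt_ext. intros t _. now rewrite Hpt.
  - assert (K2 : RInt (fun t => snd (k (circ_pt 0 r t))) 0 (2 * PI) = snd (RtoC 2 * RtoC PI))
      by (rewrite <- Hk; reflexivity).
    unfold circ, snd at 1.
    rewrite (RInt_ext (V := R_CompleteNormedModule) (fun t => snd (geom_kernel u (circ_pt 0 r t)))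
      (fun t => opp (snd (k (circ_pt 0 r t))))) by (intros t _; now rewrite Hpt).
    rewrite (RInt_opp (V := R_CompleteNormedModule)).
    + rewrite K2. unfold opp. simpl. ring.
    + apply circ_ex_RInt_snd. intros t. apply holo_at_Ccont, Hsafe. unfold s. lra.
Qed.

(** The removable singularity is filled by the derivative. Continuity at u is enough, since
    [circ_const] asks no more on the end circles of its range. *)
Definition diff_quot (m : C -> C) (u z : C) : C :=
  if Ceq_dec z u then C_derive m u else (m z - m u) / (z - u).

Lemma diff_quot_cont (m : C -> C) (u : C) : holo_at m u -> Ccont (diff_quot m u) u.
Proof.
  intros Hm. apply Ccont_eps. intros eps Heps.
  destruct (proj1 (Cder_eps _ _ _) (proj1 (holo_at_C_derive m u Hm)) (eps / 2)%R ltac:(lra))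
    as [d [Hd Hw]].
  exists d. split; [assumption|]. intros w Hwd. specialize (Hw w Hwd).
  unfold diff_quot. destruct (Ceq_dec u u) as [_|]; [|congruence].
  destruct (Ceq_dec w u) as [->|Hne].
  - replace (C_derive m u - C_derive m u) with (RtoC 0) by ring. now rewrite Cmod_0.
  - assert (Hwu : w - u <> 0) by now apply Cminus_eq_contra.
    replace ((m w - m u) / (w - u) - C_derive m u)
      with ((m w - m u - C_derive m u * (w - u)) / (w - u)) by (field; assumption).
    rewrite Cmod_div by assumption. apply Cmod_gt_0 in Hwu.
    apply Rle_lt_trans with (eps / 2)%R; [|lra].
    apply Rmult_le_reg_r with (Cmod (w - u)); [assumption|].
    unfold Rdiv at 1. rewrite Rmult_assoc, Rinv_l, Rmult_1_r by lra. exact Hw.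
Qed.

Lemma diff_quot_holo (m : C -> C) (u z : C) :
  holo_at m z -> z <> u -> holo_at (diff_quot m u) z.
Proof.
  intros Hm Hne. apply holo_at_ext_loc with (fun w => (m w + - m u) / (w + - u)).
  - assert (Hnz : z - u <> 0) by now apply Cminus_eq_contra.
    destruct (Ccont_nonzero (fun w => w - u) z) as [e He]; [|exact Hnz|].
    { apply Ccont_plus; [apply Ccont_id | apply Ccont_const]. }
    exists e. intros w Hw. unfold diff_quot. destruct (Ceq_dec w u) as [->|_]; [|reflexivity].
    exfalso. apply (He u Hw). ring.
  - apply holo_at_div.
    + apply holo_at_plus; [assumption | apply holo_at_const].
    + apply holo_at_plus; [apply holo_at_id | apply holo_at_const].
    + now apply Cminus_eq_contra.
Qed.

(* [z m(z) / (z - u)] differs from [m(u) z / (z - u)] by a function that is continuous on the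
   annulus and holomorphic off [u], whose circle means agree on both sides of [|z| = |u|]. *)
Lemma annulus_residue (m : C -> C) (u : C) (s1 r1 r2 s2 : R) :
  (0 <= s1)%R -> (s1 < r1)%R -> (r1 < Cmod u)%R -> (Cmod u < r2)%R -> (r2 < s2)%R ->
  (forall z, (s1 < Cmod z < s2)%R -> holo_at m z) ->
  circ (fun z => m z * geom_kernel u z) 0 r2 - circ (fun z => m z * geom_kernel u z) 0 r1
  = 2 * PI * m u.
Proof.
  intros Hs1 H1 H2 H3 H4 Hm.
  set (h := fun z => z * diff_quot m u z).
  assert (Hu : holo_at m u) by (apply Hm; lra).
  assert (Hmod : forall r t, (s1 < r < s2)%R -> (s1 < Cmod (circ_pt 0 r t) < s2)%R)
    by (intros r t Hr; rewrite Cmod_circ_pt_0; lra).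
  assert (Hhc : forall r t, (s1 < r < s2)%R -> Ccont h (circ_pt 0 r t)).
  { intros r t Hr. apply Ccont_mult; [apply Ccont_id|].
    destruct (Ceq_dec (circ_pt 0 r t) u) as [->|Hne].
    - now apply diff_quot_cont.
    - apply holo_at_Ccont, diff_quot_holo; [|assumption]. now apply Hm, Hmod. }
  assert (Hne : forall r t, (0 <= r)%R -> r <> Cmod u -> circ_pt 0 r t <> u).
  { intros r t Hr0 Hr H. apply Hr. now rewrite <- H, Cmod_circ_pt_0. }
  assert (Hhh : forall r t, (s1 < r < s2)%R -> r <> Cmod u -> holo_at h (circ_pt 0 r t)).
  { intros r t Hr Hru. apply holo_at_mult; [apply holo_at_id|].
    apply diff_quot_holo; [now apply Hm, Hmod | apply Hne; [lra | assumption]]. }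
  assert (Hconst : circ h 0 r1 = circ h 0 r2).
  { transitivity (circ h 0 (Cmod u)); apply circ_const with s1 s2; try lra; try assumption;
      intros r t Hr; apply Hhh; lra. }
  assert (Hsplit : forall r, (s1 < r < s2)%R -> r <> Cmod u ->
    circ (fun z => m z * geom_kernel u z) 0 r
    = circ h 0 r + m u * circ (geom_kernel u) 0 r).
  { intros r Hr Hru.
    assert (Hk : forall t, Ccont (geom_kernel u) (circ_pt 0 r t)).
    { intros t. apply holo_at_Ccont, holo_at_geom_kernel, Hne; [lra | assumption]. }
    rewrite <- circ_scal, <- circ_plus.
    - apply circ_ext. intros t. unfold h, diff_quot, geom_kernel.
      specialize (Hne r t ltac:(lra) Hru).
      destruct (Ceq_dec (circ_pt 0 r t) u) as [|_]; [contradiction|].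
      field. now apply Cminus_eq_contra.
    - intros t. now apply Hhc.
    - intros t. apply Ccont_mult; [apply Ccont_const | apply Hk].
    - exact Hk. }
  rewrite !Hsplit by lra. rewrite Hconst, circ_geom_kernel_out, circ_geom_kernel_in by lra.
  ring.
Qed.

(** * The sum of residues *)

Lemma Clim_reindex (x : nat -> C) (l : C) (s : nat -> nat) :
  (forall N, exists n0, forall n, (n0 <= n)%nat -> (N <= s n)%nat) ->
  Clim x l -> Clim (fun n => x (s n)) l.
Proof.
  intros Hs. rewrite !Clim_eps. intros H eps Heps.
  destruct (H eps Heps) as [N HN]. destruct (Hs N) as [n0 Hn0].
  exists n0. intros n Hn. now apply HN, Hn0.
Qed.

(** With products over p = a, b, c, division by the weight turns this into: prod (1 - p/x) / (1 -
    x^(-2)) + prod (1 - px) / (1 - x^2) = (1 - ab)(1 - ac) - bc (1 - ax)(1 - a/x). Both sides equal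
    1 - (ab + ac + bc) + abc (x + 1/x). [M] stands for the remaining infinite products. *)
Lemma weight_identity (a b c x M : C) :
  x <> 0 -> 1 - a * x <> 0 -> 1 - b * x <> 0 -> 1 - c * x <> 0 ->
  1 - a / x <> 0 -> 1 - b / x <> 0 -> 1 - c / x <> 0 ->
  (1 - a * b) * (1 - a * c) *
    ((1 - 1 / x ^ 2) * M / ((1 - a * x) * (1 - a / x) * ((1 - b * x) * (1 - b / x))
                           * ((1 - c * x) * (1 - c / x))))
  - b * c * ((1 - 1 / x ^ 2) * M / ((1 - b * x) * (1 - b / x) * ((1 - c * x) * (1 - c / x))))
  = M / ((1 - a * x) * (1 - b * x) * (1 - c * x))
    - M / (x ^ 2 * ((1 - a / x) * (1 - b / x) * (1 - c / x))).
Proof.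
  intros Hx Ha Hb Hc Ha' Hb' Hc'.
  assert (H : forall p, 1 - p / x <> 0 -> x - p <> 0).
  { intros p Hp Hxp. apply Hp. replace (1 - p / x) with ((x - p) / x) by now field.
    rewrite Hxp. unfold Cdiv. ring. }
  field. repeat split; auto.
Qed.

(* The residue of the integrand at [u / q ^ k], [k >= 1]. *)
Definition res_term (q : R) (a b c u : C) (k : nat) : C :=
  (1 - RtoC q ^ k * q ^ k / u ^ 2) * (u ^ 2 / q ^ S k) ^ k /
  (qp q q ^ 2 * (qp q (a * u / q ^ k) * qp q (a / u * q ^ k))
    * (qp q (b * u / q ^ k) * qp q (b / u * q ^ k))
    * (qp q (c * u / q ^ k) * qp q (c / u * q ^ k))).

(* The residue at [u / q ^ k] of [g(x) / x], with [g] as in the header. *)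
Definition bdry_term (q : R) (a b c u : C) (k : nat) : C :=
  (u ^ 2 / q ^ S k) ^ k /
  (qp q q ^ 2 * (qp q (a * u / q ^ k) * qp q (a / u * q ^ S k))
    * (qp q (b * u / q ^ k) * qp q (b / u * q ^ S k))
    * (qp q (c * u / q ^ k) * qp q (c / u * q ^ S k))).

Lemma theta_power_S (q : R) (v : C) (k : nat) :
  (0 < q < 1)%R ->
  (v / q ^ S (S k)) ^ S k = (v / q ^ S k) ^ k * (v / (RtoC q ^ S k * q ^ S k)).
Proof.
  intros Hq. assert (Hq0 := Cq_nz q Hq). assert (Hk := Cqn_nz q k Hq).
  replace (v / q ^ S (S k)) with (v / q ^ S k * / q) by (simpl; field; auto).
  rewrite Cpow_mult_l. simpl ((v / q ^ S k) ^ S k).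
  rewrite Cpow_inv by assumption. simpl. field. auto.
Qed.

(* For [|p| < 1], genericity keeps the poles of [1 / (px, p/x; q)] away from [u / q ^ k]. *)
Definition admissible (q : R) (u p : C) : Prop :=
  p <> 0 /\ (Cmod p < 1)%R /\ generic q (p * u).

Lemma admissible_mult_pow (q : R) (u p : C) (n : nat) :
  (0 < q < 1)%R -> admissible q u p -> admissible q u (p * q ^ n).
Proof.
  intros Hq [Hp0 [Hp Hg]]. repeat split.
  - apply Cmult_neq_0; [assumption | now apply Cqn_nz].
  - rewrite Cmod_mult, Cmod_qn by assumption.
    apply Rle_lt_trans with (Cmod p * 1)%R; [|now rewrite Rmult_1_r].
    apply Rmult_le_compat_l; [apply Cmod_ge_0 | apply qn_le1; assumption].
  - replace (p * q ^ n * u) with (p * u * q ^ n) by ring. now apply generic_mult_pow.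
Qed.

Lemma admissible_up_nz (q : R) (u p : C) (k : nat) :
  (0 < q < 1)%R -> admissible q u p -> qp q (p * u / q ^ k) <> 0.
Proof.
  intros Hq [_ [_ Hg]]. apply qp_generic_nz; [assumption|]. now apply generic_div_pow.
Qed.

Lemma Cmod_div_u_lt_1 (q : R) (u p : C) (k : nat) :
  (0 < q < 1)%R -> (q < Cmod u)%R -> (Cmod p < 1)%R -> (Cmod (p / u * q ^ S k) < 1)%R.
Proof.
  intros Hq Hu Hp. assert (Hu0 : u <> 0) by (apply Cmod_gt_0; lra).
  rewrite Cmod_mult, Cmod_qn, Cmod_div by assumption. simpl.
  assert (Hk := qn_le1 q k Hq). assert (Hp0 := Cmod_ge_0 p).
  apply Rmult_lt_reg_r with (Cmod u); [lra|].
  replace (Cmod p / Cmod u * (q * q ^ k) * Cmod u)%R with (Cmod p * (q * q ^ k))%R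
    by (field; lra).
  apply Rle_lt_trans with (1 * (q * 1))%R; [|lra].
  repeat apply Rmult_le_compat; try apply Rmult_le_pos; lra.
Qed.

Lemma admissible_down_nz (q : R) (u p : C) (k : nat) :
  (0 < q < 1)%R -> (q < Cmod u)%R -> admissible q u p -> qp q (p / u * q ^ S k) <> 0.
Proof.
  intros Hq Hu [_ [Hp _]]. apply qp_nz_disc; [assumption|]. now apply Cmod_div_u_lt_1.
Qed.

Lemma qp_q_nz (q : R) : (0 < q < 1)%R -> qp q q <> 0.
Proof. intros Hq. apply qp_nz_disc; [|rewrite Cmod_q]; lra. Qed.

(** The residue form of the relation between the weights and g: the residue of g(qx)/x at u /
    q^(k+1) is that of g(x)/x at u / q^k. It is verified on the explicit products through
    [weight_identity] at x = u / q^(k+1). *)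
Lemma res_bdry_telescope (q : R) (a b c u : C) (k : nat) :
  (0 < q < 1)%R -> (q < Cmod u < 1)%R ->
  admissible q u a -> admissible q u b -> admissible q u c ->
  (1 - a * b) * (1 - a * c) * res_term q a b c u (S k)
    - b * c * res_term q (a * q) b c u (S k)
  = bdry_term q a b c u (S k) - bdry_term q a b c u k.
Proof.
  intros Hq Hu Ha Hb Hc.
  assert (Hq0 := Cq_nz q Hq). assert (Hqk := Cqn_nz q k Hq).
  assert (Hu0 : u <> 0) by (apply Cmod_gt_0; lra).
  set (x := u / q ^ S k).
  assert (HqS : RtoC q ^ S k <> 0) by now apply Cqn_nz.
  assert (Hx0 : x <> 0) by now apply Cdiv_nz.
  assert (Hup : forall p, qp q (p * u / q ^ S k) = (1 - p * x) * qp q (p * u / q ^ k)).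
  { intros p. rewrite (qp_step q (p * u / q ^ S k)) by assumption. f_equal.
    - unfold x, Cdiv. ring.
    - f_equal. simpl. field. auto. }
  assert (Hdn : forall p, qp q (p / u * q ^ S k) = (1 - p / x) * qp q (p / u * q ^ S (S k))).
  { intros p. rewrite (qp_step q (p / u * q ^ S k)) by assumption. f_equal.
    - unfold x. field. auto.
    - f_equal. simpl. ring. }
  assert (Hnz : forall p, admissible q u p ->
    (qp q (p * u / q ^ k) <> 0 /\ 1 - p * x <> 0) /\
    (qp q (p / u * q ^ S (S k)) <> 0 /\ 1 - p / x <> 0)).
  { intros p Hp. assert (H1 := admissible_up_nz q u p k Hq Hp).
    assert (H2 := admissible_up_nz q u p (S k) Hq Hp).
    assert (H3 := admissible_down_nz q u p k Hq (proj1 Hu) Hp).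
    assert (H4 := admissible_down_nz q u p (S k) Hq (proj1 Hu) Hp).
    rewrite Hup in H2. rewrite Hdn in H3. repeat split; try assumption; intros H.
    - apply H2. rewrite H. ring.
    - apply H3. rewrite H. ring. }
  destruct (Hnz a Ha) as [[Xa Da] [Ya Ea]]. destruct (Hnz b Hb) as [[Xb Db] [Yb Eb]].
  destruct (Hnz c Hc) as [[Xc Dc] [Yc Ec]]. clear Hnz.
  assert (HQ := qp_q_nz q Hq).
  unfold res_term, bdry_term.
  rewrite (Hup a), (Hup b), (Hup c), (Hdn a), (Hdn b), (Hdn c).
  replace (a * q * u / q ^ S k) with (a * u / q ^ k) by (simpl; field; auto).
  replace (a * q / u * q ^ S k) with (a / u * q ^ S (S k)) by (simpl; field; auto).
  rewrite (theta_power_S q (u ^ 2) k Hq).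
  replace (u ^ 2 / (RtoC q ^ S k * q ^ S k)) with (x ^ 2) by (unfold x; simpl; field; auto).
  replace (RtoC q ^ S k * q ^ S k / u ^ 2) with (1 / x ^ 2) by (unfold x; simpl; field; auto).
  generalize dependent (qp q (a * u / q ^ k)). intros A1 HA1.
  generalize dependent (qp q (b * u / q ^ k)). intros B1 HB1.
  generalize dependent (qp q (c * u / q ^ k)). intros C1 HC1.
  generalize dependent (qp q (a / u * q ^ S (S k))). intros A2 HA2.
  generalize dependent (qp q (b / u * q ^ S (S k))). intros B2 HB2.
  generalize dependent (qp q (c / u * q ^ S (S k))). intros C2 HC2.
  generalize dependent (qp q q). intros Q HQ.
  generalize ((u ^ 2 / q ^ S k) ^ k). intros V. intros.
  (* [M] is chosen so that the first fraction of the identity is [res_term] at S k; the factor x^2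
     is the step from V to the power occurring there. *)
  assert (W := weight_identity a b c x (V * x ^ 2 / (Q ^ 2 * A1 * B1 * C1 * A2 * B2 * C2))
    Hx0 Da Db Dc Ea Eb Ec).
  transitivity ((1 - a * b) * (1 - a * c) *
    ((1 - 1 / x ^ 2) * (V * x ^ 2 / (Q ^ 2 * A1 * B1 * C1 * A2 * B2 * C2))
     / ((1 - a * x) * (1 - a / x) * ((1 - b * x) * (1 - b / x)) * ((1 - c * x) * (1 - c / x))))
    - b * c * ((1 - 1 / x ^ 2) * (V * x ^ 2 / (Q ^ 2 * A1 * B1 * C1 * A2 * B2 * C2))
     / ((1 - b * x) * (1 - b / x) * ((1 - c * x) * (1 - c / x))))).
  - clear W. clearbody x.
    generalize dependent (1 - 1 / x ^ 2). intros N.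
    generalize dependent (1 - a / x). intros ea Ea. generalize dependent (1 - b / x). intros eb Eb.
    generalize dependent (1 - c / x). intros ec Ec. generalize dependent (1 - a * x). intros da Da.
    generalize dependent (1 - b * x). intros db Db. generalize dependent (1 - c * x). intros dc Dc.
    field. repeat split; assumption.
  - rewrite W. clear W. clearbody x.
    generalize dependent (1 - a / x). intros ea Ea. generalize dependent (1 - b / x). intros eb Eb.
    generalize dependent (1 - c / x). intros ec Ec. generalize dependent (1 - a * x). intros da Da.
    generalize dependent (1 - b * x). intros db Db. generalize dependent (1 - c * x). intros dc Dc.
    intros. field. repeat split; assumption.
Qed.

(** Measures the growth of the b- and c-products of [res_term] at u / q^k: it matches the power in
    the numerator up to (bc)^k. *)
Lemma th_pair_div_pow (q : R) (b c u : C) (k : nat) :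
  (0 < q < 1)%R -> b <> 0 -> c <> 0 -> u <> 0 ->
  th q (b * u / q ^ k) * th q (c * u / q ^ k) =
  (b * c) ^ k * (u ^ 2 / q ^ S k) ^ k * (th q (b * u) * th q (c * u)).
Proof.
  intros Hq Hb Hc Hu. assert (Hq0 := Cq_nz q Hq).
  induction k as [|k IH].
  - simpl. replace (b * u / 1) with (b * u) by field. replace (c * u / 1) with (c * u) by field.
    ring.
  - assert (Hqk := Cqn_nz q k Hq).
    assert (H : forall y : C, y <> 0 -> th q (y / q ^ S k) = - (y / q ^ k / q) * th q (y / q ^ k)).
    { intros y Hy. rewrite <- th_div_q; [|assumption|].
      - f_equal. simpl. now field.
      - now apply Cdiv_nz. }
    rewrite !H by now apply Cmult_neq_0.
    transitivity (b * u / q ^ k / q * (c * u / q ^ k / q) *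
                  (th q (b * u / q ^ k) * th q (c * u / q ^ k))); [ring|].
    rewrite IH, theta_power_S by assumption. simpl Cpow. field. auto.
Qed.

(** What remains of [res_term] once (bc)^k and the two a-products are split off: free of a, and
    convergent as k grows. *)
Definition res_weight (q : R) (b c u : C) (k : nat) : C :=
  (1 - RtoC q ^ k * q ^ k / u ^ 2) * qp q (q / (b * u) * q ^ k) * qp q (q / (c * u) * q ^ k)
  * / (qp q q ^ 2 * th q (b * u) * th q (c * u))
  * / qp q (b / u * q ^ k) * / qp q (c / u * q ^ k).

Lemma res_term_weight (q : R) (a b c u : C) (m : nat) :
  (0 < q < 1)%R -> (q < Cmod u < 1)%R ->
  admissible q u a -> admissible q u b -> admissible q u c ->
  res_term q a b c u (S m) =
  / ((b * c) ^ S m * qp q (a * u / q ^ S m))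
  * (res_weight q b c u (S m) * / qp q (a / u * q ^ S m)).
Proof.
  intros Hq Hu Ha Hb Hc. set (k := S m).
  assert (Hq0 := Cq_nz q Hq). assert (Hqk := Cqn_nz q k Hq).
  assert (Hu0 : u <> 0) by (apply Cmod_gt_0; lra).
  assert (HQ := qp_q_nz q Hq).
  assert (Hb0 := proj1 Hb). assert (Hc0 := proj1 Hc).
  assert (Hbu : b * u <> 0) by now apply Cmult_neq_0.
  assert (Hcu : c * u <> 0) by now apply Cmult_neq_0.
  assert (Htb := th_generic_nz q _ Hq Hbu (proj2 (proj2 Hb))).
  assert (Htc := th_generic_nz q _ Hq Hcu (proj2 (proj2 Hc))).
  assert (Hpair := th_pair_div_pow q b c u k Hq Hb0 Hc0 Hu0).
  assert (A1 := admissible_up_nz q u a k Hq Ha). assert (B1 := admissible_up_nz q u b k Hq Hb).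
  assert (C1 := admissible_up_nz q u c k Hq Hc).
  assert (A2 := admissible_down_nz q u a m Hq (proj1 Hu) Ha).
  assert (B2 := admissible_down_nz q u b m Hq (proj1 Hu) Hb).
  assert (C2 := admissible_down_nz q u c m Hq (proj1 Hu) Hc).
  fold k in A2, B2, C2.
  assert (Hbc : (b * c) ^ k <> 0) by now apply Cpow_nz, Cmult_neq_0.
  unfold th at 1 2 in Hpair.
  replace (q / (b * u / q ^ k)) with (q / (b * u) * q ^ k) in Hpair by (field; auto).
  replace (q / (c * u / q ^ k)) with (q / (c * u) * q ^ k) in Hpair by (field; auto).
  assert (HV : (u ^ 2 / q ^ S k) ^ k =
    qp q (b * u / q ^ k) * qp q (q / (b * u) * q ^ k) *
    (qp q (c * u / q ^ k) * qp q (q / (c * u) * q ^ k))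
    / ((b * c) ^ k * (th q (b * u) * th q (c * u)))).
  { rewrite Hpair. clear - Hbc Htb Htc.
    generalize ((u ^ 2 / q ^ S k) ^ k). generalize dependent ((b * c) ^ k).
    generalize dependent (th q (b * u)). generalize dependent (th q (c * u)). intros.
    field. repeat split; assumption. }
  unfold res_term, res_weight. rewrite HV. clear HV Hpair.
  generalize dependent ((b * c) ^ k). intros Z HZ.
  generalize dependent (qp q (a * u / q ^ k)). generalize dependent (qp q (b * u / q ^ k)).
  generalize dependent (qp q (c * u / q ^ k)). generalize dependent (qp q (a / u * q ^ k)).
  generalize dependent (qp q (b / u * q ^ k)). generalize dependent (qp q (c / u * q ^ k)).
  generalize dependent (qp q q). generalize dependent (th q (b * u)).
  generalize dependent (th q (c * u)).
  generalize (qp q (q / (b * u) * q ^ k)) (qp q (q / (c * u) * q ^ k))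
    (1 - RtoC q ^ k * q ^ k / u ^ 2). intros.
  field. repeat split; assumption.
Qed.

Lemma res_weight_lim (q : R) (b c u : C) :
  (0 < q < 1)%R -> Clim (res_weight q b c u) (/ (qp q q ^ 2 * th q (b * u) * th q (c * u))).
Proof.
  intros Hq. eapply Clim_eq.
  - assert (Hinv : forall y, Clim (fun k => / qp q (y * q ^ k)) (/ 1))
      by (intros y; apply Clim_inv; [exact C1_nz | now apply Clim_qp_qn]).
    unfold res_weight.
    apply Clim_mult; [|apply Hinv]. apply Clim_mult; [|apply Hinv].
    apply Clim_mult; [|apply Clim_const].
    apply Clim_mult; [|now apply Clim_qp_qn]. apply Clim_mult; [|now apply Clim_qp_qn].
    apply Clim_minus; [apply Clim_const|]. apply Clim_mult; [|apply Clim_const].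
    apply Clim_mult; now apply Clim_qn.
  - replace (/ 1) with (RtoC 1) by field. unfold Cdiv. rewrite !Cmult_0_l, !Cmult_1_r.
    replace (1 - 0) with (RtoC 1) by ring. now rewrite Cmult_1_l.
Qed.

Lemma Clim_inv_qp_qn (q : R) (y : C) : (0 < q < 1)%R -> Clim (fun k => / qp q (y * q ^ k)) 1.
Proof.
  intros Hq. eapply Clim_eq.
  - apply Clim_inv; [exact C1_nz | now apply Clim_qp_qn].
  - field.
Qed.

Lemma Cmod_bc (b c : C) :
  b <> 0 -> c <> 0 -> (Cmod b < 1)%R -> (Cmod c < 1)%R -> (0 < Cmod (b * c) < 1)%R.
Proof.
  intros Hb0 Hc0 Hb Hc. apply Cmod_gt_0 in Hb0. apply Cmod_gt_0 in Hc0.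
  rewrite Cmod_mult. nra.
Qed.

(** For k = n + j + 1 both (bc)^(n-k) and the product (a u q^(n-k); q)_oo depend on n - k = - S j
    only. Residues beyond k = n thus form the negative half of the bilateral series, up to a bounded
    factor. *)
Lemma scaled_res_down (q : R) (a b c u : C) (n j : nat) :
  (0 < q < 1)%R -> (q < Cmod u < 1)%R ->
  admissible q u a -> admissible q u b -> admissible q u c ->
  (b * c) ^ n * res_term q (a * q ^ n) b c u (S (n + j)) =
  psi_down q (a * u) (b * c) j *
  (res_weight q b c u (S (n + j)) * / qp q (a / u * q ^ (n + S (n + j)))).
Proof.
  intros Hq Hu Ha Hb Hc. assert (Hqn := Cqn_nz q n Hq). assert (Hqj := Cqn_nz q (S j) Hq).
  rewrite res_term_weight by auto using admissible_mult_pow.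
  assert (Hbc : b * c <> 0) by (apply Cmult_neq_0; [apply Hb | apply Hc]).
  assert (Hu0 : u <> 0) by (apply Cmod_gt_0; lra).
  replace (a * q ^ n / u * q ^ S (n + j)) with (a / u * q ^ (n + S (n + j)))
    by (rewrite (Cpow_add_r q n (S (n + j))); field; assumption).
  unfold psi_down.
  replace (S (n + j)) with (n + S j)%nat by lia.
  replace (a * q ^ n * u / q ^ (n + S j)) with (a * u / q ^ S j)
    by (rewrite Cpow_add_r; field; auto).
  rewrite (Cpow_add_r (b * c) n (S j)).
  assert (H1 := admissible_up_nz q u a (S j) Hq Ha).
  assert (H2 := Cpow_nz (b * c) n Hbc). assert (H3 := Cpow_nz (b * c) (S j) Hbc).
  generalize (res_weight q b c u (n + S j)) (/ qp q (a / u * q ^ (n + (n + S j)))). intros.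
  generalize dependent (qp q (a * u / q ^ S j)).
  generalize dependent ((b * c) ^ n). generalize dependent ((b * c) ^ S j). intros.
  field. auto.
Qed.

(** The residues k = n - j, for j < n, give the nonnegative half, with exponent n - k = j. *)
Lemma scaled_res_up (q : R) (a b c u : C) (n j : nat) :
  (0 < q < 1)%R -> (q < Cmod u < 1)%R ->
  admissible q u a -> admissible q u b -> admissible q u c -> (j < n)%nat ->
  (b * c) ^ n * res_term q (a * q ^ n) b c u (S (n - 1 - j)) =
  psi_up q (a * u) (b * c) j *
  (res_weight q b c u (S (n - 1 - j)) * / qp q (a / u * q ^ (n + S (n - 1 - j)))).
Proof.
  intros Hq Hu Ha Hb Hc Hj. set (m := (n - 1 - j)%nat).
  assert (Hqm := Cqn_nz q (S m) Hq).
  rewrite res_term_weight by auto using admissible_mult_pow.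
  assert (Hbc : b * c <> 0) by (apply Cmult_neq_0; [apply Hb | apply Hc]).
  assert (Hu0 : u <> 0) by (apply Cmod_gt_0; lra).
  replace (a * q ^ n / u * q ^ S m) with (a / u * q ^ (n + S m))
    by (rewrite (Cpow_add_r q n (S m)); field; assumption).
  unfold psi_up.
  assert (Hn : n = (S m + j)%nat) by (unfold m; lia).
  replace (a * q ^ n * u / q ^ S m) with (a * u * q ^ j)
    by (rewrite Hn at 1; rewrite Cpow_add_r; field; auto).
  rewrite Hn at 1. rewrite (Cpow_add_r (b * c) (S m) j).
  assert (H1 := qp_generic_nz q _ Hq (generic_mult_pow q _ j Hq (proj2 (proj2 Ha)))).
  assert (H3 := Cpow_nz (b * c) (S m) Hbc).
  generalize (res_weight q b c u (S m)) (/ qp q (a / u * q ^ (n + S m))). intros.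
  generalize dependent (qp q (a * u * q ^ j)).
  generalize dependent ((b * c) ^ S m). generalize ((b * c) ^ j). intros.
  field. auto.
Qed.

Lemma res_weight_bounded (q : R) (a b c u : C) :
  (0 < q < 1)%R ->
  exists K : R, forall i k : nat,
    (Cmod (res_weight q b c u k * / qp q (a / u * q ^ i)) <= K)%R.
Proof.
  intros Hq.
  destruct (Clim_bounded _ _ (res_weight_lim q b c u Hq)) as [K1 HK1].
  destruct (Clim_bounded _ _ (Clim_inv_qp_qn q (a / u) Hq)) as [K2 HK2].
  exists (K1 * K2)%R. intros i k. rewrite Cmod_mult.
  apply Rmult_le_compat; auto using Cmod_ge_0.
Qed.

(** The case n = 0 of [scaled_res_down]: the residues are dominated by the half that converges for
    every nonzero bc. *)
Lemma res_summable (q : R) (a b c u : C) :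
  (0 < q < 1)%R -> (q < Cmod u < 1)%R ->
  admissible q u a -> admissible q u b -> admissible q u c ->
  summable (fun k => res_term q a b c u (S k)).
Proof.
  intros Hq Hu Ha Hb Hc. destruct (res_weight_bounded q a b c u Hq) as [K HK].
  assert (Hu0 : u <> 0) by (apply Cmod_gt_0; lra).
  apply summable_le with (fun k => K * Cmod (psi_down q (a * u) (b * c) k))%R.
  - intros k. assert (H := scaled_res_down q a b c u 0 k Hq Hu Ha Hb Hc).
    change (0 + k)%nat with k in H. change (0 + S k)%nat with (S k) in H. simpl (_ ^ 0) in H.
    rewrite Cmult_1_l, Cmult_1_r in H.
    rewrite H, Cmod_mult, Rmult_comm.
    apply Rmult_le_compat_r; [apply Cmod_ge_0 | apply HK].
  - apply (@ex_series_scal_l R_AbsRing R_NormedModule).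
    apply psi_down_summable; [assumption | | apply Ha |];
      apply Cmult_neq_0; try assumption; [apply Ha | apply Hb | apply Hc].
Qed.

(** Recentred at k = n, the terms tend to the constant W times the bilateral series with x = au and
    z = bc, which [psi_sum] evaluates. *)
Lemma scaled_residue_sum_lim (q : R) (a b c u : C) :
  (0 < q < 1)%R -> (q < Cmod u < 1)%R ->
  admissible q u a -> admissible q u b -> admissible q u c ->
  Clim (fun n => (b * c) ^ n * Csum (fun k => res_term q (a * q ^ n) b c u (S k)))
    (th q (a * b * c * u) /
     (qp q q * qp q (b * c) * (th q (a * u) * th q (b * u) * th q (c * u)))).
Proof.
  intros Hq Hu Ha Hb Hc. assert (Hu0 : u <> 0) by (apply Cmod_gt_0; lra).
  assert (Hau : a * u <> 0) by (apply Cmult_neq_0; [apply Ha | assumption]).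
  assert (Hbu : b * u <> 0) by (apply Cmult_neq_0; [apply Hb | assumption]).
  assert (Hcu : c * u <> 0) by (apply Cmult_neq_0; [apply Hc | assumption]).
  assert (Hbc : (0 < Cmod (b * c) < 1)%R) by (apply Cmod_bc; [apply Hb | apply Hc | apply Hb | apply Hc]).
  assert (Hbc0 : b * c <> 0) by (apply Cmod_gt_0; lra).
  assert (Hga : generic q (a * u)) by apply Ha.
  destruct (res_weight_bounded q a b c u Hq) as [K HK].
  set (W := / (qp q q ^ 2 * th q (b * u) * th q (c * u))).
  assert (Hsn : forall n, summable (fun k => res_term q (a * q ^ n) b c u (S k)))
    by (intros n; apply res_summable; auto using admissible_mult_pow).
  assert (HW : forall (s t : nat -> nat), (forall n, (n <= t n)%nat) ->
    (forall N, exists n0, forall n, (n0 <= n)%nat -> (N <= s n)%nat) ->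
    Clim (fun n => res_weight q b c u (s n) * / qp q (a / u * q ^ t n)) W).
  { intros s t Ht Hs. eapply Clim_eq.
    - apply Clim_mult.
      + apply (Clim_reindex _ _ s Hs (res_weight_lim q b c u Hq)).
      + apply (Clim_subseq _ _ t Ht (Clim_inv_qp_qn q (a / u) Hq)).
    - apply Cmult_1_r. }
  eapply Clim_eq.
  - eapply Clim_ext; [intros n; now apply Csum_scal|].
    apply (tannery_bilateral _
      (fun j => psi_down q (a * u) (b * c) j * W) (fun j => psi_up q (a * u) (b * c) j * W)
      (fun j => K * Cmod (psi_down q (a * u) (b * c) j))%R
      (fun j => K * Cmod (psi_up q (a * u) (b * c) j))%R).
    + apply (@ex_series_scal_l R_AbsRing R_NormedModule). now apply psi_down_summable.
    + apply (@ex_series_scal_l R_AbsRing R_NormedModule). now apply psi_up_summable.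
    + intros n. now apply summable_scal.
    + intros n j. rewrite scaled_res_down, Cmod_mult, Rmult_comm by assumption.
      apply Rmult_le_compat_r; [apply Cmod_ge_0 | apply HK].
    + intros n j Hj. rewrite scaled_res_up, Cmod_mult, Rmult_comm by assumption.
      apply Rmult_le_compat_r; [apply Cmod_ge_0 | apply HK].
    + intros j. eapply Clim_ext; [intros n; symmetry; now apply scaled_res_down|].
      apply Clim_mult; [apply Clim_const|].
      apply (HW (fun n => S (n + j)) (fun n => (n + S (n + j))%nat)); [intros n; lia|].
      intros N. exists N. intros n Hn. lia.
    + intros j.
      assert (H : Clim (fun n => psi_up q (a * u) (b * c) j *
        (res_weight q b c u (S (n - 1 - j)) * / qp q (a / u * q ^ (n + S (n - 1 - j)))))
        (psi_up q (a * u) (b * c) j * W)).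
      { apply Clim_mult; [apply Clim_const|].
        apply (HW (fun n => S (n - 1 - j)) (fun n => (n + S (n - 1 - j))%nat)); [intros n; lia|].
        intros N. exists (N + j + 1)%nat. intros n Hn. lia. }
      (* [scaled_res_up] needs j < n, so the limits are compared for large n. *)
      rewrite Clim_eps in H |- *. intros eps Heps. destruct (H eps Heps) as [N HN].
      exists (N + S j)%nat. intros n Hn. rewrite scaled_res_up by (try lia; assumption).
      apply HN. lia.
  - rewrite (Csum_ext (fun j => psi_down q (a * u) (b * c) j * W)
      (fun j => W * psi_down q (a * u) (b * c) j)) by (intros; ring).
    rewrite (Csum_ext (fun j => psi_up q (a * u) (b * c) j * W)
      (fun j => W * psi_up q (a * u) (b * c) j)) by (intros; ring).
    rewrite !Csum_scal by auto using psi_up_summable, psi_down_summable.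
    transitivity (W * (Csum (psi_up q (a * u) (b * c)) + Csum (psi_down q (a * u) (b * c))));
      [ring|].
    rewrite psi_sum by assumption. unfold W.
    replace (a * u * (b * c)) with (a * b * c * u) by ring.
    assert (HQ := qp_q_nz q Hq).
    assert (Hta := th_generic_nz q _ Hq Hau Hga).
    assert (Htb := th_generic_nz q _ Hq Hbu (proj2 (proj2 Hb))).
    assert (Htc := th_generic_nz q _ Hq Hcu (proj2 (proj2 Hc))).
    assert (Hqbc : qp q (b * c) <> 0) by (apply qp_nz_disc; lra).
    generalize dependent (qp q (b * c)). generalize dependent (qp q q).
    generalize dependent (th q (a * u)). generalize dependent (th q (b * u)).
    generalize dependent (th q (c * u)). generalize (th q (a * b * c * u)). intros.
    field. auto.
Qed.

(** * Shifting the contour by q *)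

(** The integrand without its factor 1/x, which belongs to the measure dx/x seen by [circ]. *)
Definition weight (q : R) (a b c u x : C) : C :=
  qp q (x ^ 2) * qp q (1 / x ^ 2) /
  (qp q (a * x) * qp q (a / x) * (qp q (b * x) * qp q (b / x)) * (qp q (c * x) * qp q (c / x))
   * (th q (u * x) * th q (u / x))).

Lemma integrand_weight (q : R) (a b c u x : C) :
  (0 < q < 1)%R -> x <> 0 ->
  qp q (a * x) * qp q (a / x) * (qp q (b * x) * qp q (b / x)) * (qp q (c * x) * qp q (c / x))
   * (th q (u * x) * th q (u / x)) <> 0 ->
  integrand q a b c u x = weight q a b c u x / x.
Proof.
  intros Hq Hx Hd. unfold integrand, weight, qpochs, thetas, map, Cprod, fold_right.
  rewrite !th_theta, !qpoch_qp by assumption.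
  set (D := qp q (a * x) * qp q (a / x) * (qp q (b * x) * qp q (b / x))
            * (qp q (c * x) * qp q (c / x)) * (th q (u * x) * th q (u / x))) in *.
  match goal with |- _ / (?d' * x) = _ => replace d' with D by (unfold D; ring) end.
  clearbody D.
  field. auto.
Qed.

(** The product (px, p/x; q)_oo without its factor 1 - p/x. For |p| < 1 it has no zero with q <= |x|
    <= 1, and it is invariant under x -> q/x. *)
Definition pole_pair (q : R) (p x : C) : C := qp q (p * x) * qp q (p / x * q).

(** The function g without 1 / ((1 - u/x)(1 - v/x)): what is left is holomorphic near the closed
    annulus q <= |x| <= 1 by [contour_num_annulus]. *)
Definition contour_num (q : R) (a b c u v x : C) : C :=
  th q (x ^ 2) / (pole_pair q a x * pole_pair q b x * pole_pair q c x
                  * (pole_pair q u x * pole_pair q v x)).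

(* The function [g] of the header, with [v = q / u]: since
   [1 / ((1 - u/x)(1 - v/x)) = (u / (1 - u/x) - v / (1 - v/x)) / (u - v)], its two poles in the
   annulus are separated. *)
Definition contour_fun (q : R) (a b c u v x : C) : C :=
  u / (u - v) * (contour_num q a b c u v x * geom_kernel u x)
  + - (v / (u - v)) * (contour_num q a b c u v x * geom_kernel v x).

Lemma Cmod_unit_mult (p x : C) : Cmod x = 1%R -> (Cmod p < 1)%R -> (Cmod (p * x) < 1)%R.
Proof. intros Hx Hp. rewrite Cmod_mult, Hx. lra. Qed.

Lemma Cmod_unit_div (p x : C) : Cmod x = 1%R -> (Cmod p < 1)%R -> (Cmod (p / x) < 1)%R.
Proof.
  intros Hx Hp. assert (x <> 0) by (apply Cmod_gt_0; lra).
  rewrite Cmod_div, Hx by assumption. lra.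
Qed.

Lemma qp_split_mult (q : R) (p x : C) :
  (0 < q < 1)%R -> qp q (p * x) = (1 - p * x) * qp q (p * (x * q)).
Proof. intros Hq. rewrite (qp_step q (p * x)) by assumption. do 2 f_equal. ring. Qed.

(** Under x -> qx, theta(x^2) acquires 1 / (q x^4), and because uv = q the factors 1 - u/x and 1 -
    v/x become 1 - vx and 1 - ux up to a total factor 1 / (q x^2). Together these leave the x^(-2)
    of [weight_identity]. *)
Lemma weight_recurrence (q : R) (a b c u v x : C) :
  (0 < q < 1)%R -> u * v = q -> u <> v -> Cmod x = 1%R ->
  (Cmod a < 1)%R -> (Cmod b < 1)%R -> (Cmod c < 1)%R -> (Cmod u < 1)%R -> (Cmod v < 1)%R ->
  (1 - a * b) * (1 - a * c) * weight q a b c u x - b * c * weight q (a * q) b c u x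
  = contour_fun q a b c u v x - contour_fun q a b c u v (x * q).
Proof.
  intros Hq Huv Hne Hx Ha Hb Hc Hu Hv.
  assert (Hq0 := Cq_nz q Hq).
  assert (Hx0 : x <> 0) by (apply Cmod_gt_0; lra).
  assert (Hu0 : u <> 0) by (intros ->; apply Hq0; rewrite <- Huv; ring).
  assert (Hv0 : v <> 0) by (intros ->; apply Hq0; rewrite <- Huv; ring).
  assert (Hdiff : u - v <> 0) by now apply Cminus_eq_contra.
  assert (Hup : forall p, qp q (p * x) = (1 - p * x) * qp q (p * (x * q)))
    by (intros p; now apply qp_split_mult).
  assert (Hdn : forall p, qp q (p / x) = (1 - p / x) * qp q (p / x * q))
    by (intros p; now apply qp_step).
  assert (Hnz : forall p, (Cmod p < 1)%R ->
    (qp q (p * (x * q)) <> 0 /\ 1 - p * x <> 0) /\ (qp q (p / x * q) <> 0 /\ 1 - p / x <> 0)).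
  { intros p Hp.
    assert (H1 := qp_nz_disc q _ Hq (Cmod_unit_mult p x Hx Hp)).
    assert (H2 := qp_nz_disc q _ Hq (Cmod_unit_div p x Hx Hp)).
    rewrite Hup in H1. rewrite Hdn in H2. repeat split; intros H.
    - apply H1. rewrite H. ring.
    - apply H1. rewrite H. ring.
    - apply H2. rewrite H. ring.
    - apply H2. rewrite H. ring. }
  destruct (Hnz a Ha) as [[Xa Da] [Ya Ea]]. destruct (Hnz b Hb) as [[Xb Db] [Yb Eb]].
  destruct (Hnz c Hc) as [[Xc Dc] [Yc Ec]]. destruct (Hnz u Hu) as [[Xu Du] [Yu Eu]].
  destruct (Hnz v Hv) as [[Xv Dv] [Yv Ev]]. clear Hnz.
  assert (Hth : th q ((x * q) ^ 2) = th q (x ^ 2) / (x ^ 4 * q)).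
  { replace ((x * q) ^ 2) with (x ^ 2 * q * q) by ring.
    rewrite !th_mult_q; auto using Cmult_neq_0, Cpow_nz. field. auto. }
  assert (Hker : forall y : C, y <> 0 -> 1 - u / y <> 0 -> 1 - v / y <> 0 ->
    u / (u - v) * geom_kernel u y + - (v / (u - v)) * geom_kernel v y
    = 1 / ((1 - u / y) * (1 - v / y))).
  { intros y Hy H1 H2. unfold geom_kernel.
    assert (Hyu : forall p, 1 - p / y <> 0 -> y - p <> 0).
    { intros p Hp H. apply Hp. replace (1 - p / y) with ((y - p) / y) by now field.
      rewrite H. unfold Cdiv. ring. }
    field. repeat split; auto. }
  assert (Hcf : forall y : C, y <> 0 -> 1 - u / y <> 0 -> 1 - v / y <> 0 ->
    contour_fun q a b c u v y =
    contour_num q a b c u v y * (1 / ((1 - u / y) * (1 - v / y)))).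
  { intros y Hy H1 H2. rewrite <- Hker by assumption. unfold contour_fun. ring. }
  assert (Hxq0 : x * q <> 0) by now apply Cmult_neq_0.
  assert (Hu' : 1 - u / (x * q) = - (1 - v * x) / (v * x)).
  { rewrite <- Huv. field. auto. }
  assert (Hv' : 1 - v / (x * q) = - (1 - u * x) / (u * x)).
  { rewrite <- Huv. field. auto. }
  assert (Hopp : forall y : C, y <> 0 -> - y <> 0).
  { intros y Hy H. apply Hy. replace y with (- - y) by ring. rewrite H. ring. }
  rewrite (Hcf x), (Hcf (x * q)); try assumption.
  2:{ rewrite Hu'. apply Cdiv_nz; auto using Cmult_neq_0. }
  2:{ rewrite Hv'. apply Cdiv_nz; auto using Cmult_neq_0. }
  rewrite Hu', Hv'. clear Hker Hcf Hu' Hv' Hopp.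
  unfold contour_num. rewrite Hth. clear Hth.
  unfold pole_pair, weight, th.
  replace (q / (u * x)) with (v / x) by (rewrite <- Huv; field; auto).
  replace (q / (u / x)) with (v * x) by (rewrite <- Huv; field; auto).
  replace (q / x ^ 2) with (1 / x ^ 2 * q) by (field; auto).
  rewrite (qp_step q (1 / x ^ 2)) by assumption.
  rewrite (Hup a), (Hup b), (Hup c), (Hup u), (Hup v).
  rewrite (Hdn a), (Hdn b), (Hdn c), (Hdn u), (Hdn v).
  replace (a * q * x) with (a * (x * q)) by ring.
  replace (a * q / x) with (a / x * q) by (field; auto).
  assert (Hpq : forall p, p / (x * q) * q = p / x) by (intros p; field; auto).
  rewrite !Hpq. rewrite (Hdn a), (Hdn b), (Hdn c), (Hdn u), (Hdn v).
  clear Hup Hdn Hpq Ha Hb Hc Hu Hv Hx Hxq0.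
  generalize dependent (qp q (a * (x * q))). intros A1 HA1.
  generalize dependent (qp q (b * (x * q))). intros B1 HB1.
  generalize dependent (qp q (c * (x * q))). intros C1 HC1.
  generalize dependent (qp q (u * (x * q))). intros U1 HU1.
  generalize dependent (qp q (v * (x * q))). intros V1 HV1.
  generalize dependent (qp q (a / x * q)). intros A2 HA2.
  generalize dependent (qp q (b / x * q)). intros B2 HB2.
  generalize dependent (qp q (c / x * q)). intros C2 HC2.
  generalize dependent (qp q (u / x * q)). intros U2 HU2.
  generalize dependent (qp q (v / x * q)). intros V2 HV2.
  generalize (qp q (x ^ 2)) (qp q (1 / x ^ 2 * q)). intros N1 N2.
  assert (W := weight_identity a b c x
    (N1 * N2 / (A1 * B1 * C1 * A2 * B2 * C2 * ((1 - u * x) * U1 * ((1 - v / x) * V2)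
       * ((1 - u / x) * U2 * ((1 - v * x) * V1))))) Hx0 Da Db Dc Ea Eb Ec).
  set (M := N1 * N2 / _) in W.
  transitivity ((1 - a * b) * (1 - a * c) *
    ((1 - 1 / x ^ 2) * M
     / ((1 - a * x) * (1 - a / x) * ((1 - b * x) * (1 - b / x)) * ((1 - c * x) * (1 - c / x))))
    - b * c * ((1 - 1 / x ^ 2) * M
     / ((1 - b * x) * (1 - b / x) * ((1 - c * x) * (1 - c / x))))).
  - unfold M. clear W M.
    generalize dependent (1 - 1 / x ^ 2). intros N.
    generalize dependent (1 - a / x). intros ea Ea. generalize dependent (1 - b / x). intros eb Eb.
    generalize dependent (1 - c / x). intros ec Ec. generalize dependent (1 - a * x). intros da Da.
    generalize dependent (1 - b * x). intros db Db. generalize dependent (1 - c * x). intros dc Dc.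
    generalize dependent (1 - u / x). intros eu Eu. generalize dependent (1 - v / x). intros ev Ev.
    generalize dependent (1 - u * x). intros du Du. generalize dependent (1 - v * x). intros dv Dv.
    field. repeat split; assumption.
  - rewrite W. unfold M. clear W M. rewrite <- Huv.
    generalize dependent (1 - a / x). intros ea Ea. generalize dependent (1 - b / x). intros eb Eb.
    generalize dependent (1 - c / x). intros ec Ec. generalize dependent (1 - a * x). intros da Da.
    generalize dependent (1 - b * x). intros db Db. generalize dependent (1 - c * x). intros dc Dc.
    generalize dependent (1 - u / x). intros eu Eu. generalize dependent (1 - v / x). intros ev Ev.
    generalize dependent (1 - u * x). intros du Du. generalize dependent (1 - v * x). intros dv Dv.
    field. repeat split; assumption.
Qed.

Lemma holo_at_pole_pair (q : R) (p x : C) :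
  (0 < q < 1)%R -> x <> 0 -> holo_at (pole_pair q p) x.
Proof.
  intros Hq Hx. apply holo_at_mult; apply holo_at_qp; try assumption.
  - apply holo_at_mult; [apply holo_at_const | apply holo_at_id].
  - apply holo_at_mult; [|apply holo_at_const].
    apply (holo_at_div (fun _ => p) (fun y => y));
      [apply holo_at_const | apply holo_at_id | assumption].
Qed.

Lemma holo_at_th (q : R) (f : C -> C) (x : C) :
  (0 < q < 1)%R -> holo_at f x -> f x <> 0 -> holo_at (fun y => th q (f y)) x.
Proof.
  intros Hq Hf Hx. apply holo_at_mult; apply holo_at_qp; try assumption.
  apply holo_at_div; [apply holo_at_const | assumption | assumption].
Qed.

Lemma pole_pair_nz (q M : R) (p x : C) :
  (0 < q < 1)%R -> (0 < M)%R -> (Cmod p <= M)%R -> (q * M < Cmod x < / M)%R ->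
  pole_pair q p x <> 0.
Proof.
  intros Hq HM Hp Hx. assert (Hp0 := Cmod_ge_0 p).
  assert (HqM : (0 < q * M)%R) by (apply Rmult_lt_0_compat; lra).
  assert (Hx0 : x <> 0) by (apply Cmod_gt_0; lra).
  assert (HMx : (M * Cmod x < 1)%R).
  { apply Rmult_lt_reg_l with (/ M)%R; [now apply Rinv_0_lt_compat|].
    rewrite <- Rmult_assoc, Rinv_l by lra. lra. }
  apply Cmult_neq_0; apply qp_nz_disc; try assumption.
  - rewrite Cmod_mult. apply Rle_lt_trans with (M * Cmod x)%R; [|assumption].
    apply Rmult_le_compat_r; lra.
  - rewrite Cmod_mult, Cmod_div, Cmod_q by assumption.
    apply Rmult_lt_reg_r with (Cmod x); [lra|].
    replace (Cmod p / Cmod x * q * Cmod x)%R with (q * Cmod p)%R by (field; lra).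
    rewrite Rmult_1_l. apply Rle_lt_trans with (q * M)%R; [|lra].
    apply Rmult_le_compat_l; lra.
Qed.

Lemma contour_num_holo (q M : R) (a b c u v x : C) :
  (0 < q < 1)%R -> (0 < M)%R ->
  (Cmod a <= M)%R -> (Cmod b <= M)%R -> (Cmod c <= M)%R -> (Cmod u <= M)%R -> (Cmod v <= M)%R ->
  (q * M < Cmod x < / M)%R ->
  holo_at (contour_num q a b c u v) x.
Proof.
  intros Hq HM Ha Hb Hc Hu Hv Hx.
  assert (HqM : (0 < q * M)%R) by (apply Rmult_lt_0_compat; lra).
  assert (Hx0 : x <> 0) by (apply Cmod_gt_0; lra).
  apply holo_at_div.
  - apply (holo_at_th q (fun y => y ^ 2)); [assumption | | now apply Cpow_nz].
    apply (holo_at_pow (fun y => y)), holo_at_id.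
  - assert (H : forall p, holo_at (pole_pair q p) x) by (intros p; now apply holo_at_pole_pair).
    exact (holo_at_mult _ _ x
      (holo_at_mult _ _ x (holo_at_mult _ _ x (H a) (H b)) (H c)) (holo_at_mult _ _ x (H u) (H v))).
  - assert (H : forall p, (Cmod p <= M)%R -> pole_pair q p x <> 0)
      by (intros p Hp; now apply pole_pair_nz with M).
    exact (Cmult_neq_0 _ _ (Cmult_neq_0 _ _ (Cmult_neq_0 _ _ (H a Ha) (H b Hb)) (H c Hc))
      (Cmult_neq_0 _ _ (H u Hu) (H v Hv))).
Qed.

Lemma bdry_term_0 (q : R) (a b c u : C) :
  bdry_term q a b c u 0 =
  1 / (qp q q ^ 2 * pole_pair q a u * pole_pair q b u * pole_pair q c u).
Proof.
  unfold bdry_term, pole_pair.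
  assert (H : forall p, p * u / RtoC q ^ 0 = p * u) by (intros p; simpl; field).
  rewrite !H, !Cpow_1_r. reflexivity.
Qed.

(** With uv = q the u- and v-products at x = u are those of theta(u^2), up to the factor 1 - v/u and
    two copies of (q;q)_oo. Genericity of u^2 permits the cancellation; 1 - v/u later meets the u /
    (u - v) of [contour_fun]. *)
Lemma contour_num_at_pole (q : R) (a b c u v : C) :
  (0 < q < 1)%R -> u * v = q -> u <> v -> generic q (u ^ 2) ->
  pole_pair q a u <> 0 -> pole_pair q b u <> 0 -> pole_pair q c u <> 0 ->
  contour_num q a b c u v u = (1 - v / u) / (qp q q ^ 2 *
     pole_pair q a u * pole_pair q b u * pole_pair q c u) .
Proof.
  intros Hq Huv Hne Hg HA HB HC. assert (Hq0 := Cq_nz q Hq).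
  assert (Hu0 : u <> 0) by (intros ->; apply Hq0; rewrite <- Huv; ring).
  assert (Hv0 : v <> 0) by (intros ->; apply Hq0; rewrite <- Huv; ring).
  unfold contour_num. unfold pole_pair at 4 5, th.
  replace (v * u) with (RtoC q) by (rewrite <- Huv; ring).
  replace (u / u * q) with (RtoC q) by (field; assumption).
  replace (q / u ^ 2) with (v / u) by (rewrite <- Huv; field; assumption).
  replace (u * u) with (u ^ 2) by ring.
  rewrite (qp_step q (v / u)) by assumption.
  assert (H1 := qp_generic_nz q _ Hq Hg).
  assert (H2 : qp q (v / u * q) <> 0).
  { replace (v / u * q) with (q / u ^ 2 * q ^ 1).
    - apply qp_generic_nz; [assumption|]. apply generic_mult_pow; [assumption|].
      apply generic_q_div; [assumption | now apply Cpow_nz | assumption].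
    - rewrite Cpow_1_r. f_equal. rewrite <- Huv. field. assumption. }
  assert (HQ := qp_q_nz q Hq).
  generalize dependent (pole_pair q a u). generalize dependent (pole_pair q b u).
  generalize dependent (pole_pair q c u). generalize dependent (qp q (u ^ 2)).
  generalize dependent (qp q (v / u * q)). generalize dependent (qp q q).
  generalize (1 - v / u). intros. field. repeat split; assumption.
Qed.

Lemma pole_pair_reflect (q : R) (p u v : C) :
  (0 < q < 1)%R -> u * v = q -> pole_pair q p v = pole_pair q p u.
Proof.
  intros Hq Huv. assert (Hq0 := Cq_nz q Hq).
  assert (Hu0 : u <> 0) by (intros ->; apply Hq0; rewrite <- Huv; ring).
  assert (Hv0 : v <> 0) by (intros ->; apply Hq0; rewrite <- Huv; ring).
  unfold pole_pair. rewrite Cmult_comm. f_equal; f_equal; rewrite <- Huv; field; assumption.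
Qed.

Lemma contour_num_sym (q : R) (a b c u v x : C) :
  contour_num q a b c v u x = contour_num q a b c u v x.
Proof. unfold contour_num. now rewrite (Cmult_comm (pole_pair q v x)). Qed.

Lemma contour_num_annulus (q : R) (a b c u v : C) :
  (0 < q < 1)%R ->
  (Cmod a < 1)%R -> (Cmod b < 1)%R -> (Cmod c < 1)%R -> (0 < Cmod u < 1)%R -> (Cmod v < 1)%R ->
  exists s1 s2 : R, (0 <= s1)%R /\ (s1 < q)%R /\ (1 < s2)%R /\
    forall z, (s1 < Cmod z < s2)%R -> holo_at (contour_num q a b c u v) z.
Proof.
  intros Hq Ha Hb Hc Hu Hv.
  (* A common bound M < 1 on the parameters makes qM < |z| < 1/M an open annulus around q <= |z| <=
     1. *)
  set (M := Rmax (Rmax (Cmod a) (Rmax (Cmod b) (Cmod c))) (Rmax (Cmod u) (Cmod v))).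
  assert (HM : (Cmod a <= M /\ Cmod b <= M /\ Cmod c <= M /\ Cmod u <= M /\ Cmod v <= M)%R).
  { unfold M. repeat split; eauto 6 using Rle_trans, Rmax_l, Rmax_r. }
  destruct HM as [Ma [Mb [Mc [Mu Mv]]]].
  assert (HM1 : (M < 1)%R) by (unfold M; repeat apply Rmax_lub_lt; lra).
  exists (q * M)%R, (/ M)%R. repeat split.
  - apply Rmult_le_pos; lra.
  - nra.
  - rewrite <- Rinv_1. apply Rinv_lt_contravar; lra.
  - intros z Hz. apply contour_num_holo with M; lra || assumption.
Qed.

Lemma contour_term_cont (q : R) (a b c u v p : C) (r t : R) :
  (0 < q < 1)%R ->
  (Cmod a < 1)%R -> (Cmod b < 1)%R -> (Cmod c < 1)%R -> (0 < Cmod u < 1)%R -> (Cmod v < 1)%R ->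
  (q < Cmod p < 1)%R -> (r = q \/ r = 1%R) ->
  Ccont (fun z => contour_num q a b c u v z * geom_kernel p z) (circ_pt 0 r t).
Proof.
  intros Hq Ha Hb Hc Hu Hv Hp Hr.
  destruct (contour_num_annulus q a b c u v) as [s1 [s2 [_ [Hs1 [Hs2 Hm]]]]]; try assumption.
  assert (Hr' : Cmod (circ_pt 0 r t) = r)
    by (apply Cmod_circ_pt_0; destruct Hr as [-> | ->]; lra).
  apply holo_at_Ccont, holo_at_mult.
  - apply Hm. rewrite Hr'. destruct Hr as [-> | ->]; lra.
  - apply holo_at_geom_kernel. intros H. rewrite H in Hr'. destruct Hr as [-> | ->]; lra.
Qed.

Lemma contour_fun_cont (q : R) (a b c u v : C) (r t : R) :
  (0 < q < 1)%R ->
  (Cmod a < 1)%R -> (Cmod b < 1)%R -> (Cmod c < 1)%R ->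
  (q < Cmod u < 1)%R -> (q < Cmod v < 1)%R -> (r = q \/ r = 1%R) ->
  Ccont (contour_fun q a b c u v) (circ_pt 0 r t).
Proof.
  intros Hq Ha Hb Hc Hu Hv Hr.
  apply Ccont_plus; (apply Ccont_mult; [apply Ccont_const|]); apply contour_term_cont; lra || assumption.
Qed.

(* Both poles [u] and [v = q / u] contribute the same residue. *)
Lemma contour_fun_shift (q : R) (a b c u v : C) :
  (0 < q < 1)%R -> u * v = q -> u <> v ->
  generic q (u ^ 2) -> generic q (v ^ 2) ->
  (q < Cmod u < 1)%R -> (q < Cmod v < 1)%R ->
  admissible q u a -> admissible q u b -> admissible q u c ->
  circ (contour_fun q a b c u v) 0 1 - circ (contour_fun q a b c u v) 0 q
  = 4 * PI * bdry_term q a b c u 0.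
Proof.
  intros Hq Huv Hne Hgu Hgv Hu Hv Ha Hb Hc.
  assert (Hu0 : u <> 0) by (apply Cmod_gt_0; lra).
  assert (Hv0 : v <> 0) by (apply Cmod_gt_0; lra).
  set (m := contour_num q a b c u v).
  destruct (contour_num_annulus q a b c u v) as [s1 [s2 [Hs0 [Hs1 [Hs2 Hm]]]]];
    [assumption | apply Ha | apply Hb | apply Hc | lra | lra |].
  assert (Hk : forall p r t, (q < Cmod p < 1)%R -> (r = q \/ r = 1%R) ->
    Ccont (fun z => m z * geom_kernel p z) (circ_pt 0 r t)).
  { intros p r t Hp Hr.
    apply contour_term_cont; [assumption | apply Ha | apply Hb | apply Hc | lra | lra | | ]; assumption. }
  assert (Hlin : forall r, (r = q \/ r = 1%R) ->
    circ (contour_fun q a b c u v) 0 r =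
    u / (u - v) * circ (fun z => m z * geom_kernel u z) 0 r
    + - (v / (u - v)) * circ (fun z => m z * geom_kernel v z) 0 r).
  { intros r Hr. rewrite <- !circ_scal by (intros t; now apply Hk).
    apply (circ_plus (fun z => u / (u - v) * (m z * geom_kernel u z))
      (fun z => - (v / (u - v)) * (m z * geom_kernel v z)));
      intros t; apply Ccont_mult; auto using Ccont_const. }
  rewrite !Hlin by auto.
  assert (Ru := annulus_residue m u s1 q 1 s2 Hs0 Hs1 (proj1 Hu) (proj2 Hu) Hs2 Hm).
  assert (Rv := annulus_residue m v s1 q 1 s2 Hs0 Hs1 (proj1 Hv) (proj2 Hv) Hs2 Hm).
  match goal with |- ?A * ?U1 + ?B * ?V1 - (_ * ?U2 + _ * ?V2) = _ =>
    transitivity (A * (U1 - U2) + B * (V1 - V2)); [ring|] end.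
  rewrite Ru, Rv. unfold m.
  assert (Hnz : forall p, admissible q u p -> pole_pair q p u <> 0).
  { intros p Hp. apply Cmult_neq_0.
    - apply qp_generic_nz; [assumption | apply Hp].
    - rewrite <- (Cpow_1_r q). apply admissible_down_nz; [assumption | apply Hu | assumption]. }
  rewrite (contour_num_at_pole q a b c u v) by auto.
  (* Exchanging u and v reduces the pole at v to the case of u; [pole_pair_reflect] then moves the
     values back to u. *)
  rewrite <- (contour_num_sym q a b c u v v).
  rewrite (contour_num_at_pole q a b c v u);
    rewrite ?(pole_pair_reflect q _ u v Hq Huv); auto; [|now rewrite Cmult_comm].
  rewrite bdry_term_0.
  assert (HA := Hnz a Ha). assert (HB := Hnz b Hb). assert (HC := Hnz c Hc).
  assert (HQ := qp_q_nz q Hq). clear - HA HB HC HQ Hu0 Hv0 Hne.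
  generalize dependent (pole_pair q a u). generalize dependent (pole_pair q b u).
  generalize dependent (pole_pair q c u). generalize dependent (qp q q). intros.
  field. repeat split; auto. now apply Cminus_eq_contra.
Qed.

(** * Evaluation *)

Lemma holo_at_qp_mult (q : R) (p x : C) :
  (0 < q < 1)%R -> holo_at (fun y => qp q (p * y)) x.
Proof.
  intros Hq. apply holo_at_qp; [assumption|].
  apply holo_at_mult; [apply holo_at_const | apply holo_at_id].
Qed.

Lemma holo_at_qp_div (q : R) (p x : C) :
  (0 < q < 1)%R -> x <> 0 -> holo_at (fun y => qp q (p / y)) x.
Proof.
  intros Hq Hx. apply holo_at_qp; [assumption|].
  apply (holo_at_div (fun _ => p) (fun y => y)); [apply holo_at_const | apply holo_at_id | assumption].
Qed.

Definition weight_den (q : R) (a b c x : C) : C :=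
  qp q (a * x) * qp q (a / x) * (qp q (b * x) * qp q (b / x)) * (qp q (c * x) * qp q (c / x)).

Lemma holo_at_weight_den (q : R) (a b c x : C) :
  (0 < q < 1)%R -> x <> 0 -> holo_at (weight_den q a b c) x.
Proof.
  intros Hq Hx.
  assert (H : forall p, holo_at (fun y => qp q (p * y) * qp q (p / y)) x).
  { intros p. apply holo_at_mult; [now apply holo_at_qp_mult | now apply holo_at_qp_div]. }
  exact (holo_at_mult _ _ x (holo_at_mult _ _ x (H a) (H b)) (H c)).
Qed.

Lemma weight_den_unit_nz (q : R) (a b c x : C) :
  (0 < q < 1)%R -> Cmod x = 1%R -> (Cmod a < 1)%R -> (Cmod b < 1)%R -> (Cmod c < 1)%R ->
  weight_den q a b c x <> 0.
Proof.
  intros Hq Hx Ha Hb Hc.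
  assert (H : forall p, (Cmod p < 1)%R -> qp q (p * x) * qp q (p / x) <> 0).
  { intros p Hp. apply Cmult_neq_0; apply qp_nz_disc; try assumption;
      [now apply Cmod_unit_mult | now apply Cmod_unit_div]. }
  exact (Cmult_neq_0 _ _ (Cmult_neq_0 _ _ (H a Ha) (H b Hb)) (H c Hc)).
Qed.

Lemma theta_den_unit_nz (q : R) (u x : C) :
  (0 < q < 1)%R -> (q < Cmod u < 1)%R -> Cmod x = 1%R -> th q (u * x) * th q (u / x) <> 0.
Proof.
  intros Hq Hu Hx. assert (Hx0 : x <> 0) by (apply Cmod_gt_0; lra).
  assert (Hu0 : u <> 0) by (apply Cmod_gt_0; lra).
  assert (Hv : (Cmod (q / u) < 1)%R).
  { rewrite Cmod_div, Cmod_q by assumption. apply Rmult_lt_reg_r with (Cmod u); [lra|].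
    replace (q / Cmod u * Cmod u)%R with q by (field; lra). lra. }
  unfold th. apply Cmult_neq_0; apply Cmult_neq_0; apply qp_nz_disc; try assumption.
  - apply Cmod_unit_mult; [assumption | apply Hu].
  - replace (q / (u * x)) with (q / u / x) by (field; auto). now apply Cmod_unit_div.
  - apply Cmod_unit_div; [assumption | apply Hu].
  - replace (q / (u / x)) with (q / u * x) by (field; auto). now apply Cmod_unit_mult.
Qed.

Lemma holo_at_weight (q : R) (a b c u x : C) :
  (0 < q < 1)%R -> u <> 0 -> x <> 0 ->
  weight_den q a b c x <> 0 -> th q (u * x) * th q (u / x) <> 0 ->
  holo_at (weight q a b c u) x.
Proof.
  intros Hq Hu Hx H1 H2.
  apply (holo_at_div (fun y => qp q (y ^ 2) * qp q (1 / y ^ 2))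
    (fun y => weight_den q a b c y * (th q (u * y) * th q (u / y)))).
  - apply holo_at_mult; apply holo_at_qp; try assumption.
    + apply (holo_at_pow (fun y => y)), holo_at_id.
    + apply (holo_at_div (fun _ => 1) (fun y => y ^ 2)); [apply holo_at_const | |now apply Cpow_nz].
      apply (holo_at_pow (fun y => y)), holo_at_id.
  - apply holo_at_mult; [now apply holo_at_weight_den|].
    apply holo_at_mult.
    + apply (holo_at_th q (fun y => u * y)); [assumption | | now apply Cmult_neq_0].
      apply holo_at_mult; [apply holo_at_const | apply holo_at_id].
    + apply (holo_at_th q (fun y => u / y)); [assumption | | now apply Cdiv_nz].
      apply (holo_at_div (fun _ => u) (fun y => y));
        [apply holo_at_const | apply holo_at_id | assumption].
  - now apply Cmult_neq_0.
Qed.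

Lemma weight_unit_cont (q : R) (a b c u : C) (t : R) :
  (0 < q < 1)%R -> (q < Cmod u < 1)%R ->
  (Cmod a < 1)%R -> (Cmod b < 1)%R -> (Cmod c < 1)%R ->
  Ccont (weight q a b c u) (circ_pt 0 1 t).
Proof.
  intros Hq Hu Ha Hb Hc. assert (Hx : Cmod (circ_pt 0 1 t) = 1%R) by (apply Cmod_circ_pt_0; lra).
  apply holo_at_Ccont, holo_at_weight; try assumption.
  - apply Cmod_gt_0. lra.
  - apply Cmod_gt_0. lra.
  - now apply weight_den_unit_nz.
  - now apply theta_den_unit_nz.
Qed.

Lemma circ_integrand (q : R) (a b c u : C) :
  (0 < q < 1)%R -> (q < Cmod u < 1)%R ->
  (Cmod a < 1)%R -> (Cmod b < 1)%R -> (Cmod c < 1)%R ->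
  is_circle_int (integrand q a b c u) 0 1 (Ci * circ (weight q a b c u) 0 1).
Proof.
  intros Hq Hu Ha Hb Hc. apply is_circle_int_circ.
  - intros t. now apply weight_unit_cont.
  - intros t. assert (Hx : Cmod (circ_pt 0 1 t) = 1%R) by (apply Cmod_circ_pt_0; lra).
    assert (Hx0 : circ_pt 0 1 t <> 0) by (apply Cmod_gt_0; lra).
    rewrite integrand_weight; try assumption.
    + replace (1 * expi t) with (circ_pt 0 1 t) by (unfold circ_pt; ring). field. assumption.
    + exact (Cmult_neq_0 _ _ (weight_den_unit_nz q a b c _ Hq Hx Ha Hb Hc)
        (theta_den_unit_nz q u _ Hq Hu Hx)).
Qed.

Lemma power_div_S (v q : C) (n : nat) :
  q <> 0 -> (v / q ^ S n) ^ S n = (v / q ^ n) ^ n * (v / (q ^ n * q ^ n * q)).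
Proof.
  intros Hq. assert (Hn := Cpow_nz q n Hq).
  replace (v / q ^ S n) with (v / q ^ n * / q) by (simpl; field; auto).
  rewrite Cpow_mult_l, Cpow_inv by assumption. simpl. field. auto.
Qed.

(** The factor (y^2 / q^k)^k also occurs in [th_den_div_pow] and cancels in the integrand; the other
    power becomes the one in [res_term] at y = u. *)
Lemma th_square_div_pow (q : R) (y : C) (k : nat) :
  (0 < q < 1)%R -> y <> 0 ->
  th q ((y / q ^ k) ^ 2) = (y ^ 2 / q ^ k) ^ k * (y ^ 2 / q ^ S k) ^ k * th q (y ^ 2).
Proof.
  intros Hq Hy. assert (Hq0 := Cq_nz q Hq).
  induction k as [|k IH].
  - simpl. replace (y / 1) with y by field. ring.
  - assert (Hqk := Cqn_nz q k Hq).
    replace ((y / q ^ S k) ^ 2) with ((y / q ^ k) ^ 2 / q / q) by (simpl; field; auto).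
    assert (Hz : (y / q ^ k) ^ 2 <> 0) by now apply Cpow_nz, Cdiv_nz.
    rewrite (th_div_q q (_ / q)), th_div_q by auto using Cdiv_nz.
    rewrite IH, theta_power_S, power_div_S by assumption. simpl Cpow. field. auto.
Qed.

Lemma th_den_div_pow (q : R) (u y : C) (k : nat) :
  (0 < q < 1)%R -> y <> 0 -> u <> 0 ->
  th q (u * (y / q ^ k)) * th q (u / (y / q ^ k)) =
  (y ^ 2 / q ^ k) ^ k * (th q (u * y) * th q (u / y)).
Proof.
  intros Hq Hy Hu. assert (Hq0 := Cq_nz q Hq).
  induction k as [|k IH].
  - simpl. replace (y / 1) with y by field. ring.
  - assert (Hqk := Cqn_nz q k Hq).
    replace (u * (y / q ^ S k)) with (u * (y / q ^ k) / q) by (simpl; field; auto).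
    replace (u / (y / q ^ S k)) with (u / (y / q ^ k) * q) by (simpl; field; auto).
    rewrite th_div_q, th_mult_q by auto using Cdiv_nz, Cmult_neq_0.
    transitivity (u * (y / q ^ k) / q * / (u / (y / q ^ k)) *
      (th q (u * (y / q ^ k)) * th q (u / (y / q ^ k)))); [ring|].
    rewrite IH, power_div_S by assumption. simpl Cpow. field. auto.
Qed.

(** In the variable y = q^k x the pole lies at y = u. Quasi-periodicity carries the thetas from x to
    y, and theta(u/y) = (y - u)/y times (q u/y, q y/u; q)_oo displays the simple zero; since y = q^k
    x, the quotient y / ((y - u) x) is 1 / (x - x0). The regular factor [F] is then evaluated at
    [x0]. *)
Lemma residue_at_pole (q : R) (a b c u : C) (m : nat) :
  (0 < q < 1)%R -> (q < Cmod u < 1)%R -> generic q (u ^ 2) ->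
  admissible q u a -> admissible q u b -> admissible q u c ->
  is_residue (integrand q a b c u) (u / q ^ S m) (res_term q a b c u (S m)).
Proof.
  intros Hq Hu Hg Ha Hb Hc. set (k := S m).
  assert (Hq0 := Cq_nz q Hq). assert (Hqk := Cqn_nz q k Hq).
  assert (Hu0 : u <> 0) by (apply Cmod_gt_0; lra).
  assert (HQ := qp_q_nz q Hq).
  assert (Hdown : forall p, admissible q u p -> qp q (p / u * q ^ k) <> 0)
    by (intros p Hp; apply admissible_down_nz; [assumption | apply Hu | assumption]).
  clearbody k.
  set (x0 := u / q ^ k). assert (Hx0 : x0 <> 0) by now apply Cdiv_nz.
  assert (Hy0 : q ^ k * x0 = u) by (unfold x0; field; assumption).
  set (den := fun x => weight_den q a b c x * (th q (u * (q ^ k * x)) *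
     (qp q (u / (q ^ k * x) * q) * qp q (q ^ k * x / u * q)))).
  set (F := fun x => (1 - 1 / x ^ 2) * ((q ^ k * x) ^ 2 / q ^ S k) ^ k * th q ((q ^ k * x) ^ 2)
                     / den x).
  assert (Hth2 : th q (u ^ 2) <> 0) by (apply th_generic_nz; auto using Cpow_nz).
  assert (Hden0 : den x0 = weight_den q a b c x0 * (th q (u ^ 2) * (qp q q * qp q q))).
  { unfold den. rewrite Hy0. replace (u / u * q) with (RtoC q) by (field; assumption).
    replace (u * u) with (u ^ 2) by ring. reflexivity. }
  assert (Hup : forall p, p * x0 = p * u / q ^ k) by (intros p; unfold x0, Cdiv; ring).
  assert (Hdn : forall p, p / x0 = p / u * q ^ k) by (intros p; unfold x0; field; auto).
  assert (Hw : weight_den q a b c x0 <> 0).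
  { assert (H : forall p, admissible q u p -> qp q (p * x0) * qp q (p / x0) <> 0).
    { intros p Hp. rewrite Hup, Hdn. apply Cmult_neq_0; [now apply admissible_up_nz | now apply Hdown]. }
    exact (Cmult_neq_0 _ _ (Cmult_neq_0 _ _ (H a Ha) (H b Hb)) (H c Hc)). }
  assert (Hdnz : den x0 <> 0) by (rewrite Hden0; auto using Cmult_neq_0).
  assert (Hy : holo_at (fun x => q ^ k * x) x0)
    by (apply holo_at_mult; [apply holo_at_const | apply holo_at_id]).
  assert (Hyn : q ^ k * x0 <> 0) by now rewrite Hy0.
  assert (Hden : holo_at den x0).
  { unfold den. apply holo_at_mult; [now apply holo_at_weight_den|].
    apply holo_at_mult; [|apply holo_at_mult].
    - apply (holo_at_th q (fun x => u * (q ^ k * x))); [assumption | | now apply Cmult_neq_0].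
      apply (holo_at_mult (fun _ => u)); [apply holo_at_const | assumption].
    - apply holo_at_qp; [assumption|].
      apply (holo_at_mult (fun x => u / (q ^ k * x)) (fun _ => RtoC q)); [|apply holo_at_const].
      apply (holo_at_div (fun _ => u)); [apply holo_at_const | assumption | assumption].
    - apply holo_at_qp; [assumption|].
      apply (holo_at_mult (fun x => q ^ k * x / u) (fun _ => RtoC q)); [|apply holo_at_const].
      apply (holo_at_div (fun x => q ^ k * x) (fun _ => u));
        [assumption | apply holo_at_const | assumption]. }
  replace (res_term q a b c u k) with (F x0).
  2:{ unfold F. rewrite Hden0, Hy0. unfold res_term, weight_den. rewrite !Hup, !Hdn.
      replace (1 / x0 ^ 2) with (RtoC q ^ k * q ^ k / u ^ 2)
        by (unfold x0; simpl; field; auto).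
      revert Hw. unfold weight_den. rewrite !Hup, !Hdn. intros Hw.
      replace (qp q q ^ 2 * (qp q (a * u / q ^ k) * qp q (a / u * q ^ k)) *
         (qp q (b * u / q ^ k) * qp q (b / u * q ^ k)) * (qp q (c * u / q ^ k) * qp q (c / u * q ^ k)))
       with (qp q q ^ 2 * (qp q (a * u / q ^ k) * qp q (a / u * q ^ k) *
         (qp q (b * u / q ^ k) * qp q (b / u * q ^ k)) * (qp q (c * u / q ^ k) * qp q (c / u * q ^ k))))
       by ring.
      generalize dependent (qp q (a * u / q ^ k) * qp q (a / u * q ^ k) *
         (qp q (b * u / q ^ k) * qp q (b / u * q ^ k)) * (qp q (c * u / q ^ k) * qp q (c / u * q ^ k))).
      clear - Hth2 HQ. generalize dependent (th q (u ^ 2)). generalize dependent (qp q q).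
      generalize ((u ^ 2 / q ^ S k) ^ k) (1 - RtoC q ^ k * q ^ k / u ^ 2). intros.
      field. auto. }
  apply residue_simple_pole.
  - unfold F. apply holo_at_div; [|assumption|assumption].
    apply holo_at_mult; [apply holo_at_mult|].
    + apply (holo_at_plus (fun _ => 1) (fun x => - (1 / x ^ 2))); [apply holo_at_const|].
      apply holo_at_ext_loc with (fun x => - (1) / x ^ 2).
      { apply filter_forall. intros x. unfold Cdiv. ring. }
      apply (holo_at_div (fun _ => - (1)) (fun x => x ^ 2));
        [apply holo_at_const | | now apply Cpow_nz].
      apply (holo_at_pow (fun y => y)), holo_at_id.
    + apply (holo_at_pow (fun x => (q ^ k * x) ^ 2 / q ^ S k)).
      apply (holo_at_mult (fun x => (q ^ k * x) ^ 2) (fun _ => / q ^ S k)); [|apply holo_at_const].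
      now apply (holo_at_pow (fun x => q ^ k * x)).
    + apply (holo_at_th q (fun x => (q ^ k * x) ^ 2)); [assumption | | now apply Cpow_nz].
      now apply (holo_at_pow (fun x => q ^ k * x)).
  - assert (L1 := Ccont_nonzero den x0 (holo_at_Ccont _ _ Hden) Hdnz).
    assert (L2 := Ccont_nonzero (fun x => x) x0 (Ccont_id x0) Hx0).
    cut (forall x : C, den x <> 0 -> x <> 0 -> x <> x0 -> integrand q a b c u x = F x / (x - x0)).
    { intros Hkey. apply (filter_imp _ _) with (2 := filter_and _ _ L1 L2).
      intros x [Hdx Hx] Hne. now apply Hkey. }
    clear L1 L2. intros x Hdx Hx Hne.
    set (y := q ^ k * x) in *. assert (Hyx : y <> 0) by now apply Cmult_neq_0.
    assert (Hxy : x = y / q ^ k) by (unfold y; field; assumption).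
    assert (Hyu : y - u <> 0).
    { apply Cminus_eq_contra. intros H. apply Hne. unfold x0. rewrite <- H. exact Hxy. }
    assert (Hxx : x - x0 = (y - u) / q ^ k) by (unfold x0; rewrite Hxy; field; assumption).
    assert (Hthu : th q (u / y) = (y - u) / y * (qp q (u / y * q) * qp q (y / u * q))).
    { unfold th. rewrite (qp_step q (u / y)) by assumption.
      replace (q / (u / y)) with (y / u * q) by (field; auto). field. assumption. }
    assert (Hpair := th_den_div_pow q u y k Hq Hyx Hu0).
    assert (Hsq := th_square_div_pow q y k Hq Hyx).
    rewrite <- Hxy in Hpair, Hsq. rewrite Hthu in Hpair.
    unfold den in Hdx. fold y in Hdx.
    assert (HV : (y ^ 2 / q ^ k) ^ k <> 0)
      by (apply Cpow_nz, Cdiv_nz; [now apply Cpow_nz | assumption]).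
    assert (D1 : weight_den q a b c x <> 0) by (intros H; apply Hdx; rewrite H; ring).
    assert (D2 : th q (u * y) <> 0) by (intros H; apply Hdx; rewrite H; ring).
    assert (D3 : qp q (u / y * q) * qp q (y / u * q) <> 0) by (intros H; apply Hdx; rewrite H; ring).
    assert (D4 : th q (u * x) * th q (u / x) <> 0).
    { rewrite Hpair. apply Cmult_neq_0; [assumption|]. apply Cmult_neq_0; [assumption|].
      apply Cmult_neq_0; [now apply Cdiv_nz | assumption]. }
    rewrite integrand_weight; [|assumption|assumption|exact (Cmult_neq_0 _ _ D1 D4)].
    unfold F, den. fold y. rewrite Hxx. clear Hxx.
    change (weight q a b c u x) with
      (qp q (x ^ 2) * qp q (1 / x ^ 2) /
        (weight_den q a b c x * (th q (u * x) * th q (u / x)))).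
    replace (qp q (x ^ 2) * qp q (1 / x ^ 2)) with ((1 - 1 / x ^ 2) * th q (x ^ 2)).
    2:{ unfold th. rewrite (qp_step q (1 / x ^ 2)) by assumption.
        replace (q / x ^ 2) with (1 / x ^ 2 * q) by (field; assumption). ring. }
    rewrite Hpair, Hsq. clear Hpair Hsq Hdx Hdnz Hden0 Hden F den D4 Hthu.
    generalize dependent (weight_den q a b c x). generalize dependent (th q (u * y)).
    generalize dependent (qp q (u / y * q) * qp q (y / u * q)).
    generalize dependent ((y ^ 2 / q ^ k) ^ k). generalize (1 - 1 / x ^ 2).
    generalize ((y ^ 2 / q ^ S k) ^ k) (th q (y ^ 2)). rewrite Hxy. clear - Hyx Hyu Hqk. intros.
    field. repeat split; assumption.
Qed.

(** * The recurrence in a, its iteration and the limit *)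

Definition total (q : R) (a b c u : C) : C :=
  circ (weight q a b c u) 0 1 / (4 * PI) + Csum (fun k => res_term q a b c u (S k)).

Lemma RtoC_PI_nz : RtoC PI <> 0.
Proof. intros H. apply RtoC_inj in H. generalize PI_RGT_0. lra. Qed.

(** For k >= 1 the boundary term is the residue times the factors 1 - p q^k / u, p = a, b, c,
    divided by 1 - q^(2k) / u^2. These extra factors converge, and the residues tend to 0 because
    they are summable. *)
Lemma bdry_term_lim (q : R) (a b c u : C) :
  (0 < q < 1)%R -> (q < Cmod u < 1)%R ->
  admissible q u a -> admissible q u b -> admissible q u c ->
  Clim (bdry_term q a b c u) 0.
Proof.
  intros Hq Hu Ha Hb Hc. apply Clim_shift.
  assert (Hu0 : u <> 0) by (apply Cmod_gt_0; lra).
  assert (Hf : forall p, Clim (fun k => 1 - p / u * q ^ S k) (1 - p / u * 0)).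
  { intros p. apply Clim_minus; [apply Clim_const|]. apply Clim_mult; [apply Clim_const|].
    apply (Clim_subseq _ _ S); [lia | now apply Clim_qn]. }
  assert (Hs : Clim (fun k => RtoC q ^ S k) 0)
    by (apply (Clim_subseq _ _ S); [lia | now apply Clim_qn]).
  assert (Hnz : forall k, 1 - RtoC q ^ S k * q ^ S k / u ^ 2 <> 0).
  { intros k.
    assert (H : 1 - RtoC q ^ S k / u <> 0 /\ 1 - -(1) * (RtoC q ^ S k / u) <> 0).
    { assert (Hm : (Cmod (RtoC q ^ S k / u) < 1)%R).
      { rewrite Cmod_div, Cmod_qn by assumption. apply Rmult_lt_reg_r with (Cmod u); [lra|].
        replace (q ^ S k / Cmod u * Cmod u)%R with (q ^ S k)%R by (field; lra).
        simpl. generalize (qn_le1 q k Hq). nra. }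
      split; apply one_minus_nz; [assumption|].
      rewrite Cmod_mult, Cmod_opp, Cmod_1, Rmult_1_l. assumption. }
    replace (1 - RtoC q ^ S k * q ^ S k / u ^ 2)
      with ((1 - RtoC q ^ S k / u) * (1 - -(1) * (RtoC q ^ S k / u))) by (field; assumption).
    now apply Cmult_neq_0. }
  apply Clim_ext with (fun k => res_term q a b c u (S k) *
    ((1 - a / u * q ^ S k) * (1 - b / u * q ^ S k) * (1 - c / u * q ^ S k))
    * / (1 - RtoC q ^ S k * q ^ S k / u ^ 2)).
  - intros k. unfold res_term, bdry_term.
    assert (Hdn : forall p, qp q (p / u * q ^ S k) = (1 - p / u * q ^ S k) * qp q (p / u * q ^ S (S k))).
    { intros p. rewrite (qp_step q (p / u * q ^ S k)) by assumption. do 2 f_equal. simpl. ring. }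
    assert (H : forall p, admissible q u p -> qp q (p * u / q ^ S k) <> 0 /\
       (1 - p / u * q ^ S k <> 0 /\ qp q (p / u * q ^ S (S k)) <> 0)).
    { intros p Hp. split; [now apply admissible_up_nz|].
      assert (H1 := admissible_down_nz q u p k Hq (proj1 Hu) Hp). rewrite Hdn in H1.
      split; intros H; apply H1; rewrite H; ring. }
    rewrite !Hdn.
    destruct (H a Ha) as [A1 [A2 A3]]. destruct (H b Hb) as [B1 [B2 B3]].
    destruct (H c Hc) as [C1 [C2 C3]]. specialize (Hnz k). assert (HQ := qp_q_nz q Hq).
    clear - Hnz A1 A2 A3 B1 B2 B3 C1 C2 C3 HQ.
    generalize dependent (1 - RtoC q ^ S k * q ^ S k / u ^ 2).
    generalize dependent (qp q (a * u / q ^ S k)). generalize dependent (qp q (b * u / q ^ S k)).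
    generalize dependent (qp q (c * u / q ^ S k)).
    generalize dependent (qp q (a / u * q ^ S (S k))).
    generalize dependent (qp q (b / u * q ^ S (S k))).
    generalize dependent (qp q (c / u * q ^ S (S k))).
    generalize dependent (1 - a / u * q ^ S k). generalize dependent (1 - b / u * q ^ S k).
    generalize dependent (1 - c / u * q ^ S k). generalize dependent (qp q q).
    generalize ((u ^ 2 / q ^ S (S k)) ^ S k). intros. field. repeat split; assumption.
  - eapply Clim_eq.
    + apply Clim_mult; [apply Clim_mult|].
      * apply summable_Clim0. now apply res_summable.
      * apply Clim_mult; [apply Clim_mult|]; apply Hf.
      * apply Clim_inv with (l := 1 - 0 * 0 * / u ^ 2).
        -- rewrite !Cmult_0_l. replace (1 - 0) with (RtoC 1) by ring. exact C1_nz.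
        -- apply Clim_minus; [apply Clim_const|]. apply Clim_mult; [|apply Clim_const].
           now apply Clim_mult.
    + ring.
Qed.

(** The integrals contribute 4 pi times [bdry_term] at 0, from the two poles in the annulus, and the
    telescoping residues contribute minus [bdry_term] at 0. The division by 4 pi in [total] makes
    them cancel. *)
Lemma total_recurrence (q : R) (a b c u : C) :
  (0 < q < 1)%R -> (q < Cmod u < 1)%R -> generic q (u ^ 2) ->
  admissible q u a -> admissible q u b -> admissible q u c ->
  (1 - a * b) * (1 - a * c) * total q a b c u = b * c * total q (a * q) b c u.
Proof.
  intros Hq Hu Hg Ha Hb Hc. assert (Hq0 := Cq_nz q Hq).
  assert (Hu0 : u <> 0) by (apply Cmod_gt_0; lra).
  set (v := q / u).
  assert (Huv : u * v = q) by (unfold v; field; assumption).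
  assert (Hv : (q < Cmod v < 1)%R).
  { unfold v. rewrite Cmod_div, Cmod_q by assumption. split.
    - apply Rmult_lt_reg_r with (Cmod u); [lra|].
      replace (q / Cmod u * Cmod u)%R with q by (field; lra). nra.
    - apply Rmult_lt_reg_r with (Cmod u); [lra|].
      replace (q / Cmod u * Cmod u)%R with q by (field; lra). lra. }
  assert (Hne : u <> v).
  (* Equality of u and q/u would mean u^2 = q. *)
  { intros H. apply (Hg 1%Z). rewrite powerRZ_1, <- Huv, <- H. ring. }
  assert (Hgv : generic q (v ^ 2)).
  { replace (v ^ 2) with (q / u ^ 2 * q ^ 1) by (unfold v; simpl; field; assumption).
    apply generic_mult_pow; [assumption|]. apply generic_q_div; auto using Cpow_nz. }
  assert (Haq : admissible q u (a * q)).
  { rewrite <- (Cpow_1_r q). now apply admissible_mult_pow. }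
  destruct (Ha) as [_ [Ha1 _]]. destruct (Hb) as [_ [Hb1 _]]. destruct (Hc) as [_ [Hc1 _]].
  destruct (Haq) as [_ [Haq1 _]].
  assert (S1 := res_summable q a b c u Hq Hu Ha Hb Hc).
  assert (S2 := res_summable q (a * q) b c u Hq Hu Haq Hb Hc).
  assert (HS : (1 - a * b) * (1 - a * c) * Csum (fun k => res_term q a b c u (S k))
    - b * c * Csum (fun k => res_term q (a * q) b c u (S k)) = - bdry_term q a b c u 0).
  { rewrite <- !Csum_scal, <- Csum_minus by auto using summable_scal.
    rewrite (Csum_ext _ (fun k => bdry_term q a b c u (S k) - bdry_term q a b c u k))
      by (intros k; now apply res_bdry_telescope).
    apply Csum_telescope; [|now apply bdry_term_lim].
    apply summable_ext with (fun k => (1 - a * b) * (1 - a * c) * res_term q a b c u (S k)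
      + - (b * c) * res_term q (a * q) b c u (S k)).
    - intros k. rewrite <- res_bdry_telescope by assumption. ring.
    - apply summable_plus; now apply summable_scal. }
  assert (HJ : (1 - a * b) * (1 - a * c) * circ (weight q a b c u) 0 1
    - b * c * circ (weight q (a * q) b c u) 0 1 = 4 * PI * bdry_term q a b c u 0).
  { rewrite <- (contour_fun_shift q a b c u v) by assumption.
    assert (W1 : forall t, Ccont (weight q a b c u) (circ_pt 0 1 t))
      by (intros t; now apply weight_unit_cont).
    assert (W2 : forall t, Ccont (weight q (a * q) b c u) (circ_pt 0 1 t))
      by (intros t; now apply weight_unit_cont).
    assert (Hsc : circ (contour_fun q a b c u v) 0 q
                  = circ (fun x => contour_fun q a b c u v (x * q)) 0 1).
    { unfold circ, mean_re.
      assert (Hp : forall t, circ_pt 0 q t = circ_pt 0 1 t * q) by (intros t; unfold circ_pt; ring).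
      f_equal; apply RInt_ext; intros t _; now rewrite Hp. }
    rewrite Hsc.
    assert (C1 : forall t, Ccont (contour_fun q a b c u v) (circ_pt 0 1 t))
      by (intros t; apply contour_fun_cont; auto).
    assert (C2 : forall t, Ccont (fun x => contour_fun q a b c u v (x * q)) (circ_pt 0 1 t)).
    { intros t. apply (Ccont_comp (fun x => x * q) (contour_fun q a b c u v)).
      - apply Ccont_mult; [apply Ccont_id | apply Ccont_const].
      - replace (circ_pt 0 1 t * q) with (circ_pt 0 q t) by (unfold circ_pt; ring).
        apply contour_fun_cont; auto. }
    assert (Hminus : forall (k h : C -> C) (x y : C),
      (forall t, Ccont k (circ_pt 0 1 t)) -> (forall t, Ccont h (circ_pt 0 1 t)) ->
      x * circ k 0 1 - y * circ h 0 1 = circ (fun z => x * k z + - y * h z) 0 1).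
    { intros k h x y Hk Hh.
      rewrite (circ_plus (fun z => x * k z) (fun z => - y * h z)), !circ_scal; try assumption.
      - ring.
      - intros t. apply Ccont_mult; [apply Ccont_const | apply Hk].
      - intros t. apply Ccont_mult; [apply Ccont_const | apply Hh]. }
    transitivity (1 * circ (contour_fun q a b c u v) 0 1
      - 1 * circ (fun x => contour_fun q a b c u v (x * q)) 0 1); [|ring].
    rewrite !Hminus by assumption. apply circ_ext. intros t.
    assert (Hx : Cmod (circ_pt 0 1 t) = 1%R) by (apply Cmod_circ_pt_0; lra).
    set (x := circ_pt 0 1 t) in *.
    transitivity ((1 - a * b) * (1 - a * c) * weight q a b c u x
                  - b * c * weight q (a * q) b c u x); [ring|].
    rewrite (weight_recurrence q a b c u v x); try assumption; try apply Hu; try apply Hv. ring. }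
  unfold total.
  set (J1 := circ (weight q a b c u) 0 1) in *. set (J2 := circ (weight q (a * q) b c u) 0 1) in *.
  set (T1 := Csum (fun k => res_term q a b c u (S k))) in *.
  set (T2 := Csum (fun k => res_term q (a * q) b c u (S k))) in *.
  assert (HPI := RtoC_PI_nz).
  transitivity (((1 - a * b) * (1 - a * c) * J1 - b * c * J2) / (4 * PI)
     + ((1 - a * b) * (1 - a * c) * T1 - b * c * T2) + b * c * (J2 / (4 * PI) + T2)).
  - field. assumption.
  - rewrite HJ, HS. field. assumption.
Qed.

Lemma total_iterate (q : R) (a b c u : C) (n : nat) :
  (0 < q < 1)%R -> (q < Cmod u < 1)%R -> generic q (u ^ 2) ->
  admissible q u a -> admissible q u b -> admissible q u c ->
  qpn q n (a * b) * qpn q n (a * c) * total q a b c u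
  = (b * c) ^ n * total q (a * q ^ n) b c u.
Proof.
  intros Hq Hu Hg Ha Hb Hc. induction n as [|n IH].
  - simpl. rewrite !Cmult_1_r. ring.
  - simpl qpn.
    transitivity ((1 - a * b * q ^ n) * (1 - a * c * q ^ n)
      * (qpn q n (a * b) * qpn q n (a * c) * total q a b c u)); [ring|].
    rewrite IH.
    assert (H := total_recurrence q (a * q ^ n) b c u Hq Hu Hg
      (admissible_mult_pow q u a n Hq Ha) Hb Hc).
    transitivity ((b * c) ^ n * ((1 - a * q ^ n * b) * (1 - a * q ^ n * c) *
      total q (a * q ^ n) b c u)); [ring|].
    rewrite H. replace (a * q ^ n * q) with (a * q ^ S n) by (simpl; ring).
    simpl Cpow. ring.
Qed.

(** The constant is 4 pi instead of 2 pi because real and imaginary parts are bounded separately. *)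
Lemma circ_bound (h : C -> C) (z0 : C) (r M : R) :
  (forall t, Ccont h (circ_pt z0 r t)) ->
  (forall t, (0 <= t <= 2 * PI)%R -> (Cmod (h (circ_pt z0 r t)) <= M)%R) ->
  (Cmod (circ h z0 r) <= 4 * PI * M)%R.
Proof.
  intros Hc HM. assert (Hpi := PI_RGT_0).
  assert (H1 := norm_RInt_le_const (V := R_NormedModule) _ 0 (2 * PI) _ M ltac:(lra)
    (fun t Ht => Rle_trans _ _ _ (abs_fst_le_Cmod _) (HM t Ht))
    (RInt_correct (V := R_CompleteNormedModule) _ _ _ (circ_ex_RInt h z0 r 0 (2 * PI) Hc))).
  assert (H2 := norm_RInt_le_const (V := R_NormedModule) _ 0 (2 * PI) _ M ltac:(lra)
    (fun t Ht => Rle_trans _ _ _ (abs_snd_le_Cmod _) (HM t Ht))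
    (RInt_correct (V := R_CompleteNormedModule) _ _ _ (circ_ex_RInt_snd h z0 r 0 (2 * PI) Hc))).
  eapply Rle_trans; [apply Cmod_le_abs|].
  replace (4 * PI * M)%R with ((2 * PI - 0) * M + (2 * PI - 0) * M)%R by ring.
  exact (Rplus_le_compat _ _ _ _ H1 H2).
Qed.

Lemma circ_cont_bounded (h : C -> C) (z0 : C) (r : R) :
  (forall t, Ccont h (circ_pt z0 r t)) ->
  exists M : R, forall t, (0 <= t <= 2 * PI)%R -> (Cmod (h (circ_pt z0 r t)) <= M)%R.
Proof.
  intros Hc.
  destruct (continuity_ab_maj (fun t => (Rabs (fst (h (circ_pt z0 r t)))
    + Rabs (snd (h (circ_pt z0 r t))))%R) 0 (2 * PI)) as [tm [Htm _]].
  - generalize PI_RGT_0. lra.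
  - intros t _. destruct (circ_cont h z0 r t (Hc t)) as [H1 H2].
    apply (continuity_pt_plus (fun t => Rabs (fst (h (circ_pt z0 r t))))
      (fun t => Rabs (snd (h (circ_pt z0 r t)))));
      apply (continuity_pt_comp _ Rabs); try apply Rcontinuity_abs.
    + exact (continuity_2d_fst _ _ _ H1).
    + exact (continuity_2d_fst _ _ _ H2).
  - eexists. intros t Ht. eapply Rle_trans; [apply Cmod_le_abs|]. exact (Htm t Ht).
Qed.

Lemma qpn_unit_bounded (q : R) (a : C) :
  (0 < q < 1)%R -> exists K : R, forall n y, Cmod y = Cmod a -> (Cmod (qpn q n y) <= K)%R.
Proof.
  intros Hq. destruct (Clim_bounded _ _ (Clim_qpn q (- RtoC (Cmod a)) Hq)) as [K HK].
  exists K. intros n y Hy. eapply Rle_trans; [now apply Cmod_qpn_upper|]. rewrite Hy. apply HK.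
Qed.

(** Only the a-products change when a becomes a q^n, and they do so by finite products that
    [qpn_unit_bounded] controls. *)
Lemma weight_scaled (q : R) (a b c u x : C) (n : nat) :
  (0 < q < 1)%R -> Cmod x = 1%R ->
  (Cmod a < 1)%R -> (Cmod b < 1)%R -> (Cmod c < 1)%R -> th q (u * x) * th q (u / x) <> 0 ->
  weight q (a * q ^ n) b c u x = qpn q n (a * x) * qpn q n (a / x) * weight q a b c u x.
Proof.
  intros Hq Hx Ha Hb Hc Hth. assert (Hx0 : x <> 0) by (apply Cmod_gt_0; lra).
  unfold weight. rewrite (qp_qpn q n (a * x)), (qp_qpn q n (a / x)) by assumption.
  replace (a * q ^ n * x) with (a * x * q ^ n) by ring.
  replace (a * q ^ n / x) with (a / x * q ^ n) by (unfold Cdiv; ring).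
  assert (H : forall p, (Cmod p < 1)%R -> qp q (p * x) <> 0 /\ qp q (p / x) <> 0).
  { intros p Hp. split; apply qp_nz_disc; try assumption;
      [now apply Cmod_unit_mult | now apply Cmod_unit_div]. }
  destruct (H a Ha) as [A1 A2]. destruct (H b Hb) as [B1 B2]. destruct (H c Hc) as [C1 C2].
  rewrite (qp_qpn q n) in A1 by assumption. rewrite (qp_qpn q n) in A2 by assumption.
  clear H.
  assert (A3 : qpn q n (a * x) <> 0) by (intros H; apply A1; rewrite H; ring).
  assert (A4 : qp q (a * x * q ^ n) <> 0) by (intros H; apply A1; rewrite H; ring).
  assert (A5 : qpn q n (a / x) <> 0) by (intros H; apply A2; rewrite H; ring).
  assert (A6 : qp q (a / x * q ^ n) <> 0) by (intros H; apply A2; rewrite H; ring).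
  clear A1 A2. clear - A3 A4 A5 A6 B1 B2 C1 C2 Hth.
  generalize dependent (qpn q n (a * x)). generalize dependent (qpn q n (a / x)).
  generalize dependent (qp q (a * x * q ^ n)). generalize dependent (qp q (a / x * q ^ n)).
  generalize dependent (qp q (b * x)). generalize dependent (qp q (b / x)).
  generalize dependent (qp q (c * x)). generalize dependent (qp q (c / x)).
  generalize dependent (th q (u * x) * th q (u / x)).
  generalize (qp q (x ^ 2) * qp q (1 / x ^ 2)). intros. field. repeat split; assumption.
Qed.

(** On the unit circle the weight with a q^n is bounded uniformly in n and x, so the factor (bc)^n
    forces the limit 0. *)
Lemma scaled_integral_lim (q : R) (a b c u : C) :
  (0 < q < 1)%R -> (q < Cmod u < 1)%R ->
  (Cmod a < 1)%R -> (Cmod b < 1)%R -> (Cmod c < 1)%R -> (Cmod (b * c) < 1)%R ->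
  Clim (fun n => (b * c) ^ n * circ (weight q (a * q ^ n) b c u) 0 1) 0.
Proof.
  intros Hq Hu Ha Hb Hc Hbc.
  destruct (circ_cont_bounded (weight q a b c u) 0 1) as [M HM].
  { intros t. now apply weight_unit_cont. }
  destruct (qpn_unit_bounded q a Hq) as [K HK].
  assert (Ha' : forall n, (Cmod (a * q ^ n) < 1)%R).
  { intros n. rewrite Cmod_mult, Cmod_qn by assumption.
    apply Rle_lt_trans with (Cmod a * 1)%R; [|now rewrite Rmult_1_r].
    apply Rmult_le_compat_l; [apply Cmod_ge_0 | apply qn_le1; assumption]. }
  apply Clim_squeeze0 with (fun n => Cmod (b * c) ^ n * (4 * PI * (K * K * M)))%R.
  - intros n. rewrite Cmod_mult, Cmod_pow.
    apply Rmult_le_compat_l; [apply pow_le, Cmod_ge_0|].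
    apply circ_bound; [intros t; now apply weight_unit_cont|]. intros t Ht.
    assert (Hx : Cmod (circ_pt 0 1 t) = 1%R) by (apply Cmod_circ_pt_0; lra).
    assert (Hx0 : circ_pt 0 1 t <> 0) by (apply Cmod_gt_0; lra).
    rewrite weight_scaled by (try assumption; now apply theta_den_unit_nz).
    rewrite !Cmod_mult.
    apply Rmult_le_compat; [apply Rmult_le_pos; apply Cmod_ge_0 | apply Cmod_ge_0 | |now apply HM].
    apply Rmult_le_compat; try apply Cmod_ge_0; apply HK.
    + now rewrite Cmod_mult, Hx, Rmult_1_r.
    + rewrite Cmod_div, Hx by assumption. field.
  - replace 0%R with (0 * (4 * PI * (K * K * M)))%R by ring.
    apply (is_lim_seq_scal_r _ (4 * PI * (K * K * M)) 0%R).
    apply is_lim_seq_geom. rewrite Rabs_pos_eq; [assumption | apply Cmod_ge_0].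
Qed.

Lemma total_value (q : R) (a b c u : C) :
  (0 < q < 1)%R -> (q < Cmod u < 1)%R -> generic q (u ^ 2) ->
  admissible q u a -> admissible q u b -> admissible q u c ->
  qp q (a * b) * qp q (a * c) * total q a b c u
  = th q (a * b * c * u) /
     (qp q q * qp q (b * c) * (th q (a * u) * th q (b * u) * th q (c * u))).
Proof.
  intros Hq Hu Hg Ha Hb Hc.
  apply (Clim_unique (fun n => qpn q n (a * b) * qpn q n (a * c) * total q a b c u)).
  - apply Clim_mult; [|apply Clim_const]. apply Clim_mult; now apply Clim_qpn.
  - apply Clim_ext with (fun n => (b * c) ^ n * circ (weight q (a * q ^ n) b c u) 0 1 * / (4 * PI)
      + (b * c) ^ n * Csum (fun k => res_term q (a * q ^ n) b c u (S k))).
    + intros n. rewrite total_iterate by assumption. unfold total, Cdiv. ring.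
    + eapply Clim_eq.
      * apply Clim_plus; [|now apply scaled_residue_sum_lim].
        apply Clim_mult; [|apply Clim_const]. apply scaled_integral_lim; try assumption.
        -- apply Ha.
        -- apply Hb.
        -- apply Hc.
        -- destruct Hb as [Hb0 [Hb1 _]]. destruct Hc as [Hc0 [Hc1 _]]. now apply Cmod_bc.
      * rewrite Cmult_0_l. apply Cplus_0_l.
Qed.

Theorem theorem5p5 (q : R) (a b c u : C)
  (hq : (0 < q < 1)%R)
  (ha0 : a <> 0) (hb0 : b <> 0) (hc0 : c <> 0) (hu0 : u <> 0)
  (hu : (q < Cmod u < 1)%R)
  (ha : (Cmod a < 1)%R) (hb : (Cmod b < 1)%R) (hc : (Cmod c < 1)%R)
  (* genericity: the denominator theta(au,bu,cu) does not vanish, and the zeros of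
     theta(ux,u/x) in x are simple *)
  (gau : forall m : Z, a * u <> powerRZ q m)
  (gbu : forall m : Z, b * u <> powerRZ q m)
  (gcu : forall m : Z, c * u <> powerRZ q m)
  (guu : forall m : Z, u ^ 2 <> powerRZ q m) :
  exists (I sigma : C) (res : nat -> C),
    is_circle_int (integrand q a b c u) 0 1 I /\
    (forall k : nat, (1 <= k)%nat ->
       is_residue (integrand q a b c u) (u / q ^ k) (res k)) /\
    is_series (K := C_AbsRing) (V := C_NormedModule)
      (fun k : nat => res (S k)) sigma /\
    1 / (4 * PI * Ci) * I + sigma =
      1 / qpochs q [RtoC q; a * b; a * c; b * c] *
      (theta q (a * b * c * u) / thetas q [a * u; b * u; c * u]).
Proof.
  assert (Ha : admissible q u a) by (repeat split; assumption).
  assert (Hb : admissible q u b) by (repeat split; assumption).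
  assert (Hc : admissible q u c) by (repeat split; assumption).
  exists (Ci * circ (weight q a b c u) 0 1), (Csum (fun k => res_term q a b c u (S k))),
    (res_term q a b c u).
  split; [now apply circ_integrand|]. split; [|split].
  - intros [|m] Hm; [lia|]. now apply residue_at_pole.
  - now apply Csum_correct, res_summable.
  - assert (HV := total_value q a b c u hq hu guu Ha Hb Hc).
    assert (HPI := RtoC_PI_nz).
    replace (1 / (4 * PI * Ci) * (Ci * circ (weight q a b c u) 0 1))
      with (circ (weight q a b c u) 0 1 / (4 * PI))
      by (field; split; [exact Ci_nz | assumption]).
    fold (total q a b c u).
    unfold qpochs, thetas, map, Cprod, fold_right. rewrite !th_theta, !qpoch_qp by assumption.
    assert (Hmul : forall x y : C, (Cmod x < 1)%R -> (Cmod y < 1)%R -> qp q (x * y) <> 0).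
    { intros x y Hx Hy. apply qp_nz_disc; [assumption|]. rewrite Cmod_mult.
      generalize (Cmod_ge_0 x) (Cmod_ge_0 y). nra. }
    assert (Hab := Hmul a b ha hb). assert (Hac := Hmul a c ha hc). assert (Hbc := Hmul b c hb hc).
    assert (HQ := qp_q_nz q hq).
    assert (Hta := th_generic_nz q _ hq (Cmult_neq_0 _ _ ha0 hu0) gau).
    assert (Htb := th_generic_nz q _ hq (Cmult_neq_0 _ _ hb0 hu0) gbu).
    assert (Htc := th_generic_nz q _ hq (Cmult_neq_0 _ _ hc0 hu0) gcu).
    (* This restores the form of [total_value], where the two products obtained from iterating in a
       stand on the left. *)
    apply Cmult_eq_reg_l with (qp q (a * b) * qp q (a * c)); [now apply Cmult_neq_0|].
    rewrite HV. clear - Hab Hac Hbc HQ Hta Htb Htc.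
    generalize dependent (qp q (a * b)). generalize dependent (qp q (a * c)).
    generalize dependent (qp q (b * c)). generalize dependent (qp q q).
    generalize dependent (th q (a * u)). generalize dependent (th q (b * u)).
    generalize dependent (th q (c * u)). generalize (th q (a * b * c * u)). intros.
    field. repeat split; assumption.
Qed.
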